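(* Let $p\equiv 5\pmod 8$ be a prime and $\chi$ a Dirichlet character modulo $p$ of exact order $4$. Put $\mathcal{F}_\chi(n)=\sum_{j=0}^n\delta_\chi(j)\delta_{\overline\chi}(n-j)$ and $\mathcal{H}_\chi(n)=\sum_{j=0}^n\delta_\chi(j)\delta_\chi(n-j)$, and let $\alpha=\frac{|\delta_\chi(0)|^2}{\sigma'_p(0)}$ and $\alpha'=\frac{\delta_\chi(0)^2}{\tilde\sigma_p(0)}$. (a) $\displaystyle\lim_{n\to\infty,\ p\nmid n}\frac{\mathcal{F}_\chi(n)}{\sigma'_p(n)}=\alpha$. (b) There exists $\gamma\in\mathbb{C}$ such that, for each fixed value $\varepsilon\in\{1,-1\}$ of the Kronecker symbol, $\displaystyle\lim_{n\to\infty,\ p\nmid n,\ (p/n)=\varepsilon}\frac{\mathcal{H}_\chi(n)}{\tilde\sigma_p(n)}=\alpha'+\varepsilon\gamma$, i.e. $\frac{\mathcal{H}_\chi(n)}{\tilde\sigma_p(n)}\to\alpha'+\left(\frac{p}{n}\right)\gamma$ as $n\to\infty$ with $p\nmid n$.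
   Context: The bar denotes complex conjugation. $\delta_\chi(n)=\sum_{0<d\mid n}\chi(d)$ for $n>0$, $\delta_\chi(0)=-\frac{1}{2p}\sum_{a=1}^{p-1}\chi(a)a$. $\sigma'_p(n)=\sum_{0<d\mid n,\ p\nmid d}d$ for $n>0$, $\sigma'_p(0)=\frac{p-1}{24}$. $\tilde\sigma_p(n)=\sum_{0<d\mid n}\left(\frac pd\right)d$ for $n>0$, $\tilde\sigma_p(0)=-\frac14B_{2,\psi}$, where $\left(\frac{p}{\cdot}\right)$ is the Kronecker symbol, $\psi=\chi^2=\left(\frac p\cdot\right)$, and $B_{2,\psi}$ is the generalized Bernoulli number of $\psi$. *)

(* Defs.v *)
From HB Require Import structures.
From mathcomp Require Import all_boot all_order all_algebra.

Set Implicit Arguments.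
Unset Strict Implicit.
Unset Printing Implicit Defensive.

Import Order.TTheory GRing.Theory Num.Theory.

Local Open Scope ring_scope.

Section DirichletCharacters.

Variable C : numClosedFieldType.

Definition dirichlet_character (N : nat) (chi : int -> C) : Prop :=
  [/\ chi 1 = 1,
      forall a b : int, chi (a * b) = chi a * chi b,
      forall a : int, chi (a + N%:Z) = chi a
    & forall a : int, (chi a != 0) = coprimez a N%:Z].

Definition principal_character (N : nat) : int -> C :=
  fun a => (coprimez a N%:Z)%:R.

Definition has_exact_order (N : nat) (chi : int -> C) (k : nat) : Prop :=
  [/\ (0 < k)%N,
      forall a : int, chi a ^+ k = principal_character N a
    & forall j : nat, (0 < j < k)%N ->
        ~ (forall a : int, chi a ^+ j = principal_character N a)].

Definition conj_character (chi : int -> C) : int -> C := fun a => (chi a)^*.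

End DirichletCharacters.

Definition legendre (a : int) (q : nat) : int :=
  if (q%:Z %| a)%Z then 0
  else if [exists x : 'I_q, ((x%:Z) ^+ 2 == a %[mod q%:Z])%Z] then 1 else -1.

Definition kronecker_prime (a : int) (q : nat) : int :=
  if q == 2%N then
    if (2 %| a)%Z then 0
    else if ((a %% 8)%Z == 1) || ((a %% 8)%Z == 7) then 1 else -1
  else legendre a q.

(* (a/n) for n = u * \prod_q q^(e_q) with u = +1 or -1; the sign contributes
   (a/-1) = -1 exactly when a < 0, and (a/0) = 1 exactly when a = +1 or -1 *)
Definition kronecker (a n : int) : int :=
  if n == 0 then (`|a|%N == 1%N)%:R
  else (if (n < 0) && (a < 0) then -1 else 1)
       * \prod_(q <- primes `|n|) kronecker_prime a q ^+ logn q `|n|.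

Section GeneralizedBernoulli.

Variables (C : numClosedFieldType) (f : nat) (chi : int -> C).

(* B_{0,chi}, ..., B_{n-1,chi} *)
Fixpoint gen_bernoulli_seq (n : nat) : seq C :=
  if n is m.+1 then
    let s := gen_bernoulli_seq m in
    rcons s (m`!%:R / f%:R *
      ((\sum_(1 <= a < f.+1) chi a%:Z * a%:R ^+ m) / m`!%:R
       - \sum_(k < m) s`_k / k`!%:R * (f%:R ^+ (m.+1 - k) / (m.+1 - k)`!%:R)))
  else [::].

(* Defined by
     \sum_(1 <= a <= f) chi(a) t e^(a t) / (e^(f t) - 1)
       = \sum_(n >= 0) B_{n,chi} t^n / n!,
   see gen_bernoulliP. *)
Definition gen_bernoulli (n : nat) : C := (gen_bernoulli_seq n.+1)`_n.

Lemma size_gen_bernoulli_seq n : size (gen_bernoulli_seq n) = n.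
Proof. by elim: n => //= n IHn; rewrite size_rcons IHn. Qed.

Lemma nth_gen_bernoulli_seq n k :
  (k < n)%N -> (gen_bernoulli_seq n)`_k = gen_bernoulli k.
Proof.
elim: n => // n IHn; rewrite ltnS leq_eqVlt => /predU1P[-> // | ltkn].
by rewrite /= nth_rcons size_gen_bernoulli_seq ltkn IHn.
Qed.

(* Coefficients of t^(n+1) in
     \sum_(1 <= a <= f) chi(a) t e^(a t)
       = (\sum_(n >= 0) B_{n,chi} t^n / n!) * (e^(f t) - 1). *)
Lemma gen_bernoulliP n : (0 < f)%N ->
  \sum_(1 <= a < f.+1) chi a%:Z * (a%:R ^+ n / n`!%:R)
  = \sum_(k < n.+1) gen_bernoulli k / k`!%:R
                    * (f%:R ^+ (n.+1 - k) / (n.+1 - k)`!%:R).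
Proof.
move=> f_gt0; have fN0 : f%:R != 0 :> C by rewrite pnatr_eq0 -lt0n.
have nN0 : n`!%:R != 0 :> C by rewrite pnatr_eq0 -lt0n fact_gt0.
rewrite big_ord_recr /= subSnn expr1 divr1.
rewrite {2}/gen_bernoulli /= nth_rcons size_gen_bernoulli_seq ltnn eqxx.
under [in RHS]eq_bigr => k _ do rewrite -(nth_gen_bernoulli_seq (ltn_ord k)).
set S := \sum_(k < n) _; set T := \sum_(1 <= a < f.+1) chi a%:Z * a%:R ^+ n.
have -> : n`!%:R / f%:R * (T / n`!%:R - S) / n`!%:R * f%:R = T / n`!%:R - S.
  by rewrite mulrAC [_ * _ * f%:R]mulrAC divfK // mulrAC mulfV // mul1r.
rewrite addrC subrK /T mulr_suml.
by apply: eq_bigr => a _; rewrite mulrA.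
Qed.

End GeneralizedBernoulli.

Section DivisorSums.

Variables (C : numClosedFieldType) (p : nat).

Definition delta (chi : int -> C) (n : nat) : C :=
  if n == 0%N then - (2 * p%:R)^-1 * \sum_(1 <= a < p) chi a%:Z * a%:R
  else \sum_(d <- divisors n) chi d%:Z.

Definition sigma' (n : nat) : C :=
  if n == 0%N then (p%:R - 1) / 24
  else \sum_(d <- divisors n | ~~ (p %| d)%N) d%:R.

Definition kronecker_character : int -> C :=
  fun n => (kronecker p%:Z n)%:~R.

Definition sigma_tilde (n : nat) : C :=
  if n == 0%N then - (1 / 4) * gen_bernoulli p kronecker_character 2
  else \sum_(d <- divisors n) kronecker_character d%:Z * d%:R.

Definition conv_F (chi : int -> C) (n : nat) : C :=
  \sum_(0 <= j < n.+1) delta chi j * delta (conj_character chi) (n - j).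

Definition conv_H (chi : int -> C) (n : nat) : C :=
  \sum_(0 <= j < n.+1) delta chi j * delta chi (n - j).

Definition alpha (chi : int -> C) : C := `|delta chi 0| ^+ 2 / sigma' 0.

Definition alpha' (chi : int -> C) : C := delta chi 0 ^+ 2 / sigma_tilde 0.

End DivisorSums.

(* Main.v *)
Require Import Defs.
From HB Require Import structures.
From mathcomp Require Import all_boot all_order all_algebra all_fingroup all_solvable all_field.
From mathcomp Require Import complex.
From mathcomp Require Import all_classical all_reals all_analysis.
From mathcomp Require Import zify ring lra.

Set Implicit Arguments.
Unset Strict Implicit.
Unset Printing Implicit Defensive.

Import Order.TTheory GRing.Theory Num.Theory.
Import numFieldNormedType.Exports.

(** Up to the two boundary terms, [conv_F] and [conv_H] count the solutions of
    [a * b + c * d = n] with weight [f a * f' c], [f] and [f'] being [chi] or its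
    conjugate.  Splitting at [Y = sqrt n] according to the sizes of [a] and [c]
    leaves, for each pair of small variables [x], [y], the solutions [u], [v] of
    [x * u + y * v = n] in classes modulo [p]; their number is a linear main term
    plus two sawtooth values.  The sawtooth sums are expanded in a finite Fourier
    series and bounded by Kloosterman sums, for which the elementary fourth-moment
    bound [q ^ (3/4)] suffices: the total error is [O(n ^ (125/128))].
    The main terms with [a], [c <= Y] produce [n * (sum_(g | n) f f' (g) / g)]
    times [L(1, f) L(1, f') / L(2, f f')], those with [a], [c > Y] the conjugate
    expression times [f f' (n)] and a Jacobi sum over [p], and the mixed ones vanish.
    The divisor sums are [sigma' n] and [sigma_tilde n], because [chi ^ 2] is the
    Kronecker symbol by quadratic reciprocity, and [n / numdiv n] bounds them from
    below.  Finally Fourier expansions of Bernoulli polynomials evaluate the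
    L-values, and the Gauss and Jacobi sums cancel in the constants. *)

(** * Solutions of linear equations in residue classes *)

(** The trivial bound for the sawtooth sums has the order of [n], like the main terms, so a power
    saving is indispensable, but any one will do: with moduli up to a multiple of [sqrt n], the
    bound [q ^ (3/4)] leads to [n ^ (7/8)] times divisor and harmonic factors. These factors are
    [O(n ^ (1/128))] each, an exponent chosen so that every size becomes a natural power of
    [n ^ (1/128)]. The denominators are bounded below by [n / numdiv n], hence the error exponent
    only has to stay below [127/128]. Kloosterman sums enter because the first point of the
    progression of solutions depends on [n / x] modulo [y], with [x] in an interval. The characters
    see residues modulo [p] only, so all four variables are first fixed modulo [p]; this makes the
    modulus [y * p] when [p] divides [y]. A variable above [Y] is replaced by its small cofactor,
    and its character is then summed along a line modulo [p]. One such character gives a complete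
    sum, which is zero: this is why the mixed ranges have no main term. Two of them give a Jacobi
    sum and the conjugate characters of the small variables. *)

Lemma eqmod_exP a b d :
  a = b %[mod d] <-> exists k l, a + k * d = b + l * d.
Proof.
split=> [eq_ab | [k [l eq_kl]]].
  exists (b %/ d), (a %/ d); have := divn_eq a d; have := divn_eq b d.
  rewrite eq_ab; move: (_ * d) (_ * d) => r s; lia.
by rewrite -(modnMDl k a) -(modnMDl l b) addnC eq_kl addnC.
Qed.

Lemma modn_inv_ex x y : coprime x y -> exists x', x * x' = 1 %[mod y].
Proof.
move=> cxy; exists (chinese x y 0 1 %/ x).
have := chinese_modl cxy 0 1; rewrite mod0n => /eqP dx.
by rewrite mulnC divnK // chinese_modr.
Qed.

Lemma eqmod_cancel x y a b : coprime x y ->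
  x * a = x * b %[mod y] -> a = b %[mod y].
Proof.
move=> /modn_inv_ex[x' e] eab.
have inv c : c = x' * (x * c %% y) %[mod y].
  by rewrite modnMmr mulnA [x' * x]mulnC -modnMml e modnMml mul1n.
by rewrite inv eab -inv.
Qed.

Lemma residue_window U r m : 0 < m ->
  exists s, 0 < s <= m /\ U + s = r %[mod m].
Proof.
(* [m.-1] stands for [-1] modulo [m], and the successor places the representative of [r - U] in
   [1..m], in accordance with the strict bounds [U < u] and [V < v] of [line_num]. *)
move=> m0; exists ((r + U * m.-1 + m.-1) %% m).+1.
split; first by rewrite /= ltn_pmod.
rewrite addnS -addSn modnDmr.
by apply/eqmod_exP; exists 0, U.+1; case: m m0 => // m _ /=; nia.
Qed.

Definition line_num p n U V u0 v0 B x y :=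
  \sum_(1 <= u < B.+1) \sum_(1 <= v < B.+1)
     ([&& U < u, V < v, u == u0 %[mod p], v == v0 %[mod p] & x * u + y * v == n] : nat).

(* Popoviciu's formula: the class solutions form a progression in [u] of step
   [y * p], first point [U + ru]; [rv] locates its other end. *)
Lemma line_count (R : realFieldType) p x y U V u0 v0 n B : n <= B ->
  0 < p -> 0 < x -> 0 < y -> coprime x y ->
  x * u0 + y * v0 = n %[mod p] -> x * U + y * V < n ->
  exists ru rv,
  [/\ 0 < ru <= y * p /\ 0 < rv <= x * p,
      U + ru = u0 %[mod p] /\ x * (U + ru) + y * v0 = n %[mod y * p],
      V + rv = v0 %[mod p] /\ y * (V + rv) + x * u0 = n %[mod x * p] &
      ((line_num p n U V u0 v0 B x y)%:R
       = (n%:R - x%:R * U%:R - y%:R * V%:R) / (x%:R * y%:R * p%:R)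
         - (ru%:R / (y%:R * p%:R) - 2^-1) - (rv%:R / (x%:R * p%:R) - 2^-1)
       :> R)%R].
Proof.
move=> nB p0 x0 y0 cxy /eqmod_exP [l [k e0]] ltn.
have [x' /eqmod_exP [kx [lx ex]]] := modn_inv_ex cxy.
have yp0 : 0 < y * p by rewrite muln_gt0 y0.
have xp0 : 0 < x * p by rewrite muln_gt0 x0.
have [y1 ey] : exists y1, y = y1.+1 by exists y.-1; rewrite prednK.
(* [w] is [l - k] modulo [y], written without subtraction. As [x'] inverts [x] modulo [y], [rho] is
   [u0] modulo [p] and solves [x * rho + y * v0 = n] modulo [y * p]. *)
pose w := l + k * y1; pose rho := u0 + p * (x' * w).
have [ru [ru_b /eqmod_exP [a [b eru]]]] := residue_window U rho yp0.
have hu1 : U + ru = u0 %[mod p].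
  apply/eqmod_exP; exists (a * y), (x' * w + b * y).
  by move: eru; rewrite /rho; clear; lia.
have hu2 : x * (U + ru) + y * v0 = n %[mod y * p].
  apply/eqmod_exP; exists (a * x + kx * w), (b * x + lx * w + k).
  have e1 := congr1 (muln x) eru; have e2 := congr1 (muln^~ (p * w)) ex.
  by move: e0 e1 e2; rewrite /rho /w ey; clear; lia.
have /eqmod_exP [a2 [b2 eu2]] := hu2.
(* This is [n - x * (U + ru)] made nonnegative by adding [x * (U + ru) * (y * p)], which changes the
   quotient by [y] by a multiple of [x * p] only. *)
have yD : y %| n + x * (U + ru) * (y * p).-1.
  have [yp1 eyp] : exists m, y * p = m.+1 by exists (y * p).-1; rewrite prednK.
  have e3 : n + x * (U + ru) * yp1 + b2 * (y * p) = y * (v0 + a2 * p + x * (U + ru) * p).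
    by move: eu2; rewrite mulnC; have := congr1 (muln (x * (U + ru))) eyp; clear; lia.
  by rewrite eyp /= -(dvdn_addl _ (dvdn_mull b2 (dvdn_mulr p (dvdnn y)))) e3 dvdn_mulr.
pose v1 := (n + x * (U + ru) * (y * p).-1) %/ y.
have ev1 : y * v1 = n + x * (U + ru) * (y * p).-1 by rewrite mulnC divnK.
have [rv [rv_b /eqmod_exP [c [d erv]]]] := residue_window V v1 xp0.
(* [T] will be the number of solutions. The extra period on the left keeps it a natural number when
   there is none, and [x * U + y * V < n] excludes negative values. *)
have eT : exists T, n + x * y * p = x * (U + ru) + y * (V + rv) + x * y * p * T.
  have e4 := congr1 (muln y) erv.
  have [yp1 eyp] : exists m, y * p = m.+1 by exists (y * p).-1; rewrite prednK.
  have : x * (U + ru) + y * (V + rv) = n + x * y * p %[mod x * y * p].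
    apply/eqmod_exP; exists (c + 1), (U + ru + d).
    by move: e4 ev1; rewrite !mulnDr eyp /=; have := congr1 (muln (x * (U + ru))) eyp; clear; lia.
  move/eqmod_exP => [s [t est]].
  have lt1 : x * (U + ru) + y * (V + rv) < n + x * y * p + x * y * p.
    have /andP[_ h1] := ru_b; have /andP[_ h2] := rv_b.
    by move: (leq_mul (leqnn x) h1) (leq_mul (leqnn y) h2) ltn; clear; lia.
  have le_ts : t <= s.
    rewrite leqNgt; apply/negP => lt_st.
    have : x * y * p * s.+1 <= x * y * p * t by rewrite leq_mul2l lt_st orbT.
    by move: est lt1; clear; lia.
  exists (s - t); rewrite mulnBr; move: (leq_mul (leqnn (x * y * p)) le_ts) est; clear; lia.
case: eT => T eT.
exists ru, rv; split=> //.
  split.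
    apply/eqP; rewrite -(eqn_pmul2l y0) !muln_modr; apply/eqP.
    apply/eqmod_exP; exists (x * T + b2), (a2 + x).
    by move: eT eu2; clear; lia.
  have /eqmod_exP [a3 [b3 eu3]] := hu1.
  apply/eqmod_exP; exists (y * T + b3), (a3 + y).
  by have := congr1 (muln x) eu3; move: eT; clear; lia.
pose ut t := U + ru + y * p * t; pose vt t := V + rv + x * p * (T.-1 - t).
have sol t : t < T -> x * ut t + y * vt t = n.
  rewrite /ut /vt => lt_tT.
  have [s es] : exists s, T = (s + t).+1 by exists (T.-1 - t); move: lt_tT; clear; lia.
  by move: eT; rewrite es /= addnK; clear; lia.
have -> : line_num p n U V u0 v0 B x y = \sum_(1 <= u < B.+1) \sum_(1 <= v < B.+1) \sum_(t < T) ((u == ut t) && (v == vt t) : nat).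
  apply: eq_big_nat => u _; apply: eq_big_nat => v _.
  case: (boolP [&& _, _, _, _ & _]) => [/and5P[h1 h2 /eqP h3 /eqP h4 /eqP h5] | hN].
    have : u = U + ru %[mod y * p].
      have /esym/eqmod_exP[a4 [b4 e4]] := h4.
      have /eqmod_exP [a5 [b5 e5]] : u = U + ru %[mod p] by rewrite h3 hu1.
      have e6 : x * u = x * (U + ru) %[mod y * p].
        apply/eqmod_exP; exists (b2 + a4), (a2 + b4).
        by have := congr1 (muln y) e4; move: eu2 h5; clear; lia.
      have e7 : u + a5 * p = U + ru + b5 * p by [].
      have e8 : x * a5 = x * b5 %[mod y].
        have /eqmod_exP [a9 [b9 e9]] := e6.
        apply/eqmod_exP; exists b9, a9; apply/eqP; rewrite -(eqn_pmul2r p0); apply/eqP.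
        by have := congr1 (muln x) e7; move: e9; clear; lia.
      have e10 : a5 = b5 %[mod y].
        exact: eqmod_cancel e8.
      have /eqmod_exP [a11 [b11 e11]] := e10.
      apply/eqmod_exP; exists b11, a11.
      by have := congr1 (muln p) e11; move: e7; clear; lia.
    move/eqmod_exP => [s [t est]].
    have le_st : s <= t.
      rewrite leqNgt; apply/negP => lt_ts.
      have : y * p * t.+1 <= y * p * s by rewrite leq_mul2l lt_ts orbT.
      by case/andP: ru_b; move: est h1; clear; lia.
    have eu : u = ut (t - s) by rewrite /ut mulnBr; move: (leq_mul (leqnn (y * p)) le_st) est; clear; lia.
    have lt_tT : t - s < T.
      rewrite ltnNge; apply/negP => leT.
      have : x * y * p * T <= x * y * p * (t - s) by rewrite leq_mul2l leT orbT.
      have [_ h7] := andP rv_b; have := leq_mul (leqnn y) h7.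
      have := leq_mul (leqnn y) h2; move: eT h5 y0; rewrite eu /ut; move: (t - s); clear; lia.
    have ev : v = vt (t - s).
      by apply/eqP; rewrite -(eqn_pmul2l y0) -(eqn_add2l (x * u)) h5 {1}eu sol.
    rewrite (bigD1 (Ordinal lt_tT)) //= -eu -ev !eqxx /= big1 // => i ni.
    case: eqP => //= eui; case/eqP: ni; apply/val_inj => /=.
    apply/eqP; rewrite -(eqn_pmul2l yp0) -(eqn_add2l (U + ru)); apply/eqP.
    by rewrite -/(ut i) -eui eu.
  rewrite big1 // => t _; apply/eqP; rewrite eqb0; apply: contra hN => /andP[/eqP-> /eqP->].
  have {}e1 : ut t = u0 %[mod p] by rewrite -hu1 /ut; apply/eqmod_exP; exists 0, (y * t); move: (t : nat) => t0; clear; lia.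
  rewrite sol // eqxx andbT e1 eqxx /=.
  apply/and3P; split; [by rewrite /ut -addnA -ltn_subLR ?leqnn // subnn ltn_addr //; case/andP: ru_b | by rewrite /vt -addnA -ltn_subLR ?leqnn // subnn ltn_addr //; case/andP: rv_b|].
  apply/eqP; apply/eqP; rewrite -(eqn_pmul2l y0) !muln_modr; apply/eqP.
  have /eqmod_exP[a3 [b3 e3]] := hu2.
  apply/eqmod_exP; exists (b2 + x * t), a2.
  by have := sol _ (ltn_ord t); rewrite {1}/ut; move: eu2; clear; lia.
have -> : \sum_(1 <= u < B.+1) \sum_(1 <= v < B.+1) \sum_(t < T) ((u == ut t) && (v == vt t) : nat) = T.
  under eq_bigr => u _ do rewrite exchange_big.
  rewrite exchange_big /= -[RHS]card_ord -sum1_card; apply: eq_bigr => t _.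
  have [b1 b3] : 0 < ut t /\ 0 < vt t by rewrite /ut /vt !addn_gt0; case/andP: ru_b => ->; case/andP: rv_b => ->; rewrite !orbT.
  have et := sol _ (ltn_ord t).
  have lu : ut t < B.+1 by rewrite ltnS (leq_trans _ nB) // -et (leq_trans (leq_pmull _ x0)) ?leq_addr.
  have lv : vt t < B.+1 by rewrite ltnS (leq_trans _ nB) // -et (leq_trans (leq_pmull _ y0)) ?leq_addl.
  rewrite (bigD1_seq (ut t)) ?mem_index_iota ?b1 ?iota_uniq //= (bigD1_seq (vt t)) ?mem_index_iota ?b3 ?iota_uniq //=.
  rewrite !eqxx /= big1 => [|v nv]; last by rewrite (negPf nv).
  by rewrite addn0 big1 // => u nu; rewrite big1 // => v _; rewrite (negPf nu).
have xN : (x%:R != 0 :> R)%R by rewrite pnatr_eq0 -lt0n.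
have yN : (y%:R != 0 :> R)%R by rewrite pnatr_eq0 -lt0n.
have pN : (p%:R != 0 :> R)%R by rewrite pnatr_eq0 -lt0n.
have := congr1 (fun k => k%:R : R)%R eT; rewrite !natrD !natrM !natrD => eTR.
have -> : (n%:R = x%:R * (U%:R + ru%:R) + y%:R * (V%:R + rv%:R) + x%:R * y%:R * p%:R * T%:R - x%:R * y%:R * p%:R :> R)%R.
  by rewrite -eTR; ring.
by field; rewrite xN yN pN.
Qed.

(** * Divisor sums *)

Definition numdiv n := size (divisors n).

Lemma numdiv_gt0 n : 0 < numdiv n.
Proof. by have := divisor1 n; rewrite /numdiv; case: divisors. Qed.

Lemma sum_divisors (M : nmodType) n (F : nat -> M) : 0 < n ->
  (\sum_(d <- divisors n) F d = \sum_(1 <= d < n.+1 | (d %| n)%N) F d)%R.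
Proof.
move=> n0; rewrite -[in RHS]big_filter; apply: perm_big; apply: uniq_perm.
- exact: divisors_uniq.
- by rewrite filter_uniq // iota_uniq.
move=> d; rewrite mem_filter mem_index_iota -dvdn_divisors // ltnS.
by case: (boolP (d %| n)) => //= dn; rewrite (dvdn_gt0 n0) // dvdn_leq.
Qed.

Lemma numdivE n : 0 < n -> numdiv n = \sum_(1 <= d < n.+1 | d %| n) 1.
Proof. by move=> n0; rewrite -(sum_divisors (fun=> 1)) // sum1_size. Qed.

Lemma totient_leq_mul d k : 0 < d -> 0 < k -> totient d <= totient (d * k).
Proof.
elim/ltn_ind: k d => k IH d d0 k0.
have [k1|k1] := leqP k 1; first by rewrite (_ : k = 1) ?muln1 //; lia.
have pq := pdiv_prime k1; set q := pdiv k in pq.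
have q0 := prime_gt0 pq.
have step : totient d <= totient (d * q).
  rewrite -(partnC q d0); set e := d`_q^'.
  have ce m : coprime (q ^ m) e.
    by apply: coprimeXl; rewrite prime_coprime // /e; have := part_pnat q^' d;
       rewrite -p'natE.
  rewrite p_part mulnAC -expnSr !totient_coprime // leq_mul2r.
  case: (logn q d) => [|m].
    by rewrite expn0 expn1 (totient_prime pq) -[totient 1]/1 -ltnS prednK ?prime_gt1 ?orbT.
  by rewrite !totient_pfactor //= leq_mul2l leq_exp2l ?prime_gt1 // leqnSn !orbT.
apply: (leq_trans step).
have ek : k = q * (k %/ q) by rewrite mulnC divnK // pdiv_dvd.
rewrite {1}ek mulnA; apply: IH; rewrite ?muln_gt0 ?d0 //.
  by rewrite ltn_Pdiv ?prime_gt1.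
by rewrite divn_gt0 // dvdn_leq ?pdiv_dvd.
Qed.

(** The totients of the divisors of [n] add up to [n], and each is at most [totient n]. In
    [kl_bound4] this replaces a division by [totient q] with a factor [numdiv q / q]. *)
Lemma leq_totient_numdiv n : 0 < n -> n <= totient n * numdiv n.
Proof.
move=> n0.
have e : \sum_(1 <= d < n.+1 | d %| n) totient d = n.
  rewrite -[RHS]sum_totient_dvd -(big_mkord (dvdn^~ n)) [RHS]big_ltn_cond //=.
  by rewrite dvd0n eqn0Ngt n0.
rewrite -{1}e mulnC numdivE // big_distrl /=; apply: leq_sum => d dn; rewrite mul1n.
have d0 := dvdn_gt0 n0 dn.
by case/dvdnP: dn n0 => k ->; rewrite muln_gt0 mulnC => /andP[k0 _]; exact: totient_leq_mul.
Qed.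

(** The gcd is at most the sum of all common divisors [d], and [d] divides [n %/ d] of the
    residues. *)
Lemma sum_gcdn n : 0 < n -> \sum_(a < n) gcdn a n <= n * numdiv n.
Proof.
move=> n0; rewrite numdivE // big_distrr /=.
apply: (@leq_trans (\sum_(a < n) \sum_(1 <= d < n.+1 | d %| n) (d %| a) * d)).
  apply: leq_sum => a _.
  have g0 : 0 < gcdn a n by rewrite gcdn_gt0 n0 orbT.
  rewrite big_mkcond (bigD1_seq (gcdn a n)) ?iota_uniq //=.
  - by rewrite dvdn_gcdr dvdn_gcdl mul1n leq_addr.
  - by rewrite mem_index_iota g0 ltnS dvdn_leq ?dvdn_gcdr.
rewrite exchange_big /=; apply: leq_sum => d dn.
rewrite -big_distrl /= muln1.
have d0 : 0 < d by exact: dvdn_gt0 dn.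
have -> : \sum_(i < n) (d %| i : nat) = n %/ d.
  case/dvdnP: dn => k ->; rewrite mulnK //.
  elim: k => [|k IH]; first by rewrite mul0n big_ord0.
  rewrite mulSn addnC big_split_ord /= IH.
  case: d d0 {IH} => // d _.
  rewrite big_ord_recl /= addn0 dvdn_mull // big1 ?addn1 // => i _.
  by rewrite /bump /= dvdn_addr ?dvdn_mull // gtnNdvd // add1n ltnS.
by rewrite leq_divM.
Qed.

(** * Harmonic sums *)

Section Harmonic.
Variable R : numFieldType.
Local Open Scope ring_scope.

Definition harm (N : nat) : R := \sum_(1 <= k < N.+1) k%:R^-1.

Lemma harm_le m n : (m <= n)%N -> harm m <= harm n.
Proof.
move=> mn; rewrite /harm [leRHS](big_cat_nat (n := m.+1)) //=.
by rewrite lerDl sumr_ge0 // => i _; rewrite invr_ge0 ler0n.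
Qed.

Lemma harm_ge1 n : (0 < n)%N -> 1 <= harm n.
Proof. by move=> n0; apply: le_trans (harm_le n0); rewrite /harm big_nat1 invr1. Qed.

Lemma harm_ge0 n : 0 <= harm n.
Proof. by apply: sumr_ge0 => i _; rewrite invr_ge0 ler0n. Qed.

Lemma sum_gcdn_div n Q : (0 < n)%N ->
  \sum_(1 <= y < Q.+1) (gcdn y n)%:R / y%:R <= (numdiv n)%:R * harm Q :> R.
Proof.
move=> n0; rewrite numdivE // natr_sum mulr_suml.
apply: (@le_trans _ _ (\sum_(1 <= y < Q.+1) \sum_(1 <= d < n.+1 | (d %| n)%N)
    (if (d %| y)%N then d%:R / y%:R else 0))).
  rewrite big_nat_cond [leRHS]big_nat_cond; apply: ler_sum => y; rewrite andbT => /andP[y0 _].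
  have g0 : (0 < gcdn y n)%N by rewrite gcdn_gt0 n0 orbT.
  rewrite big_mkcond (bigD1_seq (gcdn y n)) ?iota_uniq //=.
  - rewrite dvdn_gcdr dvdn_gcdl lerDl sumr_ge0 // => i _; case: ifP => // _; case: ifP => // _;
    by rewrite divr_ge0 ?ler0n.
  - by rewrite mem_index_iota g0 ltnS dvdn_leq ?dvdn_gcdr.
rewrite exchange_big /= big_nat_cond [leRHS]big_nat_cond.
apply: ler_sum => d /andP[/andP[d0 _] dn]; rewrite mul1r.
have dN : d%:R != 0 :> R by rewrite pnatr_eq0 -lt0n.
have bound M : \sum_(1 <= y < M.+1) (if (d %| y)%N then d%:R / y%:R else 0)
   = harm (M %/ d) :> R.
  elim: M => [|M IH]; first by rewrite div0n /harm !big_geq.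
  rewrite big_nat_recr //= IH.
  rewrite divnS //.
  case: (boolP (d %| M.+1)%N) => [dM|_] /=; last by rewrite addr0.
  rewrite /harm add1n [in RHS]big_nat_recr //=; congr (_ + _).
  have -> : ((M %/ d).+1 = M.+1 %/ d)%N by rewrite divnS // dM.
  by case/dvdnP: dM => k ->; rewrite mulnK // natrM invfM mulrCA divff // mulr1.
by rewrite bound harm_le // leq_div.
Qed.

End Harmonic.

Lemma sum_multiples (M : nmodType) g N (G : nat -> M) : 0 < g ->
  (\sum_(1 <= x < N.+1 | (g %| x)%N) G x =
   \sum_(1 <= x < N.+1 | (g * x <= N)%N) G (g * x)%N)%R.
Proof.
move=> g0; rewrite -[in LHS]big_filter -[in RHS]big_filter -(big_map (muln g) predT).
apply: perm_big; apply: uniq_perm.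
- by rewrite filter_uniq ?iota_uniq.
- rewrite map_inj_in_uniq ?filter_uniq ?iota_uniq // => a b _ _ /eqP.
  by rewrite eqn_pmul2l // => /eqP.
move=> x; rewrite mem_filter mem_index_iota; apply/and3P/mapP => [[gx x0 xN] | [y]].
  have ex : x = g * (x %/ g) by rewrite mulnC divnK.
  exists (x %/ g); rewrite // mem_filter mem_index_iota -ex -ltnS xN divn_gt0 //.
  by rewrite dvdn_leq //= ltnS (leq_trans (leq_div _ _)).
rewrite mem_filter mem_index_iota => /and3P[h1 h2 h3] ->.
by rewrite dvdn_mulr // muln_gt0 g0 ltnS.
Qed.

Lemma sum_gcd_split (M : nmodType) N (F : nat -> nat -> M) :
  (\sum_(1 <= x < N.+1) \sum_(1 <= y < N.+1) F x y =
   \sum_(1 <= g < N.+1) \sum_(1 <= x < N.+1 | (g * x <= N)%N)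
     \sum_(1 <= y < N.+1 | (g * y <= N)%N && coprime x y) F (g * x)%N (g * y)%N)%R.
Proof.
transitivity (\sum_(1 <= x < N.+1) \sum_(1 <= y < N.+1) \sum_(1 <= g < N.+1)
   (if gcdn x y == g then F x y else 0))%R.
  rewrite big_nat_cond [RHS]big_nat_cond; apply: eq_bigr => x /andP[/andP[x0 xN] _].
  apply: eq_bigr => y _.
  have g0 : 0 < gcdn x y by rewrite gcdn_gt0 x0.
  rewrite (bigD1_seq (gcdn x y)) ?iota_uniq ?mem_index_iota ?g0 //=; last first.
    by rewrite (leq_ltn_trans _ xN) // dvdn_leq // dvdn_gcdl.
  rewrite eqxx big1 ?addr0 // => g; rewrite eq_sym => /negPf->//.
under eq_bigr => x _ do rewrite exchange_big.
rewrite exchange_big /= big_nat_cond [RHS]big_nat_cond.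
apply: eq_bigr => g /andP[/andP[g0 gN] _].
transitivity (\sum_(1 <= x < N.+1 | (g %| x)%N) \sum_(1 <= y < N.+1 | (g %| y)%N)
    if gcdn x y == g then F x y else 0)%R.
  rewrite [RHS]big_mkcond; apply: eq_bigr => x _.
  case: (boolP (g %| x)) => gx; last first.
    rewrite big1 // => y _; case: eqP => // e; case/negP: gx; rewrite -e.
    exact: dvdn_gcdl.
  rewrite [RHS]big_mkcond; apply: eq_bigr => y _.
  case: (boolP (g %| y)) => gy //; case: eqP => // e; case/negP: gy; rewrite -e.
  exact: dvdn_gcdr.
rewrite sum_multiples //; apply: eq_bigr => x _.
rewrite sum_multiples // [RHS]big_mkcondr; apply: eq_bigr => y _.
by rewrite -muln_gcdr -[X in _ == X]muln1 eqn_pmul2l.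
Qed.

Lemma sum_divisors_coprime (M : nmodType) m n (F : nat -> M) :
  0 < m -> 0 < n -> coprime m n ->
  (\sum_(d <- divisors (m * n)) F d =
   \sum_(d <- divisors m) \sum_(e <- divisors n) F (d * e)%N)%R.
Proof.
move=> m0 n0 cmn.
transitivity (\sum_(x <- [seq (d * e)%N | d <- divisors m, e <- divisors n]) F x)%R;
  last by rewrite big_allpairs_dep.
apply: perm_big; have mn0 : 0 < m * n by rewrite muln_gt0 m0.
apply: uniq_perm; first exact: divisors_uniq.
  apply: allpairs_uniq; try exact: divisors_uniq.
  move=> [d e] [d' e'] /allpairsP[[a b] /= [am bn [-> ->]]] /allpairsP[[a' b'] /= [am' bn' [-> ->]]].
  move: am bn am' bn'; rewrite -!dvdn_divisors // => am bn am' bn' eq.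
  have gl c k : c %| m -> k %| n -> gcdn m (c * k) = c.
    move=> cm kn; rewrite Gauss_gcdl; first by apply/gcdn_idPr.
    exact: coprime_dvdr kn cmn.
  have ea : a = a' by rewrite -(gl a b) // eq gl.
  have a0 : 0 < a' by exact: dvdn_gt0 am'.
  by move: eq; rewrite ea => /eqP; rewrite eqn_pmul2l // => /eqP ->.
move=> x; rewrite -dvdn_divisors //; apply/idP/allpairsP => [xmn | [[d e] /= [dm en ->]]].
  have x0 := dvdn_gt0 mn0 xmn.
  have g0 : 0 < gcdn x m by rewrite gcdn_gt0 x0.
  exists (gcdn x m, x %/ gcdn x m) => /=; rewrite -!dvdn_divisors // dvdn_gcdr; split=> //.
    have c1 : coprime (x %/ gcdn x m) (m %/ gcdn x m).
      rewrite /coprime -(eqn_pmul2l g0) muln1 muln_gcdr.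
      by rewrite ![gcdn x m * (_ %/ _)]mulnC !divnK ?dvdn_gcdl ?dvdn_gcdr.
    rewrite -(Gauss_dvdr n c1) -(dvdn_pmul2l g0) mulnA.
    by rewrite ![gcdn x m * (_ %/ _)]mulnC !divnK ?dvdn_gcdl ?dvdn_gcdr.
  by rewrite mulnC divnK ?dvdn_gcdl.
by rewrite dvdn_mul // dvdn_divisors.
Qed.

Lemma sum_divisors_pfactor (M : nmodType) q e (F : nat -> M) : prime q ->
  (\sum_(d <- divisors (q ^ e)) F d = \sum_(i < e.+1) F (q ^ i)%N)%R.
Proof.
move=> pq; rewrite -(big_mkord predT (fun i => F (q ^ i)%N)) -(big_map (expn q) predT).
have q0 : 0 < q ^ e by rewrite expn_gt0 prime_gt0.
apply: perm_big; apply: uniq_perm; first exact: divisors_uniq.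
  rewrite map_inj_in_uniq ?iota_uniq // => a b _ _ /eqP.
  by rewrite eqn_exp2l ?prime_gt1 // => /eqP.
move=> x; rewrite -dvdn_divisors //.
apply/(dvdn_pfactor _ _ pq)/mapP => -[m mb ->]; exists m => //; move: mb;
  by rewrite mem_index_iota.
Qed.

Lemma pfactor_split q n : prime q -> 0 < n ->
  exists m, [/\ n = q ^ logn q n * m, 0 < m & coprime (q ^ logn q n) m /\ ~~ (q %| m)].
Proof.
move=> pq n0; exists (n`_q^').
have nq : ~~ (q %| n`_q^') by rewrite -p'natE // part_pnat.
rewrite -p_part partnC //; split=> //; rewrite ?part_gt0 //; split=> //.
by rewrite p_part coprimeXl // prime_coprime.
Qed.

(** * The divisor bound *)

Lemma numdiv_pfactor q e m : prime q -> 0 < m -> coprime (q ^ e) m ->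
  numdiv (q ^ e * m) = e.+1 * numdiv m.
Proof.
move=> pq m0 c; rewrite /numdiv -!sum1_size.
rewrite sum_divisors_coprime ?expn_gt0 ?(prime_gt0 pq) //.
by rewrite sum_divisors_pfactor //= sum_nat_const card_ord.
Qed.

Lemma leq_exp2r' m n e : m <= n -> m ^ e <= n ^ e.
Proof. by move=> mn; elim: e => // e IH; rewrite !expnS leq_mul. Qed.

Lemma bin_leq_exp2 n k : 'C(n, k) <= 2 ^ n.
Proof.
elim: n k => [|n IH] [|k] //; first by rewrite bin0 expn_gt0.
by rewrite binS expnS mul2n -addnn leq_add.
Qed.

(** [(e + k) ^_ k] is [k!] times a binomial coefficient, which is at most [2 ^ (e + k)]. *)
Lemma succ_exp_leq k e : e.+1 ^ k <= k`! * 2 ^ k * 2 ^ e.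
Proof.
apply: (@leq_trans ((e + k) ^_ k)).
  elim: k => [|k IH]; first by rewrite ffactn0.
  by rewrite addnS ffactSS expnS leq_mul // ltnS leq_addr.
by rewrite -bin_ffact mulnC -mulnA leq_mul2l -expnD addnC bin_leq_exp2 orbT.
Qed.

Lemma numdiv_large k n : 0 < n -> (forall q, prime q -> q %| n -> 2 ^ k <= q) ->
  numdiv n ^ k <= n.
Proof.
elim/ltn_ind: n => n IH n0 hq.
have [n1|n1] := leqP n 1; first by rewrite (_ : n = 1) ?exp1n //; lia.
have pq := pdiv_prime n1; have dq := pdiv_dvd n; set q := pdiv n in pq dq.
have [m [en m0 [cm nqm]]] := pfactor_split pq n0.
have e0 : 0 < logn q n by rewrite logn_gt0 mem_primes pq n0.
move: (logn q n) en cm e0 => e en cm e0.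
rewrite en numdiv_pfactor // expnMn leq_mul //; last first.
  apply: IH => // [|r pr rm]; last by apply: hq; rewrite // en dvdn_mull.
  by rewrite en ltn_Pmull // -(exp1n e) ltn_exp2r // prime_gt1.
apply: (@leq_trans ((2 ^ k) ^ e)); last by rewrite leq_exp2r // hq.
by rewrite -expnM mulnC expnM leq_exp2r' // ltn_expl.
Qed.

(** By multiplicativity, a prime [q >= 2 ^ k] with exponent [e] contributes
    [(e + 1) ^ k <= 2 ^ (k * e) <= q ^ e]. Each smaller prime costs at most one more factor [c], by
    [succ_exp_leq], and there are fewer than [2 ^ k] of them. *)
Lemma numdiv_bound k : exists2 C, 0 < C & forall n, 0 < n -> numdiv n ^ k <= C * n.
Proof.
pose c := k`! * 2 ^ k.
have c0 : 0 < c by rewrite muln_gt0 fact_gt0 expn_gt0.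
exists (c ^ (2 ^ k)); first by rewrite expn_gt0 c0.
(* [i] bounds the number of candidates below [2 ^ k] that may still divide [n]; each step removes
   the least one, [j], when it is a prime factor. *)
have main i : i <= 2 ^ k -> forall n, 0 < n ->
   (forall q, prime q -> q %| n -> 2 ^ k - i <= q) -> numdiv n ^ k <= c ^ i * n.
  elim: i => [|i IH] ile n n0 hq.
    by rewrite expn0 mul1n; apply: numdiv_large => // q; move: (hq q); rewrite subn0.
  set j := 2 ^ k - i.+1 in hq.
  have ej : 2 ^ k - i = j.+1 by rewrite /j; lia.
  have [/andP[pj jn]|nj] := boolP (prime j && (j %| n)); last first.
    apply: (@leq_trans (c ^ i * n)); last by rewrite leq_mul2r leq_pexp2l ?leqnSn ?orbT.
    apply: IH => // [|q pq qn]; first exact: ltnW.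
    rewrite ej; have := hq q pq qn; rewrite leq_eqVlt => /orP[/eqP ejq|//].
    by move: nj; rewrite ejq pq qn.
  have [m [en m0 [cm nqm]]] := pfactor_split pj n0.
  move: (logn j n) en cm => e en cm.
  rewrite en numdiv_pfactor // expnMn.
  apply: (@leq_trans (c * 2 ^ e * (c ^ i * m))).
    rewrite leq_mul ?succ_exp_leq //; apply: IH => // [|q pq qm]; first exact: ltnW.
    rewrite ej ltn_neqAle hq ?en ?dvdn_mull // andbT.
    by apply: contraNneq nqm => ->.
  rewrite expnS -!mulnA leq_mul2l [2 ^ e * _]mulnCA !leq_mul2l leq_mul2r.
  by rewrite leq_exp2r' ?prime_gt1 // !orbT.
move=> n n0; apply: main => // q pq _; rewrite subnn; exact: leq0n.
Qed.

(** * The Moebius function and twisted divisor sums *)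

Definition moebius (n : nat) : int :=
  (if all (fun q => logn q n == 1%N) (primes n) then (-1) ^+ size (primes n) else 0)%R.

Lemma moebius1 : moebius 1 = 1%R.
Proof. by []. Qed.

Lemma moebius_norm_le1 n : (`|moebius n| <= 1)%R.
Proof. by rewrite /moebius; case: ifP => // _; rewrite normrX normrN1 expr1n. Qed.

Lemma moebius_prime_mul q d : prime q -> 0 < d -> ~~ (q %| d) ->
  moebius (q * d) = (- moebius d)%R.
Proof.
move=> pq d0 nqd.
have q0 := prime_gt0 pq.
have pe : perm_eq (primes (q * d)) (q :: primes d).
  apply: uniq_perm; rewrite ?primes_uniq //=.
    by rewrite primes_uniq mem_primes (negPf nqd) !andbF.
  by move=> r; rewrite primesM // primes_prime // !inE.
rewrite /moebius (perm_all _ pe) (perm_size pe) /=.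
rewrite lognM // [logn q d]lognE (negPf nqd) !andbF addn0 logn_prime // eqxx /=.
rewrite (@eq_in_all _ _ (fun r => logn r d == 1%N)); last first.
  move=> r; rewrite mem_primes => /and3P[pr _ rd]; rewrite lognM // logn_prime //.
  have /negPf-> // : r != q by apply: contraNneq nqd => <-.
by case: all; rewrite ?oppr0 // exprS mulN1r.
Qed.

Lemma moebius_square q d : prime q -> 0 < d -> moebius (q * (q * d)) = 0%R.
Proof.
move=> pq d0; have q0 := prime_gt0 pq; rewrite /moebius; case: allP => // h.
have /h : q \in primes (q * (q * d)).
  by rewrite mem_primes pq !muln_gt0 q0 d0 dvdn_mulr.
by rewrite !lognM ?muln_gt0 ?q0 // logn_prime // eqxx !add1n.
Qed.

(** For a prime [q] dividing [n] only the divisors with [q]-part [1] or [q] count, and they cancel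
    in pairs. *)
Lemma sum_moebius n : 0 < n ->
  (\sum_(d <- divisors n) moebius d = (n == 1%N)%:R)%R.
Proof.
move=> n0; have [n1|n1] := leqP n 1.
  by rewrite (_ : n = 1); [rewrite big_seq1 | lia].
rewrite gtn_eqF //.
have pq := pdiv_prime n1; have dq := pdiv_dvd n; set q := pdiv n in pq dq.
have [m [en m0 [cm nqm]]] := pfactor_split pq n0.
have e0 : 0 < logn q n by rewrite logn_gt0 mem_primes pq n0.
move: (logn q n) en cm e0 => e en cm e0.
rewrite en sum_divisors_coprime ?expn_gt0 ?(prime_gt0 pq) // sum_divisors_pfactor //.
case: e e0 {en cm} => // e _; rewrite 2!big_ord_recl /= [X in (_ + (_ + X))%R]big1 => [|i _].
  rewrite addr0 -big_split /= big_seq big1 // => d.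
  rewrite -dvdn_divisors // => dm; rewrite expn0 mul1n expn1 moebius_prime_mul ?subrr //.
    exact: dvdn_gt0 dm.
  by apply: contra nqm => qd; exact: dvdn_trans qd dm.
rewrite big_seq big1 // => d; rewrite -dvdn_divisors // => dm.
rewrite !expnS -!mulnA moebius_square // muln_gt0 expn_gt0 (prime_gt0 pq) /=.
exact: dvdn_gt0 dm.
Qed.

(** By multiplicativity the sum is a product of geometric sums with ratio [f q * q], each of modulus
    at least [(q ^ (e + 1) - 1) / (q + 1)]; the factor [e + 1 >= 2] makes up for the loss. Equality
    occurs for [n = 2] and [f 2 = -1]. *)
Lemma twisted_sigma_ge (C : numFieldType) (f : nat -> C) n : 0 < n ->
  f 1 = 1%R -> (forall a b, f (a * b) = (f a * f b)%R) ->
  (forall q, prime q -> q %| n -> (`|f q| = 1)%R) ->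
  (n%:R <= `|\sum_(d <- divisors n) f d * d%:R| * (numdiv n)%:R)%R.
Proof.
move=> n0 f1 fM; elim/ltn_ind: n n0 => n IH n0 hf.
have [n1|n1] := leqP n 1.
  by rewrite (_ : n = 1); [rewrite big_seq1 f1 mul1r normr1 mul1r | lia].
have pq := pdiv_prime n1; have dq := pdiv_dvd n; set q := pdiv n in pq dq.
have [m [en m0 [cm nqm]]] := pfactor_split pq n0.
have e0 : 0 < logn q n by rewrite logn_gt0 mem_primes pq n0.
move: (logn q n) en cm e0 => e en cm e0.
have q0 := prime_gt0 pq; have q1 := prime_gt1 pq.
have IHm : (m%:R <= `|\sum_(d <- divisors m) f d * d%:R| * (numdiv m)%:R :> C)%R.
  apply: IH => // [|r pr rm]; last by apply: hf; rewrite // en dvdn_mull.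
  by rewrite en ltn_Pmull // -(exp1n e) ltn_exp2r // prime_gt1.
have -> : (\sum_(d <- divisors n) f d * d%:R =
   (\sum_(i < e.+1) (f q * q%:R) ^+ i) * \sum_(d <- divisors m) f d * d%:R)%R.
  rewrite en sum_divisors_coprime ?expn_gt0 ?(prime_gt0 pq) // sum_divisors_pfactor //.
  rewrite mulr_suml; apply: eq_bigr => i _; rewrite mulr_sumr; apply: eq_bigr => d _.
  have fX : f (q ^ i)%N = (f q ^+ i)%R.
    by elim: (i : nat) => [|j IHj]; rewrite ?f1 // expnS fM IHj exprS.
  by rewrite fM fX natrM natrX exprMn; ring.
rewrite en numdiv_pfactor // !natrM normrM mulrACA.
apply: ler_pM => //; rewrite ?ler0n //.
set S := (\sum_(i < _) _)%R; set z := (f q * q%:R)%R in S *.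
have nz : (`|z| = q%:R)%R by rewrite normrM hf // mul1r normr_nat.
have e1 : ((q ^ e.+1)%N%:R - 1 <= `|S| * (q%:R + 1))%R.
  apply: (@le_trans _ _ `|(z - 1) * S|%R).
    rewrite -subrX1; apply: le_trans (lerB_dist _ _).
    by rewrite normrX nz normr1 natrX.
  by rewrite normrM mulrC ler_wpM2l // (le_trans (ler_normB _ _)) // nz normr1.
have q2 : (0 < q%:R + 1 :> C)%R by rewrite ltr_wpDl ?ler0n.
rewrite -(ler_pM2r q2) mulrAC.
apply: (@le_trans _ _ (((q ^ e.+1)%N%:R - 1) * e.+1%:R)%R); last by rewrite ler_wpM2r ?ler0n.
rewrite -[(1 : C)%R]/(1%N%:R)%R -natrD -natrB ?expn_gt0 ?q0 // -!natrM ler_nat.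
rewrite expnS; case: e e0 {en cm S e1} => // e _.
have : 0 < q ^ e by rewrite expn_gt0 q0.
rewrite expnS; move: (q ^ e) q1 => r q1 r0.
have : 2 <= q * r * q.-1 by case: (q) q1 => [|[|k]] // _; nia.
by case: (q) q1 => // k _ /=; nia.
Qed.

(** * Gauss and Jacobi sums *)

Local Open Scope ring_scope.

Section GaussSums.
Variables (K : fieldType) (p : nat).
Hypothesis p_prime : prime p.
Variable zeta : K.
Hypothesis zeta_prim : p.-primitive_root zeta.

(** The additive character of ['F_p]. The field is arbitrary because Gauss sums serve both in
    characteristic [q], for reciprocity, and over the complex numbers, for the L-values. *)
Definition ezp (a : 'F_p) : K := zeta ^+ a.

Lemma zeta_exp_Fp : zeta ^+ (Zp_trunc (pdiv p)).+2 = 1.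
Proof. by rewrite Fp_cast // prim_expr_order. Qed.

Lemma ezpD a b : ezp (a + b) = ezp a * ezp b.
Proof. by rewrite /ezp /= expr_mod ?zeta_exp_Fp // exprD. Qed.

Lemma ezp0 : ezp 0 = 1.
Proof. by []. Qed.

Lemma ezpM a b : ezp (a * b) = ezp b ^+ a.
Proof. by rewrite /ezp /= expr_mod ?zeta_exp_Fp // mulnC exprM. Qed.

Lemma ezp_nat n : ezp n%:R = zeta ^+ n.
Proof. by rewrite /ezp val_Fp_nat // prim_expr_mod. Qed.

Lemma sum_ezp b : \sum_(a : 'F_p) ezp (a * b) = (b == 0)%:R * p%:R.
Proof.
have [->|b0] := eqVneq b 0.
  rewrite (eq_bigr (fun=> 1)) => [|a _]; last by rewrite mulr0 ezp0.
  by rewrite sumr_const card_Fp // mul1r.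
rewrite mul0r; under eq_bigr => a _ do rewrite ezpM.
have w1 : ezp b - 1 != 0.
  rewrite subr_eq0 /ezp -(prim_order_dvd zeta_prim) gtnNdvd ?lt0n //.
  by rewrite -[X in (_ < X)%N](Fp_cast p_prime) ltn_ord.
have e : ezp b ^+ (Zp_trunc (pdiv p)).+2 = 1.
  by rewrite /ezp -exprM mulnC exprM zeta_exp_Fp expr1n.
apply: (mulfI w1); rewrite mulr0.
by transitivity (ezp b ^+ (Zp_trunc (pdiv p)).+2 - 1); [exact/esym/subrX1 | rewrite e subrr].
Qed.

Section Char.
Variable f : 'F_p -> K.
Hypothesis f0 : f 0 = 0.
Hypothesis f1 : f 1 = 1.
Hypothesis fM : forall a b, f (a * b) = f a * f b.

Definition gauss (n : 'F_p) : K := \sum_a f a * ezp (a * n).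

Lemma sum_char c : f c != 1 -> c != 0 -> \sum_a f a = 0.
Proof.
move=> fc c0; have /eqP : (f c - 1) * \sum_a f a = 0.
  rewrite mulrBl mul1r; apply/eqP; rewrite subr_eq0; apply/eqP.
  rewrite [RHS](reindex_inj (mulfI c0)) mulr_sumr; apply: eq_bigr => a _.
  by rewrite fM.
by rewrite mulf_eq0 subr_eq0 (negPf fc) => /eqP.
Qed.

Lemma gauss_scale n : n != 0 -> f n * gauss n = gauss 1.
Proof.
move=> n0; rewrite /gauss [RHS](reindex_inj (mulfI n0)) mulr_sumr; apply: eq_bigr => a _.
by rewrite fM mulr1 mulrA [a * n]mulrC.
Qed.

End Char.

(** Write the factor [gauss f 1] as [f b * gauss f b] in the term [b] of the other sum, where [g b]
    cancels [f b]. Orthogonality in [b] leaves [a = -1]; the absent [b = 0] would only contribute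
    the sum of [f], which is zero. *)
Lemma gauss_mul_inv (f g : 'F_p -> K) c :
  f 0 = 0 -> (forall a b, f (a * b) = f a * f b) -> g 0 = 0 ->
  (forall a, a != 0 -> g a * f a = 1) -> f c != 1 -> c != 0 ->
  gauss f 1 * gauss g 1 = f (-1) * p%:R.
Proof.
move=> f0 fM g0 gf fc c0; rewrite mulrC {1}/gauss mulr_suml.
rewrite (bigD1 0) //= g0 !mul0r add0r.
rewrite (eq_bigr (fun b => \sum_a f a * ezp (b * (a + 1)))); last first.
  move=> b b0; rewrite mulr1 -(gauss_scale fM b0) mulrACA gf // mul1r mulr_sumr.
  by apply: eq_bigr => a _; rewrite mulrCA -ezpD; congr (_ * ezp _); rewrite mulrDr mulr1 [a * b]mulrC addrC.
rewrite exchange_big /=.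
rewrite (eq_bigr (fun a => f a * ((a + 1 == 0)%:R * p%:R) - f a)); last first.
  move=> a _; rewrite -mulr_sumr -(sum_ezp (a + 1)) [in RHS](bigD1 0) //= mul0r ezp0.
  by rewrite mulrDr mulr1 addrAC subrr add0r.
rewrite sumrB (sum_char fM fc c0) subr0 (bigD1 (-1)) //= addNr eqxx mul1r big1 ?addr0 // => a a1.
by rewrite addr_eq0 (negPf a1) mul0r mulr0.
Qed.

Definition jacobi (f g : 'F_p -> K) : K := \sum_a f a * g (1 - a).

Lemma jacobi_scale (f g : 'F_p -> K) (s : 'F_p) :
  (forall a b, f (a * b) = f a * f b) -> (forall a b, g (a * b) = g a * g b) ->
  s != 0 -> \sum_a f a * g (s - a) = f s * g s * jacobi f g.
Proof.
move=> fM gM s0; rewrite (reindex_inj (mulfI s0)) /jacobi mulr_sumr; apply: eq_bigr => a _ /=.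
have -> : s - s * a = s * (1 - a) by rewrite mulrBr mulr1.
by rewrite fM gM mulrACA.
Qed.

(** Collect the product by the sum [s] of the two arguments: scaling gives the Jacobi sum for
    [s != 0], and [s = 0] gives a complete sum of the nontrivial character [f * g]. *)
Lemma gauss_mul_jacobi (f g : 'F_p -> K) c :
  f 0 = 0 -> (forall a b, f (a * b) = f a * f b) -> (forall a b, g (a * b) = g a * g b) ->
  f c * g c != 1 -> c != 0 ->
  gauss f 1 * gauss g 1 = jacobi f g * gauss (fun a => f a * g a) 1.
Proof.
move=> f0 fM gM fc c0.
have fgM a b : f (a * b) * g (a * b) = f a * g a * (f b * g b) by rewrite fM gM mulrACA.
rewrite /gauss big_distrlr /=.
transitivity (\sum_a \sum_s f a * g (s - a) * ezp s).
  apply: eq_bigr => a _; rewrite (reindex_inj (addIr (- a))) /=; apply: eq_bigr => s _.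
  by rewrite !mulr1 mulrACA -ezpD addrCA subrr addr0.
rewrite exchange_big mulr_sumr; apply: eq_bigr => s _; rewrite mulr1 -mulr_suml mulrA; congr (_ * _).
have [->|s0] := eqVneq s 0; last by rewrite jacobi_scale // mulrC.
rewrite f0 mul0r mulr0 (eq_bigr (fun a => g (-1) * (f a * g a))) => [|a _]; last first.
  by rewrite sub0r -[- a]mulN1r gM mulrCA.
by rewrite -mulr_sumr (sum_char (f := fun a => f a * g a) fgM fc c0) mulr0.
Qed.

End GaussSums.

Lemma prim_root_exists (F : closedFieldType) n : (0 < n)%N -> n%:R != 0 :> F ->
  exists z : F, n.-primitive_root z.
Proof.
move=> n0 nF; have [rs Drs] := closed_field_poly_normal ('X^n - 1 : {poly F}).
have lc : lead_coef ('X^n - 1 : {poly F}) = 1 by rewrite (monicP (monic_Xn_sub_1 _ n0)).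
rewrite lc scale1r in Drs.
have Urs : uniq rs by rewrite -separable_prod_XsubC -Drs separable_Xn_sub_1.
have srs : size rs = n.
  by apply: succn_inj; rewrite -(size_prod_XsubC rs id) -Drs size_XnsubC.
have /hasP[z _ zp] : has n.-primitive_root rs.
  apply: has_prim_root; rewrite ?srs //.
  apply/allP => z zrs; have : root ('X^n - 1 : {poly F}) z by rewrite Drs root_prod_XsubC.
  by rewrite /root !hornerE unity_rootE subr_eq0.
by exists z.
Qed.

(** * Quadratic reciprocity through Gauss sums *)

Section Reciprocity.
Variables (p q : nat) (e : 'F_p -> int) (c : 'F_p).
Hypotheses (p_prime : prime p) (q_prime : prime q).
Hypotheses (p_neq_q : p != q) (q_odd : odd q).
Hypothesis e0 : e 0 = 0.
Hypothesis eM : forall a b, e (a * b) = e a * e b.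
Hypothesis e_sqr : forall a, a != 0 -> e a * e a = 1.
Hypothesis e_nontriv : c != 0 /\ e c = -1.
Hypothesis eN1 : e (-1) = 1.

(** In an algebraic closure of ['F_q] the Gauss sum [t] of [e] is a square root of [p], as
    [e (-1) = 1], and Frobenius multiplies it by [e q]. So [e q = 1] exactly when [t] lies in
    ['F_q], that is, when [p] is a square modulo [q]. *)
Lemma quadratic_reciprocity :
  (e q%:R == 1) = [exists x : 'I_q, (x%:Z ^+ 2 == p%:Z %[mod q%:Z])%Z].
Proof.
have [K [iota _]] := countable_algebraic_closure 'F_q.
have chK : q \in [pchar K] by rewrite (rmorph_pchar iota) // pchar_Fp.
have pK : p%:R != 0 :> K.
  by rewrite -(dvdn_pcharf chK) dvdn_prime2 // eq_sym.
have [z zp] := @prim_root_exists K p (prime_gt0 p_prime) pK.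
pose f a : K := (e a)%:~R.
have two : (2%:R != 0 :> K).
  by rewrite -(dvdn_pcharf chK) dvdn_prime2 //; apply: contraTneq q_odd => ->.
have one_neq : (-1 : K) != 1 by rewrite eq_sym -subr_eq0 opprK.
have fM a b : f (a * b) = f a * f b by rewrite /f eM intrM.
have f0 : f 0 = 0 by rewrite /f e0.
have [c0 ec] := e_nontriv.
have fc : f c != 1 by rewrite /f ec.
have ff a : a != 0 -> f a * f a = 1 by move=> a0; rewrite /f -intrM e_sqr.
pose t := gauss z f 1.
have t2 : t * t = p%:R.
  by rewrite (gauss_mul_inv p_prime zp f0 fM f0 ff fc c0) /f eN1 mul1r.
have t0 : t != 0 by apply: contraNneq pK => t0; rewrite -t2 t0 mul0r.
have q0 : (q%:R : 'F_p) != 0.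
  rewrite -(dvdn_pcharf (pchar_Fp p_prime)) dvdn_prime2 //.
have tq : t ^+ q = f q%:R * t.
  (* Frobenius fixes the values [0], [1], [-1] of [f], the last because [q] is odd, and multiplies
     the argument of the additive character by [q]. *)
  have -> : t ^+ q = gauss z f q%:R.
    rewrite -[_ ^+ q](pFrobenius_autE chK) rmorph_sum; apply: eq_bigr => a _.
    rewrite rmorphM /= !pFrobenius_autE; congr (_ * _).
      rewrite /f; have [->|a0] := eqVneq a 0; first by rewrite e0 expr0n; case: (q) q_prime.
      have : (e a == 1) || (e a == -1).
        by rewrite -sqrf_eq1 expr2 e_sqr.
      case/orP => /eqP->; first by rewrite expr1n.
      by rewrite rmorphN1 -signr_odd q_odd.
    rewrite mulr1 [a * _]mulrC ezpM // /ezp val_Fp_nat // expr_mod //.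
    by rewrite exprAC (prim_expr_order zp) expr1n.
  by rewrite /t -(gauss_scale z fM q0) mulrA ff // mul1r.
have eq1 : (e q%:R == 1) = (t ^+ q == t).
  rewrite tq; have -> : (f q%:R * t == t) = (f q%:R == 1).
    by apply/eqP/eqP => [h|->]; [apply: (mulIf t0); rewrite h mul1r | rewrite mul1r].
  have : (e q%:R == 1) || (e q%:R == -1) by rewrite -sqrf_eq1 expr2 e_sqr.
  by case/orP => /eqP e1; rewrite /f e1 ?eqxx // rmorphN1 (negPf one_neq).
rewrite eq1; apply/idP/existsP => [/eqP tqt | [x /eqP xp]].
  (* The roots of [X ^ q - X] are exactly the images of the elements of ['F_q]. *)
  have : root (\prod_(x : 'F_q) ('X - (iota x)%:P)) t.
    rewrite (_ : \prod_x _ = map_poly iota ('X^#|'F_q| - 'X)).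
      by rewrite rmorphB /= map_polyXn map_polyX card_Fp // /root !hornerE tqt subrr.
    by rewrite finField_genPoly rmorph_prod; apply: eq_bigr => x _; rewrite rmorphB /= map_polyX map_polyC.
  rewrite -(big_map iota predT (fun x => 'X - x%:P)) root_prod_XsubC => /mapP[x _ tx].
  have lt : (x < q)%N by rewrite -[X in (_ < X)%N](Fp_cast q_prime) ltn_ord.
  exists (Ordinal lt) => /=.
  have : x * x = p%:R by apply: (fmorph_inj iota); rewrite rmorphM -tx t2 rmorph_nat.
  move/(congr1 (fun y : 'F_q => (y : nat))); rewrite val_Fp_nat //= => xx.
  rewrite expr2 -PoszM !modz_nat -xx; apply/eqP; congr Posz.
  by rewrite [X in _ = (_ %% X)%N](Fp_cast q_prime).
have xt : (x%:R : K) ^+ 2 = t ^+ 2.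
  rewrite [t ^+ 2]expr2 t2 -natrX -[RHS](rmorph_nat iota) -(rmorph_nat iota (x ^ 2)); congr (iota _).
  apply/val_inj; rewrite /= !val_Fp_nat //.
  by move: xp; rewrite expr2 -PoszM !modz_nat => -[->].
have xq : (x%:R : K) ^+ q = x%:R by rewrite -(pFrobenius_autE chK) rmorph_nat.
move/eqP: xt; rewrite eqf_sqr => /orP[/eqP <-|/eqP xt]; first by rewrite xq.
rewrite -(opprK t) -xt -(pFrobenius_autE chK) rmorphN /= pFrobenius_autE xq //.
Qed.

End Reciprocity.

(** * Kloosterman sums *)

Section Annihilator.
Variable m : nat.
Local Notation q := m.+2.
Local Notation A := 'I_q.

Definition ann (r : A) : nat := #|[set w : A | r * w == 0]|.

Lemma ann_fiber (r c : A) : (#|[set w : A | (r * w == c)%R]| <= ann r)%N.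
Proof.
have [/existsP[w0 /eqP e0]|] := boolP [exists w0, r * w0 == c]; last first.
  move=> /existsPn h; rewrite (_ : [set w | _] = finset.set0) ?cards0 //.
  by apply/setP => w; rewrite !inE; apply/negbTE/h.
rewrite -(card_imset (mem [set w : A | r * w == c]) (@addIr _ (- w0))) /ann.
apply: subset_leq_card; apply/fintype.subsetP => w /imsetP[w1]; rewrite !inE => /eqP e1 ->.
by rewrite mulrBr e0 e1 subrr.
Qed.

Lemma annE (r : A) : ann r = gcdn r q.
Proof.
have g0 : (0 < gcdn r q)%N by rewrite gcdn_gt0 orbT.
have e0 (w : A) : (r * w == 0) = (q %/ gcdn r q %| w)%N.
  have -> : (r * w == 0) = (q %| r * w)%N.
    by rewrite -val_eqE /= -/(dvdn _ _).
  have {1}-> : q = (gcdn r q * (q %/ gcdn r q))%N by rewrite mulnC divnK ?dvdn_gcdr.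
  have er : (r : nat) = (gcdn r q * (r %/ gcdn r q))%N by rewrite mulnC divnK ?dvdn_gcdl.
  rewrite {3}er -mulnA dvdn_pmul2l // Gauss_dvdr //.
  rewrite /coprime -(eqn_pmul2l g0) muln1 muln_gcdr -er.
  by rewrite [(gcdn r q * (q %/ _))%N]mulnC divnK ?dvdn_gcdr // gcdnC.
rewrite /ann; under eq_finset => w do rewrite e0.
set h := (q %/ gcdn r q)%N.
have eq : q = (gcdn r q * h)%N by rewrite mulnC divnK ?dvdn_gcdr.
have h0 : (0 < h)%N by rewrite divn_gt0 // dvdn_leq // dvdn_gcdr.
have lt (i : 'I_(gcdn r q)) : (i * h < q)%N.
  by rewrite [ltnRHS]eq ltn_mul2r h0 ltn_ord.
pose F (i : 'I_(gcdn r q)) : A := Ordinal (lt i).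
rewrite (_ : [set w : A | _] = F @: [set: _]).
  rewrite card_imset ?cardsT ?card_ord // => i j [] /eqP.
  by rewrite eqn_pmul2r // => /eqP/val_inj.
apply/setP => w; rewrite inE; apply/idP/imsetP => [hw | [i _ ->]]; last by rewrite /= dvdn_mull.
have lti : (w %/ h < gcdn r q)%N by rewrite ltn_divLR // -eq ltn_ord.
by exists (Ordinal lti); rewrite // ; apply/val_inj; rewrite /= divnK.
Qed.

Lemma ann_mul (a b : A) : (ann (a * b)%R <= ann a * ann b)%N.
Proof.
have sub : {in [set w : A | a * b * w == 0], forall w, b * w \in [set w : A | a * w == 0]}.
  by move=> w; rewrite !inE mulrA.
rewrite /ann -sum1_card (partition_big (fun w => b * w) (mem [set w : A | a * w == 0])) /=; last first.
  by move=> w hw; exact: sub.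
rewrite -sum_nat_const leq_sum // => c _.
apply: leq_trans (ann_fiber b c).
rewrite -sum1_card big_mkcond [leqRHS]big_mkcond; apply: leq_sum => w _.
by rewrite !inE; case: (_ == 0) => //=.
Qed.

Lemma sum_ann : (\sum_(a : A) ann a <= q * numdiv q)%N.
Proof. by under eq_bigr => a _ do rewrite annE; exact: sum_gcdn. Qed.

Lemma sum_comp_mul (R : numDomainType) (r : A) (G : A -> R) : (forall w, 0 <= G w) ->
  \sum_(w : A) G (r * w) <= (ann r)%:R * \sum_(w : A) G w.
Proof.
move=> G0; rewrite (partition_big (fun w => r * w) predT) //= mulr_sumr.
apply: ler_sum => c _.
rewrite (eq_bigr (fun=> G c)) => [|w /eqP -> //].
rewrite sumr_const -[leLHS]mulr_natl ler_wpM2r ?G0 // ler_nat.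
by apply: leq_trans (ann_fiber r c); rewrite cardsE.
Qed.

Definition kl_quads : {set (A * A) * (A * A)} :=
  [set t : (A * A) * (A * A) | [&& t.1.1 \is a GRing.unit, t.1.2 \is a GRing.unit,
      t.2.1 \is a GRing.unit, t.2.2 \is a GRing.unit,
      t.1.1^-1 + t.1.2^-1 == t.2.1^-1 + t.2.2^-1 & t.1.1 + t.1.2 == t.2.1 + t.2.2]].

(* With [x + y = t + u] the equations give [(x + y) (t - x) (y - t) = 0]. *)
Lemma card_kl_quads : (#|kl_quads| <= 2 * (q * numdiv q) ^ 2)%N.
Proof.
set S := kl_quads.
pose f (t : (A * A) * (A * A)) := (t.1.1, t.1.2, t.2.1).
have fS : {in S, forall t, let: (x, y, z) := f t in (x + y) * (z - x) * (y - z) == 0}.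
  move=> [[x y] [z w]]; rewrite !inE /= => /and5P[ux uy uz uw /andP[/eqP e1 /eqP e2]].
  have ew : w = x + y - z by rewrite e2 addrAC subrr add0r.
  have e3 : (x + y) * (z * w) = (x + y) * (x * y).
    have h1 : (x^-1 + y^-1) * (x * y) = x + y.
      by rewrite mulrDl mulrA mulVr // mul1r mulrCA mulVr // mulr1 addrC.
    have h2 : (z^-1 + w^-1) * (z * w) = z + w.
      by rewrite mulrDl mulrA mulVr // mul1r mulrCA mulVr // mulr1 addrC.
    by rewrite -{1}h1 e1 mulrAC h2 -e2.
  by move: e3; rewrite ew => /eqP; rewrite -subr_eq0 => /eqP e; apply/eqP; rewrite -e; ring.
have finj : {in S &, injective f}.
  move=> [[x y] [z w]] [[x' y'] [z' w']]; rewrite !inE /= => /and5P[_ _ _ _ /andP[_ /eqP e]].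
  move=> /and5P[_ _ _ _ /andP[_ /eqP e']] [ex ey ez]; move: e' ; rewrite -ex -ey -ez e.
  by move=> /addrI ->; rewrite ex ey ez.
rewrite -(card_in_imset finj).
pose T := [set t : A * A * A | let: (x, y, z) := t in (x + y) * (z - x) * (y - z) == 0].
apply: (@leq_trans #|T|).
  apply/subset_leq_card/fintype.subsetP => t /imsetP[s sS ->]; rewrite inE; exact: fS.
pose g (t : A * A * A) := let: (x, y, z) := t in (x + y, z - x, y - z).
pose T0 := [set t : A * A * A | let: (a, b, c) := t in a * b * c == 0].
(* The three factors [x + y], [z - x], [y - z] add up to [2 * y], so they leave at most [ann 2 <= 2]
   choices for [y], and then determine [z] and [x]. *)
have c1 : (#|T| <= 2 * #|T0|)%N.
  rewrite -sum1_card (partition_big g (mem T0)) /=; last first.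
    by move=> [[x y] z]; rewrite !inE.
  rewrite mulnC -sum_nat_const leq_sum // => -[[a b] c] _.
  apply: (@leq_trans (ann 2)); last first.
    by rewrite annE Zp_nat /= gcdn_modl; apply: dvdn_leq; rewrite // dvdn_gcdl.
  apply: leq_trans (ann_fiber 2 (a + b + c)).
  rewrite sum1dep_card.
  rewrite -(card_in_imset (f := fun t : A * A * A => t.1.2)); last first.
    move=> [[x y] z] [[x' y'] z']; rewrite !inE /= => /andP[_ /eqP[e1 e2 e3]] /andP[_ /eqP[e1' e2' e3']] ey.
    have ez : z = z' by apply: oppr_inj; apply: (addrI y); rewrite e3 {1}ey e3'.
    by rewrite ey ez; congr (_, _, _); apply: oppr_inj; apply: (addrI z'); rewrite -{1}ez e2 e2'.
  apply/subset_leq_card/fintype.subsetP => y /imsetP[[[x y'] z]]; rewrite !inE /= => /andP[_ /eqP[<- <- <-]] ->.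
  by apply/eqP; ring.
apply: (leq_trans c1); rewrite leq_mul2l /=.
rewrite -sum1_card (eq_bigl (fun t : A * A * A => t.1.1 * t.1.2 * t.2 == 0)); last first.
  by move=> [[a b] c]; rewrite inE.
rewrite (eq_bigr (fun t => (fun (u : A * A) (c : A) => 1%N) t.1 t.2)) //.
rewrite -(pair_big_dep predT (fun (u : A * A) (c : A) => u.1 * u.2 * c == 0) (fun _ _ => 1%N)) /=.
(* Given [a] and [b], the equation [a * b * c = 0] has [ann (a * b) <= ann a * ann b] solutions [c],
   so the count is at most the square of the sum of all [ann a]. *)
apply: (@leq_trans (\sum_(u : A * A) ann u.1 * ann u.2)%N).
  apply: leq_sum => u _; apply: leq_trans (ann_mul _ _).
  by rewrite /ann -sum1_card big_mkcond [leqRHS]big_mkcond; apply: leq_sum => w _; rewrite inE.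
rewrite -(pair_big predT predT (fun a b => ann a * ann b)%N) /=.
under eq_bigr => a _ do rewrite -big_distrr.
by rewrite -big_distrl /= leq_mul // sum_ann.
Qed.

End Annihilator.

Section Kloosterman.
Variables (C : numClosedFieldType) (m : nat).
Local Notation q := m.+2.
Local Notation A := 'I_q.
(** Of the root of unity only the modulus, the order and the distance of its powers from [1] are
    used; [expi_root_far] provides the last one for the analytic root. *)
Variable z : C.
Hypothesis z_norm : `|z| = 1.
Hypothesis z_unity : z ^+ q = 1.
Hypothesis z_far : forall h : A, h != 0 ->
  (minn h (q - h))%:R / q%:R <= `|z ^+ h - 1|.

Definition ez (x : A) : C := z ^+ x.

Lemma ez0 : ez 0 = 1.
Proof. by rewrite /ez expr0. Qed.

Lemma ezD x y : ez (x + y) = ez x * ez y.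
Proof. by rewrite /ez /= expr_mod // exprD. Qed.

Lemma ez_norm x : `|ez x| = 1.
Proof. by rewrite /ez normrX z_norm expr1n. Qed.

Lemma ez_neq0 x : ez x != 0.
Proof. by rewrite -normr_eq0 ez_norm oner_eq0. Qed.

Lemma ezN x : ez (- x) = (ez x)^-1.
Proof.
by apply: (mulfI (ez_neq0 x)); rewrite -ezD subrr ez0 mulfV // ez_neq0.
Qed.

Lemma ez_conj x : (ez x)^* = ez (- x).
Proof. by rewrite ezN invC_norm ez_norm expr1n invr1 mul1r. Qed.

Lemma ez_sub1 x : `|ez (- x) - 1| = `|ez x - 1|.
Proof.
have -> : ez (- x) - 1 = - (ez x - 1) * ez (- x).
  by rewrite mulNr mulrBl -ezD subrr ez0 mul1r opprB.
by rewrite normrM normrN ez_norm mulr1.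
Qed.

Lemma ez_neq1 h : h != 0 -> ez h - 1 != 0.
Proof.
move=> h0; rewrite -normr_gt0; apply: lt_le_trans (z_far h0).
rewrite divr_gt0 ?ltr0n // leq_min subn_gt0 ltn_ord andbT lt0n.
by move: h0; rewrite -val_eqE.
Qed.

Lemma geom_root (w : C) : w ^+ q = 1 -> w - 1 != 0 -> \sum_(i < q) w ^+ i = 0.
Proof.
move=> wq w1; apply: (mulfI w1).
by rewrite mulr0 -subrX1 wq subrr.
Qed.

Lemma ezM (r c : A) : ez (r * c) = ez c ^+ r.
Proof. by rewrite /ez /= expr_mod // mulnC exprM. Qed.

Lemma ez_unity c : ez c ^+ q = 1.
Proof. by rewrite /ez -exprM mulnC exprM z_unity expr1n. Qed.

Lemma sum_ez (c : A) : \sum_(r : A) ez (r * c) = (c == 0)%:R * q%:R.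
Proof.
have [->|c0] := eqVneq c 0.
  rewrite (eq_bigr (fun=> 1)) => [|r _]; last by rewrite mulr0 ez0.
  by rewrite sumr_const card_ord mul1r.
rewrite mul0r; under eq_bigr => r _ do rewrite ezM.
by apply: geom_root; rewrite ?ez_unity ?ez_neq1.
Qed.

Definition kl (r s : A) : C := \sum_(x | x \is a GRing.unit) ez (r * x^-1 + s * x).

Lemma kl_scale (r s w : A) : w \is a GRing.unit -> kl (r * w) (s * w^-1) = kl r s.
Proof.
move=> uw; rewrite /kl (reindex_inj (mulrI uw)) /=.
apply: eq_big => [x|x]; first by rewrite unitrMr.
rewrite unitrMr // => ux; congr ez; congr (_ + _).
  by rewrite invrM // -mulrA [w * _]mulrC -mulrA mulVr // mulr1.
by rewrite -mulrA [w^-1 * _]mulrA mulVr // mul1r.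
Qed.

(** [|kl| ^ 4] is [kl ^ 2] times its conjugate, a sum over four units; orthogonality in [r] and in
    [s] imposes the two equations of [kl_quads]. *)
Lemma kl_moment : \sum_(r : A) \sum_(s : A) `|kl r s| ^+ 4 = q%:R ^+ 2 * #|kl_quads m|%:R.
Proof.
pose f1 (t : A * A) := t.1^-1 + t.2^-1; pose f2 (t : A * A) := t.1 + t.2.
pose un (t : A * A) := (t.1 \is a GRing.unit) && (t.2 \is a GRing.unit).
have e2 r s : kl r s ^+ 2 = \sum_(t | un t) ez (r * f1 t + s * f2 t).
  rewrite expr2 /kl big_distrlr /= pair_big /=; apply: eq_bigr => t _.
  by rewrite -ezD /f1 /f2; congr ez; rewrite !mulrDr addrACA.
have e4 r s : `|kl r s| ^+ 4 = \sum_(t | un t) \sum_(t' | un t')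
     ez (r * (f1 t - f1 t')) * ez (s * (f2 t - f2 t')).
  rewrite -[4%N]/(2 * 2)%N exprM normCK exprMn -rmorphXn /= e2 rmorph_sum big_distrlr /=.
  apply: eq_bigr => t _; apply: eq_bigr => t' _.
  by rewrite ez_conj -!ezD; congr ez; rewrite !mulrBr opprD addrACA.
under eq_bigr => r _.
  under eq_bigr => s _ do rewrite e4.
  rewrite exchange_big /=.
  under eq_bigr => t _.
    rewrite exchange_big /=.
    under eq_bigr => t' _ do rewrite -mulr_sumr sum_ez.
    over.
  over.
rewrite exchange_big /=.
under eq_bigr => t _.
  rewrite exchange_big /=.
  under eq_bigr => t' _ do rewrite -mulr_suml sum_ez.
  over.
rewrite pair_big /= -sum1_card natr_sum mulr_sumr [RHS]big_mkcond [LHS]big_mkcond /=.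
apply: eq_bigr => -[[x y] [x' y']] _; rewrite /un !inE /= /f1 /f2 /= !subr_eq0 -!andbA.
by do 4 case: (_ \is a GRing.unit) => //=; do 2 case: (_ == _);
  rewrite /= ?(mulr0n, mulr1n, mulr0, mul0r, mulr1, mul1r, expr2).
Qed.

Lemma card_units : #|[set w : A | w \is a GRing.unit]| = totient q.
Proof.
rewrite totient_count_coprime big_mkord -sum1_card big_mkcond /=.
apply: eq_bigr => i _; rewrite inE.
have -> : (i \is a GRing.unit) = coprime q i.
  by have := @unitZpE q i isT; rewrite (natr_Zp (i : 'Z_q)).
by case: coprime.
Qed.

(* By [kl_scale] the value at [(r, s)] occurs [totient q] times in the moment,
   up to the [ann r] coincidences among the [r * w]. *)
Lemma kl_bound4 (r s : A) :
  `|kl r s| ^+ 4 <= 2 * (ann r)%:R * (numdiv q)%:R ^+ 3 * q%:R ^+ 3.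
Proof.
have F0 r' s' : 0 <= `|kl r' s'| ^+ 4 by rewrite exprn_ge0.
have h1 : (totient q)%:R * `|kl r s| ^+ 4 <= (ann r)%:R * (q%:R ^+ 2 * #|kl_quads m|%:R).
  rewrite -kl_moment; apply: le_trans (_ : _ <= \sum_(w : A) (\sum_s' `|kl (r * w) s'| ^+ 4)) _; last first.
    apply: (@sum_comp_mul m C r (fun r' => \sum_s' `|kl r' s'| ^+ 4)) => w; exact: sumr_ge0.
  rewrite -card_units -sum1_card natr_sum mulr_suml [leLHS]big_mkcond; apply: ler_sum => w _.
  rewrite inE; case: ifP => [uw|_]; last exact: sumr_ge0.
  by rewrite mul1r -(kl_scale r s uw) (bigD1 (s * w^-1)) //= lerDl sumr_ge0.
have d0 : 0 < (numdiv q)%:R :> C by rewrite ltr0n numdiv_gt0.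
have q0 : 0 < q%:R :> C by rewrite ltr0n.
rewrite -(ler_pM2l q0).
apply: (@le_trans _ _ ((numdiv q)%:R * ((totient q)%:R * `|kl r s| ^+ 4))).
  rewrite mulrA ler_wpM2r // -natrM ler_nat mulnC; exact: leq_totient_numdiv.
apply: (@le_trans _ _ ((numdiv q)%:R * ((ann r)%:R * (q%:R ^+ 2 * (2 * (q * numdiv q) ^ 2)%N%:R)))).
  apply: ler_wpM2l; first exact: ltW.
  apply: (le_trans h1); do 2 (apply: ler_wpM2l; rewrite ?exprn_ge0 ?ler0n //).
  by rewrite ler_nat card_kl_quads.
rewrite natrM natrX natrM le_eqVlt; apply/orP; left; apply/eqP.
by move: (numdiv q)%:R (ann r)%:R => a b; ring.
Qed.

(** * Completion of sums over inverses by finite Fourier expansion *)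

Definition dft (f : A -> C) (k : A) : C := \sum_x f x * ez (- (k * x)).

Lemma dft_inv f x : f x = q%:R^-1 * \sum_k dft f k * ez (k * x).
Proof.
have q0 : q%:R != 0 :> C by rewrite pnatr_eq0.
rewrite /dft; under eq_bigr => k _ do rewrite mulr_suml.
rewrite exchange_big /=.
under eq_bigr => y _.
  rewrite (eq_bigr (fun k => f y * ez (k * (x - y)))); last first.
    by move=> k _; rewrite -mulrA -ezD mulrBr addrC.
  rewrite -mulr_sumr sum_ez; over.
rewrite (bigD1 x) //= subrr eqxx mul1r big1 => [|y ny]; last first.
  by rewrite subr_eq0 eq_sym (negPf ny) mul0r mulr0.
by rewrite addr0 mulrCA mulVf // mulr1.
Qed.

(** A frequency [h] of [g] and [k] of [f] combine into the phase [h * N / x + k * x], so a weighted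
    sum over inverses becomes an average of complete Kloosterman sums. *)
Lemma kl_correlation (f g : A -> C) (N : A) :
  \sum_(x | x \is a GRing.unit) f x * g (N * x^-1) =
  q%:R^-1 ^+ 2 * \sum_h \sum_k dft g h * dft f k * kl (h * N) k.
Proof.
under eq_bigr => x _.
  rewrite (dft_inv f) (dft_inv g) mulrACA -expr2 big_distrlr /= exchange_big /=; over.
rewrite -mulr_sumr; congr (_ * _); rewrite exchange_big; apply: eq_bigr => h _ /=.
rewrite exchange_big; apply: eq_bigr => k _ /=; rewrite /kl mulr_sumr.
apply: eq_bigr => x _; rewrite mulrACA -ezD mulrA [dft f k * _]mulrC.
by congr (_ * ez _); rewrite ?mulrA // addrC ?mulrA.
Qed.

(** By [z_far] the reciprocal distance is at most [q / h + q / (q - h)], and the symmetry of [a]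
    identifies the two resulting sums. *)
Lemma sum_inv_far (a : nat -> nat) : (forall h, (h <= q)%N -> a (q - h)%N = a h) ->
  \sum_(h : A | h != 0) (a h)%:R / `|ez h - 1| <=
  2 * q%:R * \sum_(1 <= h < q.+1) (a h)%:R / h%:R.
Proof.
move=> a_sym.
have q0 : 0 < q%:R :> C by rewrite ltr0n.
apply: (@le_trans _ _ (\sum_(1 <= h < q) q%:R * ((a h)%:R / h%:R + (a h)%:R / (q - h)%N%:R))).
  rewrite [leRHS](_ : _ = \sum_(h < q | h != 0) q%:R * ((a h)%:R / h%:R + (a h)%:R / (q - h)%N%:R)); last first.
    rewrite [RHS]big_mkcond big_ord_recl /= add0r big_add1 big_mkord /=.
    by apply: eq_bigr => i _.
  apply: ler_sum => h h0; rewrite -mulrDr mulrCA ler_wpM2l ?ler0n //.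
  have h1 : (0 < h)%N by rewrite lt0n; move: h0; rewrite -val_eqE.
  have h2 : (0 < q - h)%N by rewrite subn_gt0.
  have f0 : 0 < (minn h (q - h))%:R :> C by rewrite ltr0n leq_min h1.
  apply: (@le_trans _ _ (q%:R / (minn h (q - h))%:R)).
    rewrite -[leRHS]invf_div lef_pV2 ?posrE ?normr_gt0 ?ez_neq1 ?divr_gt0 //.
    exact: z_far.
  rewrite ler_wpM2l ?ler0n // /minn; case: ifP => _.
    by rewrite lerDl invr_ge0 ler0n.
  by rewrite lerDr invr_ge0 ler0n.
rewrite -mulr_sumr [2 * q%:R]mulrC -mulrA ler_wpM2l ?ler0n //.
rewrite big_split /= mulr_natl mulr2n.
have le1 : \sum_(1 <= h < q) (a h)%:R / h%:R <= \sum_(1 <= h < q.+1) (a h)%:R / h%:R :> C.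
  by rewrite [leRHS]big_nat_recr //= lerDl divr_ge0 ?ler0n.
apply: lerD => //; apply: le_trans le1.
rewrite big_nat_rev /= big_nat_cond [leRHS]big_nat_cond; apply: ler_sum => h; rewrite andbT => /andP[h1 h2].
by rewrite add1n subSS a_sym ?subKn // ltnW.
Qed.

Lemma sum_inv_far_ann : \sum_(h : A | h != 0) (ann h)%:R / `|ez h - 1| <=
  2 * q%:R * (numdiv q)%:R * harm C q.
Proof.
under eq_bigr => h _ do rewrite annE.
apply: le_trans (@sum_inv_far (fun h => gcdn h q) _) _ => [h hq|].
  have {2 3}-> : q = (h + (q - h))%N by rewrite subnKC.
  by rewrite gcdnDr gcdnDl gcdnC.
by rewrite -[2 * q%:R * _ * _]mulrA ler_wpM2l ?mulr_ge0 ?ler0n // sum_gcdn_div.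
Qed.

Lemma sum_inv_far1 : \sum_(h : A | h != 0) `|ez h - 1|^-1 <= 2 * q%:R * harm C q.
Proof.
have := @sum_inv_far (fun=> 1%N) (fun _ _ => erefl).
by under eq_bigr => h _ do rewrite mul1r; under [X in _ <= _ * X]eq_bigr => h _ do rewrite mul1r.
Qed.

Lemma sum_index_geom (w : C) n :
  (w - 1) * \sum_(j < n) j%:R * w ^+ j = n%:R * w ^+ n - w * \sum_(j < n) w ^+ j.
Proof.
elim: n => [|n IH]; first by rewrite !big_ord0 mul0r !mulr0 subrr.
by rewrite !big_ord_recr /= !mulrDr IH -natr1 exprS; ring.
Qed.

Lemma sum_ord_half n : \sum_(j < n) j%:R = n%:R * (n%:R - 1) / 2 :> C.
Proof.
elim: n => [|n IH]; first by rewrite big_ord0 !mul0r.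
by rewrite big_ord_recr /= IH -natr1; field.
Qed.

(** The representative of [j + m0] in [[0, q)] minus its mean, so that the zero frequency
    vanishes. *)
Definition saw (m0 : A) (j : A) : C := ((j + m0)%R : A)%:R - (q%:R - 1) / 2.

Lemma dft_saw0 m0 : dft (saw m0) 0 = 0.
Proof.
rewrite /dft; under eq_bigr => x _ do rewrite mul0r oppr0 ez0 mulr1.
transitivity (\sum_(j : A) saw m0 (j - m0)); first exact: (reindex_inj (addIr (- m0))).
under eq_bigr => j _ do rewrite /saw subrK.
rewrite sumrB sum_ord_half sumr_const card_ord -mulr_natr; ring.
Qed.

Lemma dft_saw m0 h : h != 0 -> `|dft (saw m0) h| = q%:R / `|ez h - 1|.
Proof.
move=> h0; set w := ez (- h).
have w1 : w - 1 != 0 by apply: ez_neq1; rewrite oppr_eq0.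
have wq : w ^+ q = 1 by exact: ez_unity.
have -> : dft (saw m0) h = ez (h * m0) * (q%:R / (w - 1)).
  rewrite /dft.
  transitivity (\sum_(j : A) saw m0 (j - m0) * ez (- (h * (j - m0)))).
    exact: (reindex_inj (addIr (- m0))).
  rewrite (eq_bigr (fun j : A => ez (h * m0) * ((j%:R - (q%:R - 1) / 2) * w ^+ j))); last first.
    move=> j _; rewrite /saw subrK mulrCA; congr (_ * _).
    rewrite /w -ezM -ezD; congr ez; rewrite mulrBr opprB; congr (_ + _).
    by rewrite mulrN mulrC.
  rewrite -mulr_sumr; congr (_ * _).
  under eq_bigr => j _ do rewrite mulrBl.
  rewrite sumrB -mulr_sumr geom_root // mulr0 subr0.
  apply: (mulfI w1); rewrite sum_index_geom geom_root // mulr0 subr0 wq mulr1.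
  by rewrite mulrCA mulfV // mulr1.
by rewrite normrM ez_norm mul1r normf_div normr_nat ez_sub1.
Qed.

(** [K] stands in for the fourth root of the bound of [kl_bound4]; a real value is supplied in
    [saw_sum_bound]. The other factors come from the absolute sums of the two Fourier transforms. *)
Lemma kl_saw (p x0 M : nat) (N m0 : A) (K : C) : (0 < p)%N -> 0 <= K ->
  2 * (numdiv q)%:R ^+ 3 * q%:R ^+ 3 <= K ^+ 4 ->
  `|\sum_(t < M | ((x0 + p * t)%N%:R : A) \is a GRing.unit)
      saw m0 (N * ((x0 + p * t)%N%:R : A)^-1)|
  <= 2 * K * (ann N)%:R * (numdiv q)%:R * harm C q * p%:R * (M%:R + 4 * q%:R * harm C q).
Proof.
move=> p0 K0 hK; set g := saw m0; pose xt (t : 'I_M) : A := (x0 + p * t)%N%:R.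
(* The progression may meet a residue several times, so [f] counts multiplicities. *)
pose f (x : A) : C := \sum_(t < M) (xt t == x)%:R.
have -> : \sum_(t < M | xt t \is a GRing.unit) g (N * (xt t)^-1) =
   \sum_(x | x \is a GRing.unit) f x * g (N * x^-1).
  rewrite big_mkcond /=; under [RHS]eq_bigr => x _ do rewrite mulr_suml.
  rewrite exchange_big /=; apply: eq_bigr => t _.
  case: ifP => ut.
    rewrite (bigD1 (xt t)) //= eqxx mul1r big1 ?addr0 // => x /andP[_ /negPf nx].
    by rewrite eq_sym nx mul0r.
  rewrite big1 // => x ux; case: eqP => [e|_]; last by rewrite mul0r.
  by rewrite -e ut in ux.
have q0 : 0 < q%:R :> C by rewrite ltr0n.
have H0 : 0 <= harm C q by exact: harm_ge0.
have ann1 (r : A) : 1 <= (ann r)%:R :> C.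
  by rewrite -[1]/(1%N%:R) ler_nat annE gcdn_gt0 orbT.
(* Fourth powers are compared; [ann h * ann N] is at least [1], hence at most its own fourth
   power. *)
have klK h k : `|kl (h * N) k| <= K * (ann h)%:R * (ann N)%:R.
  rewrite -(@ler_pXn2r _ 4) // ?nnegrE ?mulr_ge0 ?ler0n //.
  apply: (le_trans (kl_bound4 _ _)).
  apply: (@le_trans _ _ (K ^+ 4 * ((ann h)%:R * (ann N)%:R))).
    rewrite -mulrA [2 * _]mulrC -mulrA mulrC mulrA.
    apply: ler_pM; rewrite ?mulr_ge0 ?exprn_ge0 ?ler0n //.
    by rewrite -natrM ler_nat ann_mul.
  rewrite -[K * _ * _]mulrA exprMn ler_wpM2l ?exprn_ge0 //.
  by rewrite ler_eXnr // mulr_ege1.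
(* The transform of a progression is a geometric sum: at most [M], or else [2] over the distance of
   its ratio from [1]. The substitution [k -> p * k] takes each value at most [ann p <= p] times. *)
have fB : \sum_k `|dft f k| <= p%:R * (M%:R + 4 * q%:R * harm C q).
  pose G (j : A) : C := if j == 0 then M%:R else 2 / `|ez j - 1|.
  have G0 j : 0 <= G j by rewrite /G; case: ifP; rewrite ?ler0n ?divr_ge0.
  have df k : dft f k = ez (- (k * x0%:R)) * \sum_(t < M) ez (- (p%:R * k)) ^+ t.
    rewrite /dft /f; under eq_bigr => x _ do rewrite mulr_suml.
    rewrite exchange_big mulr_sumr /=; apply: eq_bigr => t _.
    rewrite (bigD1 (xt t)) //= eqxx mul1r big1 ?addr0 => [|x /negPf nx]; last first.
      by rewrite eq_sym nx mul0r.
    have -> : ez (- (p%:R * k)) ^+ t = ez (t%:R * - (p%:R * k)).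
      by elim: (t : nat) => [|i IH]; rewrite ?mul0r ?ez0 // exprS IH -ezD -nat1r mulrDl mul1r.
    rewrite -ezD /xt natrD natrM; congr ez.
    by rewrite mulrDr opprD mulrN; congr (_ - _); rewrite mulrC -mulrA mulrCA.
  apply: (@le_trans _ _ (\sum_k G (p%:R * k))).
    apply: ler_sum => k _; rewrite df normrM ez_norm mul1r /G.
    case: eqP => [->|/eqP pk].
      by rewrite oppr0 ez0; under eq_bigr => t _ do rewrite expr1n; rewrite sumr_const card_ord normr_nat.
    rewrite -(ez_sub1 (p%:R * k)) ler_pdivlMr ?normr_gt0 ?ez_neq1 ?oppr_eq0 //.
    rewrite mulrC -normrM -subrX1 (le_trans (ler_normB _ _)) // normr1 normrX ez_norm expr1n.
    exact: lexx.
  apply: (le_trans (sum_comp_mul _ G0)).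
  apply: ler_pM; rewrite ?ler0n ?sumr_ge0 //.
    by rewrite ler_nat annE Zp_nat /= gcdn_modl dvdn_leq ?dvdn_gcdl.
  rewrite (bigD1 0) //= {1}/G eqxx lerD2l.
  rewrite (eq_bigr (fun j : A => 2 * `|ez j - 1|^-1)); last by move=> j /negPf j0; rewrite /G j0.
  rewrite -mulr_sumr (_ : 4 * q%:R * harm C q = 2 * (2 * q%:R * harm C q)); last by ring.
  by rewrite ler_wpM2l ?ler0n ?sum_inv_far1.
rewrite kl_correlation normrM ger0_norm ?exprn_ge0 ?invr_ge0 ?ler0n //.
apply: (@le_trans _ _ (q%:R^-1 ^+ 2 * (K * (ann N)%:R * (q%:R * (2 * q%:R * (numdiv q)%:R * harm C q))
    * (p%:R * (M%:R + 4 * q%:R * harm C q))))); last first.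
  rewrite le_eqVlt; apply/orP; left; apply/eqP.
  have {}q0 : q%:R != 0 :> C by rewrite pnatr_eq0.
  by move: (harm C q) (numdiv q)%:R (ann N)%:R q0 => a b c; move: (q%:R : C) => d d0; field.
rewrite ler_wpM2l ?exprn_ge0 ?invr_ge0 ?ler0n //.
apply: (le_trans (ler_norm_sum _ _ _)).
apply: (@le_trans _ _ (\sum_(h : A | h != 0) (K * (ann N)%:R * (q%:R * ((ann h)%:R / `|ez h - 1|))
    * \sum_k `|dft f k|))).
  rewrite (bigD1 0) //= (eq_bigr (fun=> 0)) => [|k _]; last by rewrite dft_saw0 !mul0r.
  rewrite big1 // normr0 add0r; apply: ler_sum => h h0.
  apply: (le_trans (ler_norm_sum _ _ _)); rewrite mulr_sumr; apply: ler_sum => k _.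
  rewrite !normrM dft_saw //.
  rewrite (_ : K * _ * _ * _ = q%:R / `|ez h - 1| * `|dft f k| * (K * (ann h)%:R * (ann N)%:R)).
    by rewrite ler_wpM2l ?mulr_ge0 ?invr_ge0 ?ler0n.
  by move: (`|ez h - 1|^-1) => a; ring.
rewrite -mulr_suml; apply: ler_pM => //.
- by apply: sumr_ge0 => h _; rewrite !mulr_ge0 ?invr_ge0 ?ler0n.
- exact: sumr_ge0.
rewrite -mulr_sumr ler_wpM2l ?mulr_ge0 ?ler0n // -mulr_sumr ler_wpM2l ?ler0n //.
exact: sum_inv_far_ann.
Qed.

End Kloosterman.

(** * Fourier series of Bernoulli polynomials *)

Section SeriesTail.
Variable F : numFieldType.

(** Comparison with the telescoping terms [2 / n - 2 / (n + 1)], which dominate [1 / n ^ 2] for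
    [n >= 1]. *)
Lemma sum_inv_sqr_tail M N :
  \sum_(M.+1 <= n < N.+1) n%:R^-1 ^+ 2 <= 2 / M.+1%:R :> F.
Proof.
have [NM|MN] := ltnP N M.
  by rewrite big_geq; [rewrite divr_ge0 ?ler0n | rewrite ltnS ltnW].
apply: (@le_trans _ _ (\sum_(M.+1 <= n < N.+1) 2 * (n%:R^-1 - n.+1%:R^-1))).
  rewrite big_nat_cond [leRHS]big_nat_cond; apply: ler_sum => n; rewrite andbT => /andP[n0 _].
  have n1 : 0 < n%:R :> F by rewrite ltr0n (leq_trans _ n0).
  have n2 : 0 < n.+1%:R :> F by rewrite ltr0n.
  have -> : 2 * (n%:R^-1 - n.+1%:R^-1) = n%:R^-1 * (2 / n.+1%:R) :> F.
    have -> : 2 * (n%:R^-1 - n.+1%:R^-1) = (n.+1%:R - n%:R) * (2 * n%:R^-1 * n.+1%:R^-1) :> F.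
      move: (n%:R : F) (n.+1%:R : F) (lt0r_neq0 n1) (lt0r_neq0 n2) => a b a0 b0.
      by field; rewrite a0 b0.
    by rewrite -natr1 addrAC subrr add0r mul1r mulrAC mulrC.
  rewrite expr2 ler_wpM2l ?invr_ge0 ?ler0n // ler_pdivlMr // -natr1 mulrDr mulVf ?lt0r_neq0 // mulr1.
  by rewrite -[2]/(1 + 1) lerD2l invf_le1 // ler1n (leq_trans _ n0).
rewrite -mulr_sumr ler_wpM2l ?ler0n //.
rewrite (eq_bigr (fun n => (- n.+1%:R^-1 : F) - - n%:R^-1)); last by move=> n _; rewrite opprK addrC.
by rewrite telescope_sumr // opprK addrC lerBlDr lerDl invr_ge0 ler0n.
Qed.

End SeriesTail.

(** * Trigonometric series with explicit rates *)

Section Trigonometry.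
Local Open Scope classical_set_scope.
Local Open Scope ring_scope.
Variable R : realType.
Implicit Types t : R.

Lemma sin_natpi n : sin (n%:R * pi) = 0 :> R.
Proof.
elim: n => [|n IH]; first by rewrite mul0r sin0.
by rewrite -natr1 mulrDl mul1r sinDpi IH oppr0.
Qed.

Lemma cos_pi4_ge : 2^-1 <= cos (pi / 4) :> R.
Proof.
have c0 : 0 <= cos (pi / 4) :> R by apply: cos_ge0_pihalf; have := pi_gt0 R; lra.
have := cos_mulr2n (pi / 4 : R); rewrite (_ : pi / 4 *+ 2 = pi / 2); last by rewrite -mulr_natr; field.
by rewrite cos_pihalf; move: c0; set c := cos _; rewrite -mulr_natr => c0 h; nra.
Qed.

Lemma derivable_bound_le (f df : R -> R) (a b K : R) : a <= b ->
  (forall x, a <= x <= b -> is_derive x (1 : R) f (df x)) ->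
  (forall x, a <= x <= b -> `|df x| <= K) -> `|f b - f a| <= K * (b - a).
Proof.
move=> ab fd fK.
have [c] : exists2 c, c \in `[a, b]%R & f b - f a = df c * (b - a).
  apply: MVT_segment => // [x|].
    by rewrite in_itv /= => /andP[xa xb]; apply: fd; rewrite !ltW.
  apply: derivable_within_continuous => x; rewrite in_itv /= => xab.
  by have [] := fd x xab.
rewrite in_itv /= => cab ->; rewrite normrM [`|b - a|]ger0_norm ?subr_ge0 //.
by rewrite ler_wpM2r ?subr_ge0 // fK.
Qed.

(** Up to [pi / 4] the derivative is at least [1 / 2]; beyond it [sin t >= sin (pi / 4) >= 1 / 2],
    and [t < 2]. *)
Lemma sin_ge_quarter t : 0 <= t <= pi / 2 -> t / 4 <= sin t.
Proof.
have p2 := pi_ge2 R; have p4 := pihalf_lt2 R.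
move=> /andP[t0 t1]; have [t2|t2] := leP t (pi / 4).
  have [->|tn0] := eqVneq t 0; first by rewrite sin0 mul0r.
  have [c] : exists2 c, c \in `[0, t]%R & sin t - sin 0 = cos c * (t - 0).
    apply: (@MVT_segment _ sin cos); first by [].
    by apply: continuous_subspaceT; exact: continuous_sin.
  rewrite in_itv /= sin0 !subr0 => /andP[c0 ct] ->.
  have : 2^-1 <= cos c.
    apply: le_trans cos_pi4_ge _; have [->//|nc] := eqVneq c (pi / 4).
    have ltc : c < pi / 4 by rewrite lt_neqAle nc (le_trans ct).
    rewrite ltW // ltr_cos ?in_itv /=; try (apply/andP; split); lra.
  by move: (cos c) => k; nra.
have s4 : 2^-1 <= sin (pi / 4) :> R.
  have -> : sin (pi / 4) = cos (pi / 4) :> R; last exact: cos_pi4_ge.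
  by rewrite -cosBpihalf -cosN; congr cos; field.
apply: (@le_trans _ _ 2^-1); first lra.
apply: (le_trans s4); rewrite ltW // ltr_sin ?in_itv /=; try (apply/andP; split); lra.
Qed.

Definition sinS N t : R := \sum_(1 <= n < N.+1) sin (n%:R * t) / n%:R.
Definition cosS N t : R := \sum_(1 <= n < N.+1) cos (n%:R * t) / n%:R ^+ 2.

Global Instance is_derive_sin_scale (c t : R) : is_derive t 1 (fun x => sin (c * x)) (c * cos (c * t)).
Proof.
have h : is_derive t 1 (fun x : R => c * x) c.
  by apply: (is_derive_eq (is_deriveZ _ _)); rewrite /GRing.scale /= mulr1.
rewrite [c * cos _]mulrC.
exact: (@is_derive1_comp _ sin (fun x => c * x) t _ _ (is_derive_sin _) h).
Qed.

Global Instance is_derive_cos_scale (c t : R) : is_derive t 1 (fun x => cos (c * x)) (- (c * sin (c * t))).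
Proof.
have h : is_derive t 1 (fun x : R => c * x) c.
  by apply: (is_derive_eq (is_deriveZ _ _)); rewrite /GRing.scale /= mulr1.
rewrite [c * sin _]mulrC -mulNr.
exact: (@is_derive1_comp _ cos (fun x => c * x) t _ _ (is_derive_cos _) h).
Qed.

Lemma is_derive_sinS N t : is_derive t 1 (sinS N) (\sum_(1 <= n < N.+1) cos (n%:R * t)).
Proof.
elim: N => [|N IH].
  rewrite big_geq //; have -> : sinS 0 = cst 0 by apply/funext => x; rewrite /sinS big_geq.
  exact: is_derive_cst.
have -> : sinS N.+1 = sinS N + (N.+1%:R^-1 \*: (fun x => sin (N.+1%:R * x))).
  by apply/funext => x; rewrite /sinS big_nat_recr //= mulrC.
rewrite big_nat_recr //=; apply: is_deriveD.
apply: (is_derive_eq (is_deriveZ _ _)).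
by rewrite /GRing.scale /= mulrA mulVf ?mul1r // pnatr_eq0.
Qed.

Lemma is_derive_cosS N t : is_derive t 1 (cosS N) (- sinS N t).
Proof.
elim: N => [|N IH].
  have -> : cosS 0 = cst 0 by apply/funext => x; rewrite /cosS big_geq.
  by rewrite /sinS big_geq // oppr0; exact: is_derive_cst.
have -> : cosS N.+1 = cosS N + (N.+1%:R^-1 ^+ 2 \*: (fun x => cos (N.+1%:R * x))).
  by apply/funext => x; rewrite /cosS big_nat_recr //= [_ / _]mulrC exprVn.
rewrite /sinS big_nat_recr //= opprD; apply: is_deriveD.
apply: (is_derive_eq (is_deriveZ _ _)).
have n0 : N.+1%:R != 0 :> R by rewrite pnatr_eq0.
by rewrite /GRing.scale /=; field.
Qed.

Lemma dirichlet_kernel N t :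
  2 * sin (t / 2) * \sum_(1 <= n < N.+1) cos (n%:R * t) = sin ((N%:R + 2^-1) * t) - sin (t / 2).
Proof.
elim: N => [|N IH]; first by rewrite big_geq // mulr0 add0r [2^-1 * t]mulrC subrr.
rewrite big_nat_recr //= mulrDr IH.
have -> : (N.+1%:R + 2^-1) * t = N.+1%:R * t + t / 2 by ring.
have -> : (N%:R + 2^-1) * t = N.+1%:R * t - t / 2 by rewrite -natr1; field.
by rewrite sinB sinD; ring.
Qed.

Lemma sin_half_gt0 t : 0 < t <= pi -> 0 < sin (t / 2).
Proof. by move=> /andP[t0 t1]; apply: sin_gt0_pi; have := pi_gt0 R; lra. Qed.

(** The derivative of the difference oscillates like [sin ((N + 1/2) * x) / (2 * sin (x / 2))]. The
    last summand of [g] has size [1 / N] and cancels this oscillation up to a derivative of size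
    [1 / N]; the mean value inequality on [[t, pi]], where [g pi = 0], then replaces an integration
    by parts. Uniformity in [t >= t0] is what [cosS_lim_half] needs. *)
Lemma sinS_lim_half (t0 t : R) N : 0 < t0 -> t0 <= t <= pi ->
  `|sinS N t - (pi - t) / 2| <= (pi + 2) / sin (t0 / 2) ^+ 2 / N.+1%:R.
Proof.
move=> t00 /andP[t0t tpi].
have p2 := pi_ge2 R.
pose g (x : R) := sinS N x - (pi - x) / 2 + cos ((N%:R + 2^-1) * x) / ((2 * N%:R + 1) * sin (2^-1 * x)).
have n0 : 0 < 2 * N%:R + 1 :> R by rewrite ltr_wpDl ?mulr_ge0 ?ler0n.
have s0 : 0 < sin (t0 / 2) by apply: sin_half_gt0; rewrite t00 (le_trans t0t).
have sle x : t0 <= x <= pi -> sin (t0 / 2) <= sin (x / 2).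
  move=> /andP[x0 x1]; have [->//|nx] := eqVneq t0 x.
  have lt0x : t0 < x by rewrite lt_neqAle nx.
  rewrite ltW // ltr_sin ?in_itv /=; try (apply/andP; split); lra.
have dg x : t0 <= x <= pi -> is_derive x (1:R) g
    (- (cos ((N%:R + 2^-1) * x) * cos (x / 2)) / (2 * (2 * N%:R + 1) * sin (x / 2) ^+ 2)).
  move=> xb; have sx : 0 < sin (x / 2) by apply: lt_le_trans (sle x xb).
  have sx' : sin (2^-1 * x) != 0 by rewrite mulrC lt0r_neq0.
  pose h := sinS N + (cst (- (pi / 2)) + 2^-1 \*: id) +
     ((2 * N%:R + 1)^-1 \*: ((fun y => cos ((N%:R + 2^-1) * y)) * (fun y => (sin (2^-1 * y))^-1))).
  have -> : g = h.
    apply/funext => y; rewrite /g /h /= !fctE /= /GRing.scale /= invfM.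
    by move: (sin _)^-1 => u; field; rewrite lt0r_neq0.
  have dS := is_derive_sinS N x.
  have dI : is_derive x 1 (fun y => (sin (2^-1 * y))^-1) (- (sin (2^-1 * x)) ^- 2 *: (2^-1 * cos (2^-1 * x))).
    exact: is_deriveV.
  have dC := is_derive_cos_scale (N%:R + 2^-1) x.
  have dL := is_deriveD (is_derive_cst (- (pi / 2) : R) x 1) (is_deriveZ 2^-1 (is_derive_id x (1 : R))).
  apply: (is_derive_eq (is_deriveD (is_deriveD dS dL) (is_deriveZ (2 * N%:R + 1)^-1 (is_deriveM dC dI)))).
  have := dirichlet_kernel N x; move: (\sum_(1 <= n < _) _) => S eS.
  rewrite /GRing.scale /= add0r mulr1.
  have -> : S = (sin ((N%:R + 2^-1) * x) - sin (x / 2)) / (2 * sin (x / 2)).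
    by rewrite -eS; field; rewrite lt0r_neq0.
  rewrite [2^-1 * x]mulrC; move: (sin (x / 2)) sx => s sx.
  by field; rewrite !lt0r_neq0.
have gpi : g pi = 0.
  rewrite /g subrr mul0r subr0 /sinS big1 => [|n _]; last by rewrite sin_natpi mul0r.
  have -> : (N%:R + 2^-1) * pi = N%:R * pi + pi / 2 :> R by ring.
  by rewrite cosDpihalf sin_natpi oppr0 mul0r addr0.
have N1 : 0 < N.+1%:R :> R by rewrite ltr0n.
have gb : `|g pi - g t| <= (2 * (2 * N%:R + 1) * sin (t0 / 2) ^+ 2)^-1 * (pi - t).
  apply: (derivable_bound_le tpi) => [x /andP[x0 x1]|x /andP[x0 x1]].
    by apply: dg; rewrite (le_trans t0t).
  have xb : t0 <= x <= pi by rewrite (le_trans t0t).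
  rewrite normrM normrN normrM -[leRHS]mul1r; apply: ler_pM => //.
    by rewrite -[1]mulr1 ler_pM // cos_max.
  have sx := lt_le_trans s0 (sle x xb).
  rewrite gtr0_norm; last by rewrite invr_gt0 !mulr_gt0 ?exprn_gt0.
  rewrite lef_pV2 ?posrE ?mulr_gt0 ?exprn_gt0 //.
  by rewrite ler_pM2l ?mulr_gt0 // ler_pXn2r ?nnegrE ?(ltW s0) ?(ltW sx) // sle.
rewrite gpi sub0r normrN in gb.
have st := lt_le_trans s0 (sle t (introT andP (conj t0t tpi))).
have -> : sinS N t - (pi - t) / 2 = g t - cos ((N%:R + 2^-1) * t) / ((2 * N%:R + 1) * sin (t / 2)).
  by rewrite /g [2^-1 * t]mulrC addrK.
apply: (le_trans (ler_normB _ _)).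
have cb : `|cos ((N%:R + 2^-1) * t) / ((2 * N%:R + 1) * sin (t / 2))| <= ((2 * N%:R + 1) * sin (t0 / 2) ^+ 2)^-1.
  rewrite normrM -[leRHS]mul1r ler_pM ?cos_max //.
  rewrite gtr0_norm; last by rewrite invr_gt0 !mulr_gt0.
  rewrite lef_pV2 ?posrE ?mulr_gt0 ?exprn_gt0 //.
  rewrite ler_pM2l // (le_trans _ (sle t _)) ?t0t //.
  by rewrite expr2 -[leRHS]mul1r ler_pM2r // sin_le1.
apply: (le_trans (lerD gb cb)).
have k0 : 0 < (sin (t0 / 2) ^+ 2)^-1 by rewrite invr_gt0 exprn_gt0.
move: (sin (t0 / 2) ^+ 2) k0 => s2 k0; rewrite !invfM; move: s2^-1 k0 => k k0.
have i1 : (2 * N%:R + 1)^-1 <= N.+1%:R^-1 :> R.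
  rewrite lef_pV2 ?posrE // -natr1; have := ler0n R N; lra.
have i0 : 0 < (2 * N%:R + 1)^-1 :> R by rewrite invr_gt0.
apply: (@le_trans _ _ (((pi - t) / 2 + 1) * k * (2 * N%:R + 1)^-1)).
  rewrite le_eqVlt; apply/orP; left; apply/eqP.
  by move: (2 * N%:R + 1)^-1 => i; field.
apply: ler_pM => //; first by rewrite mulr_ge0 ?(ltW k0) //; lra.
by rewrite ler_pM2r //; lra.
Qed.

(** The derivative of the difference is, up to sign, the error in [sinS_lim_half]. The value at [pi]
    remains as a constant of integration. *)
Lemma cosS_lim_half (t0 t : R) N : 0 < t0 -> t0 <= t <= pi ->
  `|cosS N t - cosS N pi - (pi - t) ^+ 2 / 4| <= (pi + 2) / sin (t0 / 2) ^+ 2 * pi / N.+1%:R.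
Proof.
move=> t00 /andP[t0t tpi]; have p2 := pi_ge2 R.
set A := (pi + 2) / _.
pose d x := cosS N x - (pi - x) ^+ 2 / 4.
have dE x : d x = cosS N x - (pi - x) ^+ 2 / 4 by [].
have dd x : is_derive x (1:R) d (- sinS N x + (pi - x) / 2).
  have -> : d = cosS N - (4^-1 \*: (cst pi - id) ^+ 2).
    by apply/funext => y; rewrite /d !fctE /GRing.scale /= mulrC.
  have dL' := is_deriveX 2 (is_deriveB (is_derive_cst (pi : R) x 1) (is_derive_id x (1 : R))).
  apply: (is_derive_eq (is_deriveB (is_derive_cosS N x) (is_deriveZ 4^-1 dL'))).
  by rewrite /GRing.scale /= !fctE expr1; field.
have A0 : 0 <= A by rewrite divr_ge0 ?exprn_even_ge0 //; lra.
have : `|d pi - d t| <= A / N.+1%:R * (pi - t).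
  apply: (@derivable_bound_le d _ _ _ _ tpi (fun x _ => dd x)) => x /andP[x0 x1].
  have -> : - sinS N x + (pi - x) / 2 = - (sinS N x - (pi - x) / 2) by ring.
  by rewrite normrN; apply: sinS_lim_half; rewrite // (le_trans t0t x0).
rewrite !dE subrr expr0n mul0r subr0 distrC => h.
rewrite (_ : cosS N t - _ - _ = cosS N t - (pi - t) ^+ 2 / 4 - cosS N pi); last by ring.
apply: (le_trans h); rewrite mulrAC ler_wpM2r ?invr_ge0 ?ler0n // ler_wpM2l //; lra.
Qed.

Lemma cos_natpi_even m : cos (m.*2%:R * pi) = 1 :> R.
Proof.
elim: m => [|m IH]; first by rewrite mul0r cos0.
rewrite doubleS -addn2 natrD mulrDl cosD IH.
by rewrite (_ : 2 * pi = pi *+ 2) ?mulr_natl // cos2pi sin2pi mulr0 subr0 mulr1.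
Qed.

Definition zeta2S N : R := \sum_(1 <= n < N.+1) n%:R^-1 ^+ 2.

Lemma cosS_S N t : cosS N.+1 t = cosS N t + cos (N.+1%:R * t) / N.+1%:R ^+ 2.
Proof. by rewrite /cosS big_nat_recr. Qed.

Lemma zeta2S_S N : zeta2S N.+1 = zeta2S N + N.+1%:R^-1 ^+ 2.
Proof. by rewrite /zeta2S big_nat_recr. Qed.

Lemma cosS_double_pihalf M : cosS M.*2 (pi / 2) = cosS M pi / 4.
Proof.
elim: M => [|M IH]; first by rewrite /cosS !big_geq // mul0r.
rewrite doubleS !cosS_S IH.
have -> : cos (M.*2.+1%:R * (pi / 2)) = 0 :> R.
  rewrite (_ : M.*2.+1%:R * (pi / 2) = M%:R * pi + pi / 2).
    by rewrite cosDpihalf sin_natpi oppr0.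
  by rewrite -natr1 -muln2 natrM; field.
have -> : M.*2.+2%:R * (pi / 2) = M.+1%:R * pi :> R.
  by rewrite -doubleS -muln2 natrM; field.
rewrite mul0r addr0 mulrDl; congr (_ + _).
by rewrite -doubleS -muln2 natrM; field; rewrite nat1r pnatr_eq0.
Qed.

Lemma cosS_double_pi M : cosS M.*2 pi = zeta2S M / 2 - zeta2S M.*2.
Proof.
elim: M => [|M IH]; first by rewrite /cosS /zeta2S !big_geq // mul0r subr0.
rewrite doubleS !cosS_S IH !zeta2S_S.
have -> : cos (M.*2.+1%:R * pi) = -1 :> R.
  by rewrite -natr1 mulrDl mul1r cosDpi cos_natpi_even.
rewrite -doubleS cos_natpi_even -[M.+1.*2]muln2 natrM.
have m0 : M.+1%:R != 0 :> R by rewrite pnatr_eq0.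
have m1 : M.*2.+1%:R != 0 :> R by rewrite pnatr_eq0.
by move: (M.+1%:R : R) (M.*2.+1%:R : R) m0 m1 => a b a0 b0; field; rewrite a0 b0.
Qed.

Lemma zeta2S_diff M N : (M <= N)%N -> `|zeta2S N - zeta2S M| <= 2 / M.+1%:R.
Proof.
move=> MN; rewrite /zeta2S [in X in `|X - _|](big_cat_nat (n := M.+1)) //= addrAC subrr add0r.
rewrite ger0_norm ?sum_inv_sqr_tail //.
by apply: sumr_ge0 => i _; rewrite exprn_ge0 ?invr_ge0 ?ler0n.
Qed.

Lemma cosS_diff M N t : (M <= N)%N -> `|cosS N t - cosS M t| <= 2 / M.+1%:R.
Proof.
move=> MN; rewrite /cosS [in X in `|X - _|](big_cat_nat (n := M.+1)) //= addrAC subrr add0r.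
apply: le_trans (sum_inv_sqr_tail R M N); apply: (le_trans (ler_norm_sum _ _ _)).
apply: ler_sum => n _; rewrite normrM -[leRHS]mul1r ler_pM ?cos_max // exprVn.
by rewrite ger0_norm ?invr_ge0 ?exprn_ge0 ?ler0n.
Qed.

(** At [pi / 2] the odd terms vanish and the even ones form a quarter of the sum at [pi], of half
    the length. For the limit [l] at [pi], [cosS_lim_half] at [pi / 2] then reads
    [l / 4 - l = pi ^ 2 / 16], so the constant of integration evaluates itself. *)
Lemma cosS_pi_lim : exists K : R, forall N, `|cosS N pi + pi ^+ 2 / 12| <= K / N.+1%:R.
Proof.
have p2 := pi_ge2 R.
have h0 : 0 < pi / 2 :> R by lra.
have hb : pi / 2 <= pi :> R by lra.
set B := (pi + 2) / sin (pi / 2 / 2) ^+ 2 * pi : R.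
have B0 : 0 <= B by rewrite !mulr_ge0 ?invr_ge0 ?exprn_even_ge0 //; lra.
exists (2 * (B + 2)) => M.
have := @cosS_lim_half _ _ M.*2 h0 (introT andP (conj (lexx _) hb)); rewrite cosS_double_pihalf -/B => h1.
have h2 := @cosS_diff M M.*2 pi; rewrite -addnn leq_addl addnn in h2; have {}h2 := h2 isT.
have i1 : M.*2.+1%:R^-1 <= M.+1%:R^-1 :> R.
  by rewrite lef_pV2 ?posrE ?ltr0n // ler_nat ltnS -addnn leq_addl.
have {}h1 : `|cosS M pi / 4 - cosS M.*2 pi - (pi - pi / 2) ^+ 2 / 4| <= B / M.+1%:R.
  by apply: (le_trans h1); rewrite ler_wpM2l.
move: h1 h2; rewrite !ler_norml; move: (M.+1%:R^-1) => i /andP[a1 a2] /andP[b1 b2].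
have e : (pi - pi / 2) ^+ 2 / 4 = pi ^+ 2 / 16 :> R by field.
rewrite e in a1 a2; have -> : pi ^+ 2 / 12 = 4 / 3 * (pi ^+ 2 / 16) :> R by field.
move: (pi ^+ 2 / 16) a1 a2 => P a1 a2; apply/andP; split; lra.
Qed.

(** Splitting off the even terms shows that the alternating sum at [pi] tends to [- zeta(2) / 2]. *)
Lemma zeta2S_lim : exists K : R, forall N, `|zeta2S N - pi ^+ 2 / 6| <= K / N.+1%:R.
Proof.
have [K hK] := cosS_pi_lim; have K0 : 0 <= K.
  by have := hK 0; rewrite divr1; apply: le_trans.
exists (2 * (K + 2)) => M.
have h1 := hK M.*2; have h2 := @zeta2S_diff M M.*2.
rewrite -addnn leq_addl addnn in h2; have {}h2 := h2 isT.
rewrite cosS_double_pi in h1.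
have i1 : M.*2.+1%:R^-1 <= M.+1%:R^-1 :> R.
  by rewrite lef_pV2 ?posrE ?ltr0n // ler_nat ltnS -addnn leq_addl.
have {}h1 := le_trans h1 (ler_wpM2l K0 i1).
move: h1 h2; rewrite !ler_norml; move: (M.+1%:R^-1) => i /andP[a1 a2] /andP[b1 b2].
have -> : pi ^+ 2 / 6 = 2 * (pi ^+ 2 / 12) :> R by field.
move: (pi ^+ 2 / 12) a1 a2 => P a1 a2; apply/andP; split; lra.
Qed.

Lemma sin_reflect n t : sin (n%:R * (pi *+ 2 - t)) = - sin (n%:R * t).
Proof.
have -> : n%:R * (pi *+ 2 - t) = n.*2%:R * pi - n%:R * t by rewrite -muln2 natrM -[pi *+ 2]mulr_natr; ring.
by rewrite sinB sin_natpi cos_natpi_even; ring.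
Qed.

Lemma cos_reflect n t : cos (n%:R * (pi *+ 2 - t)) = cos (n%:R * t).
Proof.
have -> : n%:R * (pi *+ 2 - t) = n.*2%:R * pi - n%:R * t by rewrite -muln2 natrM -[pi *+ 2]mulr_natr; ring.
by rewrite cosB sin_natpi cos_natpi_even; ring.
Qed.

Lemma sinS_lim t : 0 < t < pi *+ 2 ->
  exists K : R, forall N, `|sinS N t - (pi - t) / 2| <= K / N.+1%:R.
Proof.
rewrite -[pi *+ 2]mulr_natr => /andP[t0 t2]; have [tpi|pit] := leP t pi.
  by exists ((pi + 2) / sin (t / 2) ^+ 2) => N; apply: sinS_lim_half; rewrite // lexx.
exists ((pi + 2) / sin ((pi *+ 2 - t) / 2) ^+ 2) => N.
have h := @sinS_lim_half (pi *+ 2 - t) (pi *+ 2 - t) N.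
rewrite -normrN.
have -> : - (sinS N t - (pi - t) / 2) = sinS N (pi *+ 2 - t) - (pi - (pi *+ 2 - t)) / 2.
  have -> : sinS N (pi *+ 2 - t) = - sinS N t.
    by rewrite /sinS -sumrN; apply: eq_bigr => n _; rewrite sin_reflect mulNr.
  by rewrite -[pi *+ 2]mulr_natr; lra.
by apply: h; rewrite ?lexx /= -[pi *+ 2]mulr_natr; lra.
Qed.

Lemma cosS_lim t : 0 < t < pi *+ 2 ->
  exists K : R, forall N, `|cosS N t - ((pi - t) ^+ 2 / 4 - pi ^+ 2 / 12)| <= K / N.+1%:R.
Proof.
have [K hK] := cosS_pi_lim.
have main s : 0 < s -> s <= pi -> exists K : R, forall N, `|cosS N s - ((pi - s) ^+ 2 / 4 - pi ^+ 2 / 12)| <= K / N.+1%:R.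
  move=> s0 s1; exists ((pi + 2) / sin (s / 2) ^+ 2 * pi + K) => N.
  have -> : cosS N s - ((pi - s) ^+ 2 / 4 - pi ^+ 2 / 12) =
    (cosS N s - cosS N pi - (pi - s) ^+ 2 / 4) + (cosS N pi + pi ^+ 2 / 12) by ring.
  rewrite (le_trans (ler_normD _ _)) // mulrDl lerD //.
  by apply: cosS_lim_half; rewrite // lexx.
rewrite -[pi *+ 2]mulr_natr => /andP[t0 t2]; have [tpi|pit] := leP t pi; first exact: main.
have [K' hK'] : exists K : R, forall N, `|cosS N (pi *+ 2 - t) - ((pi - (pi *+ 2 - t)) ^+ 2 / 4 - pi ^+ 2 / 12)| <= K / N.+1%:R.
  by apply: main; rewrite -[pi *+ 2]mulr_natr; lra.
exists K' => N; have := hK' N.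
have -> : cosS N (pi *+ 2 - t) = cosS N t by apply: eq_bigr => n _; rewrite cos_reflect.
by have -> : (pi - (pi *+ 2 - t)) ^+ 2 = (pi - t) ^+ 2 by rewrite -[pi *+ 2]mulr_natr; ring.
Qed.

End Trigonometry.

(** * Sawtooth sums *)

Local Open Scope complex_scope.

Section ComplexExponential.
Variable R : realType.

Lemma normc_real (x : R) : `|x%:C| = `|x|%:C :> R[i].
Proof. by rewrite normc_def /= expr0n addr0 sqrtr_sqr. Qed.

Definition expi (t : R) : R[i] := cos t +i* sin t.

Lemma expiD s t : expi (s + t) = expi s * expi t.
Proof. by rewrite /expi cosD sinD; apply/eqP; rewrite eq_complex /=; apply/andP; split; apply/eqP; ring. Qed.

Lemma expi0 : expi 0 = 1.
Proof. by rewrite /expi cos0 sin0. Qed.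

Lemma expiX t n : expi t ^+ n = expi (n%:R * t).
Proof.
elim: n => [|n IH]; first by rewrite mul0r expi0.
by rewrite exprS IH -expiD -nat1r mulrDl mul1r.
Qed.

Lemma expi_norm t : `|expi t| = 1.
Proof. by rewrite normc_def /= cos2Dsin2 sqrtr1. Qed.

Lemma expi_2pi : expi (2 * pi) = 1.
Proof. by rewrite /expi mulr_natl cos2pi sin2pi. Qed.

(** The distance from [expi t] to [1] depends on [cos t] only and equals [2 * sin (pi * s)]; the
    hypothesis covers the arguments [2 * pi * s] and [- 2 * pi * s] at once. *)
Lemma expi_far (t s : R) : 0 <= s <= 2^-1 -> cos t = cos (2 * (pi * s)) ->
  s%:C <= `|expi t - 1|.
Proof.
move=> /andP[s0 s1] ct; have p2 := pi_ge2 R.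
rewrite normc_def lecR /= subr0.
have -> : (cos t - 1) ^+ 2 + sin t ^+ 2 = 4 * sin (pi * s) ^+ 2.
  have := cos2Dsin2 t; rewrite ct; have := cos2Dsin2 (pi * s).
  rewrite mulr_natl cos_mulr2n -mulr_natr.
  move: (cos (pi * s)) (sin (pi * s)) (sin t) => c d e h1 h2.
  have -> : d ^+ 2 = 1 - c ^+ 2 by lra.
  have -> : e ^+ 2 = 1 - (c ^+ 2 * 2 - 1) ^+ 2 by lra.
  ring.
rewrite -[leLHS](ger0_norm s0) -sqrtr_sqr ler_sqrt; last by rewrite mulr_ge0 ?exprn_even_ge0.
have u0 : 0 <= pi * s by rewrite mulr_ge0 // pi_ge0.
have := @sin_ge_quarter R (pi * s); rewrite u0 /= => h.
have {h} : pi * s / 4 <= sin (pi * s) by apply: h; rewrite ler_wpM2l // pi_ge0.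
have : 2 * s <= pi * s by rewrite ler_wpM2r.
move: (pi * s) (sin _) u0 => u v u0 h1 h2; nra.
Qed.

Lemma expi_root_far m (h : 'I_m.+2) : h != 0 ->
  (minn h (m.+2 - h))%:R / m.+2%:R <= `|expi (2 * pi / m.+2%:R) ^+ h - 1|.
Proof.
set q := m.+2 => h0; have q0 : 0 < q%:R :> R by rewrite ltr0n.
have hq : (h <= q)%N by rewrite ltnW.
have -> : (minn h (q - h))%:R / q%:R = ((minn h (q - h))%:R / q%:R : R)%:C.
  by rewrite rmorphM /= fmorphV !rmorph_nat.
rewrite expiX; apply: expi_far.
  rewrite divr_ge0 ?ler0n //= ler_pdivrMr // mulrC ler_pdivlMr // -natrM ler_nat /minn.
  by case: ltnP; lia.
rewrite /minn; case: ltnP => _.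
  by congr cos; field; rewrite lt0r_neq0.
rewrite natrB // -[LHS]cosN -[LHS]cosD2pi -mulr_natr; congr cos.
by field; rewrite lt0r_neq0.
Qed.

Definition pow34 (x : R) : R := Num.sqrt x * Num.sqrt (Num.sqrt x).

Lemma pow34_ge0 x : 0 <= pow34 x.
Proof. by rewrite mulr_ge0 ?sqrtr_ge0. Qed.

Lemma pow34_X4 x : 0 <= x -> pow34 x ^+ 4 = x ^+ 3.
Proof.
move=> x0; rewrite /pow34 exprMn -{1}[4%N]/(2 * 2)%N exprM sqr_sqrtr //.
rewrite -[4%N]/(2 * 2)%N exprM !sqr_sqrtr ?sqrtr_ge0 //; ring.
Qed.

Lemma pow34_le x y : x <= y -> pow34 x <= pow34 y.
Proof. by move=> xy; rewrite ler_pM ?sqrtr_ge0 // ler_wsqrtr // ler_wsqrtr. Qed.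

Lemma pow34_ge1 x : 1 <= x -> 1 <= pow34 x.
Proof. by move=> /pow34_le; rewrite {1}/pow34 !sqrtr1 mulr1. Qed.

Lemma harm_complex N : harm R[i] N = (harm R N)%:C.
Proof. by rewrite /harm rmorph_sum; apply: eq_bigr => k _; rewrite fmorphV rmorph_nat. Qed.

(** The congruence says that [r t] represents [N / x + m0] modulo [q], for [x = x0 + p * t], without
    mentioning inverses. *)
Lemma saw_sum_bound q p x0 M N m0 (r : nat -> nat) : (0 < q)%N -> (0 < p)%N ->
  (forall t, (t < M)%N -> coprime (x0 + p * t) q ->
     (r t < q)%N /\ ((x0 + p * t) * r t = N + (x0 + p * t) * m0 %[mod q])%N) ->
  `|\sum_(t < M | coprime (x0 + p * t) q) ((r t)%:R - (q%:R - 1) / 2)| <=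
  4 * pow34 q%:R * (numdiv q)%:R ^+ 2 * harm R q * (gcdn N q)%:R * p%:R * (M%:R + 4 * q%:R * harm R q).
Proof.
case: q => // -[|m] _ p0 hr.
  (* The modulus [1] is apart because the Kloosterman sums live on ['I_m.+2]; here every term is
     zero. *)
  rewrite big1 ?normr0 => [|t ct].
    by rewrite !mulr_ge0 ?addr_ge0 ?mulr_ge0 ?pow34_ge0 ?exprn_ge0 ?harm_ge0 ?ler0n.
  have [] := hr t (ltn_ord t) ct.
  by rewrite ltnS leqn0 => /eqP -> _; rewrite subrr mul0r subrr.
set B := (X in _ <= X); set q := m.+2 in hr B *.
(* [K ^ 4] is [16 * numdiv q ^ 4 * q ^ 3], generous enough to avoid fourth roots of [2] and of the
   divisor function. *)
pose K := 2 * (numdiv q)%:R * pow34 q%:R.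
have K0 : 0 <= K by rewrite !mulr_ge0 ?pow34_ge0 ?ler0n.
have d1 : 1 <= (numdiv q)%:R :> R by rewrite ler1n numdiv_gt0.
have hK : 2 * (numdiv q)%:R ^+ 3 * q%:R ^+ 3 <= K%:C ^+ 4 :> R[i].
  have -> : 2 * (numdiv q)%:R ^+ 3 * q%:R ^+ 3 = (2 * (numdiv q)%:R ^+ 3 * q%:R ^+ 3 : R)%:C.
    by rewrite !(rmorphM, rmorphXn) /= !rmorph_nat.
  have -> : K%:C ^+ 4 = (K ^+ 4)%:C by rewrite rmorphXn.
  rewrite lecR /= /K exprMn pow34_X4 ?ler0n // [(2 * _) ^+ 4]exprMn ler_wpM2r ?exprn_ge0 ?ler0n //.
  apply: ler_pM; rewrite ?exprn_ge0 ?ler0n //; first by rewrite -natrX ler_nat.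
  by rewrite [leRHS]exprSr ler_peMr ?exprn_ge0 ?ler0n.
have z_unity : expi (2 * pi / q%:R) ^+ q = 1.
  by rewrite expiX mulrC divfK ?expi_2pi // pnatr_eq0.
have := @kl_saw R[i] m _ (expi_norm _) z_unity (@expi_root_far m) p x0 M N%:R m0%:R K%:C p0.
rewrite lecR => /(_ K0 hK).
have -> : \sum_(t < M | ((x0 + p * t)%N%:R : 'I_q) \is a GRing.unit)
      saw R[i] (m0%:R : 'I_q) (N%:R * ((x0 + p * t)%N%:R : 'I_q)^-1)
   = (\sum_(t < M | coprime (x0 + p * t) q) ((r t)%:R - (q%:R - 1) / 2))%:C.
  rewrite rmorph_sum; apply: eq_big => [t|t ut].
    by rewrite [RHS]coprime_sym; exact: (@unitZpE q).
  have ct : coprime (x0 + p * t) q by rewrite coprime_sym -(@unitZpE q (x0 + p * t) isT).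
  have [lt er] := hr t (ltn_ord t) ct.
  rewrite /saw.
  have -> : (N%:R * ((x0 + p * t)%N%:R : 'I_q)^-1 + m0%:R)%R = (r t)%:R :> 'I_q.
    apply: (mulrI ut); rewrite mulrDr mulrCA mulrV // mulr1 -!natrM -natrD.
    by apply/val_inj; rewrite !Zp_nat /= er.
  rewrite Zp_nat /= modn_small // rmorphB /= rmorphM /= rmorphB /= fmorphV !rmorph_nat.
  by rewrite rmorph1.
rewrite normc_real annE Zp_nat /= gcdn_modl !harm_complex.
set X := (X in _ <= X); have -> : X = B%:C; last by rewrite lecR.
have qC : (q%:R : R[i]) = (q%:R : R)%:C by rewrite rmorph_nat.
rewrite /X /B /K qC; move: (pow34 _) => P; move: (q%:R : R) (harm R q) => qr h.
rewrite !(rmorphM, rmorphD, rmorphXn) /= !rmorph_nat.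
ring.
Qed.

End ComplexExponential.

(** * Residue classes and initial intervals *)

Lemma sum_class (p x0 X : nat) : (0 < x0 <= p)%N ->
  exists2 M, (M <= X)%N & forall (V : nmodType) (P : pred nat) (F : nat -> V),
    \sum_(1 <= x < X.+1 | (x == x0 %[mod p])%N && P x) F x =
    \sum_(t < M | P (x0 + p * t)%N) F (x0 + p * t)%N.
Proof.
move=> /andP[x00 x0p].
(* For the induction [M] is pinned down: the last term of the progression is at most [X] and the
   next one exceeds it. *)
suff [M [MX lo hi] h] : exists2 M, [/\ (M <= X)%N, (M = 0)%N \/ (x0 + p * M.-1 <= X)%N & (X < x0 + p * M)%N] &
   forall (V : nmodType) (P : pred nat) (F : nat -> V),
    \sum_(1 <= x < X.+1 | (x == x0 %[mod p])%N && P x) F x =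
    \sum_(t < M | P (x0 + p * t)%N) F (x0 + p * t)%N by exists M.
elim: X => [|X [M [MX lo hi] IH]].
  by exists 0%N => [|V P F]; [split; rewrite ?muln0 ?addn0 //; left | rewrite big_geq // big_ord0].
have [/eqP e|ne] := boolP (X.+1 == x0 %[mod p])%N.
  have eX : X.+1 = (x0 + p * M)%N.
    case/eqmod_exP: e => k [l e].
    have p0 : (0 < p)%N by exact: leq_trans x0p.
    case: lo => [M0|lo].
      subst M; rewrite muln0 addn0 in hi *; have : (l <= k)%N by rewrite leqNgt; apply/negP => kl; have := leq_mul kl (leqnn p); move: p0 hi e; clear; nia.
      have : (k <= l)%N; last first.
        move=> h1 h2; have ekl : k = l by apply/eqP; rewrite eqn_leq h1 h2.
        by move: e; rewrite ekl => /addIn.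
      rewrite leqNgt; apply/negP => lk; have := leq_mul lk (leqnn p); move: x0p e; clear; nia.
    case: M MX hi {IH} lo => [|M] MX hi lo; first by move: hi lo; rewrite muln0; lia.
    rewrite /= in lo.
    have h1 : (k + M < l)%N.
      rewrite ltnNge; apply/negP => h; have := leq_mul h (leqnn p); move: lo e; clear; nia.
    have h2 : (l <= k + M.+1)%N.
      rewrite leqNgt; apply/negP => h; have := leq_mul h (leqnn p); move: p0 hi e; clear; nia.
    have el : l = (k + M.+1)%N by lia.
    by move: e; rewrite el; clear; nia.
  exists M.+1 => [|V P F].
    split=> //; first by right; rewrite /= eX.
    by move: x00 x0p; rewrite eX mulnS; clear; lia.
  rewrite big_mkcond big_nat_recr //= -big_mkcond /= IH e eqxx /=.
  by rewrite [RHS]big_mkcond big_ord_recr /= -big_mkcond /= -eX.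
exists M => [|V P F].
  split; [exact: leqW | by case: lo => [->|lo]; [left | right; exact: leqW] |].
  rewrite ltn_neqAle hi andbT; apply: contraNneq ne => ->.
  by apply/eqP/eqmod_exP; exists 0%N, M; rewrite mul0n addn0 mulnC.
by rewrite big_mkcond big_nat_recr //= -big_mkcond /= IH (negPf ne) /= addr0.
Qed.

(** The maximality of [X'] matters in [Asum_tri], where the size of the cut enters the error. *)
Lemma sum_initial (P : pred nat) X : (forall x y, (x <= y)%N -> P y -> P x) ->
  exists2 X', (X' <= X)%N /\ ((forall x, (0 < x <= X')%N -> P x) /\ (X' = X \/ ~~ P X'.+1)) & forall (V : nmodType) (Q : pred nat) (F : nat -> V),
    \sum_(1 <= x < X.+1 | Q x && P x) F x = \sum_(1 <= x < X'.+1 | Q x) F x.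
Proof.
move=> Pd; elim: X => [|X [X' [XX [PX' nP]] IH]].
  by exists 0%N => [|V Q F]; [split=> //; split=> [-[]|] //; left | rewrite !big_geq].
have [PX|nPX] := boolP (P X.+1).
  exists X.+1 => [|V Q F]; first by split=> //; split=> [x /andP[_ xX]|]; [exact: Pd PX | left].
  rewrite big_nat_cond [RHS]big_nat_cond; apply: eq_bigl => x.
  case: (boolP (0 < x < X.+2)%N) => //= /andP[_ xX]; rewrite (Pd x X.+1) ?andbT //.
exists X' => [|V Q F]; first by split; [exact: leqW | split=> //; right; case: nP => [->|]].
by rewrite big_mkcond big_nat_recr //= -big_mkcond /= IH (negPf nPX) andbF addr0.
Qed.

Section LineEnds.
Variables (R : realType) (p Q D : nat).
Hypothesis p_prime : prime p.
Hypothesis Q_gt0 : (0 < Q)%N.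
Hypothesis D_max : forall k, (0 < k <= p * Q)%N -> (numdiv k <= D)%N.

Let H := harm R (p * Q).
(** [21 = 4 * 5 + 1]: [4] from [saw_sum_bound], [5] from absorbing [M + 4 * q * harm q] into one
    product, [1] from the shift [c] in [line_end_bound]. *)
Definition end_const : R := 21 * p%:R ^+ 2 * pow34 (p * Q)%:R * D%:R ^+ 2 * H ^+ 2 * Q%:R.

Let p0 : (0 < p)%N. Proof. exact: prime_gt0. Qed.
Let pQ0 : (0 < p * Q)%N. Proof. by rewrite muln_gt0 p0. Qed.
Let H1 : 1 <= H. Proof. exact: harm_ge1. Qed.
Let D1 : 1 <= D%:R :> R.
Proof. by rewrite ler1n (leq_trans _ (D_max (k := 1) _)) ?numdiv_gt0. Qed.

(** The modulus [q] will be [y] or [y * p]. The bound is expressed through [gcdn n y / y], whose sum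
    over [y] is only [numdiv n] times a harmonic sum. *)
Lemma saw_sum_bound' q y n x0 M N m0 (r : nat -> nat) :
  (0 < y <= q)%N -> (q <= p * Q)%N -> (y <= Q)%N -> (M <= Q)%N ->
  (gcdn N q <= p * gcdn n y)%N ->
  (forall t, (t < M)%N -> coprime (x0 + p * t) q ->
     (r t < q)%N /\ ((x0 + p * t) * r t = N + (x0 + p * t) * m0 %[mod q])%N) ->
  `|\sum_(t < M | coprime (x0 + p * t) q) ((r t)%:R - (q%:R - 1) / 2)| / q%:R <=
  20 * p%:R ^+ 2 * pow34 (p * Q)%:R * D%:R ^+ 2 * H ^+ 2 * Q%:R * ((gcdn n y)%:R / y%:R).
Proof.
move=> /andP[y0 yq] qQ yQ MQ hg hr.
have q0 : (0 < q)%N by exact: leq_trans yq.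
have qR : 0 < q%:R :> R by rewrite ltr0n.
have yR : 0 < y%:R :> R by rewrite ltr0n.
have Hq : harm R q <= H by exact: harm_le.
have Hq0 : 0 <= harm R q by exact: harm_ge0.
rewrite ler_pdivrMr //; apply: (le_trans (saw_sum_bound R q0 p0 hr)).
have b1 : pow34 (q%:R : R) <= pow34 (p * Q)%:R by apply: pow34_le; rewrite ler_nat.
have b2 : (numdiv q)%:R ^+ 2 <= D%:R ^+ 2 :> R.
  by rewrite ler_pXn2r ?nnegrE ?ler0n // ler_nat D_max // q0.
have b3 : (gcdn N q)%:R <= p%:R * (gcdn n y)%:R :> R by rewrite -natrM ler_nat.
have b4 : M%:R + 4 * q%:R * harm R q <= 5 * H * (Q%:R / y%:R * q%:R).
  have Qy : 1 <= Q%:R / y%:R :> R by rewrite ler_pdivlMr // mul1r ler_nat.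
  have e1 : M%:R <= H * (Q%:R / y%:R * q%:R).
    apply: (@le_trans _ _ (1 * Q%:R)); first by rewrite mul1r ler_nat.
    apply: ler_pM; rewrite ?ler0n //.
    by rewrite mulrAC ler_pdivlMr // ler_wpM2l ?ler0n // ler_nat.
  have e2 : q%:R * harm R q <= H * (Q%:R / y%:R * q%:R).
    rewrite mulrC; apply: ler_pM => //.
    by rewrite ler_peMl // ltW.
  by rewrite -mulrA; lra.
apply: (@le_trans _ _ (4 * pow34 (p * Q)%:R * D%:R ^+ 2 * H * (p%:R * (gcdn n y)%:R) * p%:R * (5 * H * (Q%:R / y%:R * q%:R)))).
  repeat (apply: ler_pM; rewrite ?mulr_ge0 ?addr_ge0 ?mulr_ge0 ?pow34_ge0 ?exprn_ge0 ?ler0n //).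
rewrite le_eqVlt; apply/orP; left; apply/eqP.
by move: (y%:R^-1 : R) => iy; ring.
Qed.

(** For fixed [y] the end [ru x] is determined by the inverse of [x] modulo [y] or [y * p], so its
    deviation from the mean is a sawtooth sum over a progression. *)
Lemma line_end_bound n y U u0 v0 x0 X (ru : nat -> nat) :
  (0 < y <= Q)%N -> (X <= Q)%N -> (0 < x0 <= p)%N ->
  (forall x, (0 < x <= X)%N -> x = x0 %[mod p] -> coprime x y ->
     [/\ (0 < ru x <= y * p)%N, (U + ru x = u0 %[mod p])%N &
         (x * (U + ru x) + y * v0 = n %[mod y * p])%N]) ->
  `|\sum_(1 <= x < X.+1 | (x == x0 %[mod p])%N && coprime x y)
      ((ru x)%:R / (y%:R * p%:R) - 2^-1)| <= end_const * ((gcdn n y)%:R / y%:R).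
Proof.
move=> /andP[y0 yQ] XQ x0b hru; have [M MX eM] := sum_class X x0b.
have MQ : (M <= Q)%N by exact: leq_trans XQ.
rewrite eM.
have hru' t : (t < M)%N -> coprime (x0 + p * t) y ->
     [/\ (0 < ru (x0 + p * t) <= y * p)%N, (U + ru (x0 + p * t) = u0 %[mod p])%N &
         ((x0 + p * t) * (U + ru (x0 + p * t)) + y * v0 = n %[mod y * p])%N].
  move=> tM ct; apply: hru => //.
    have /andP[x00 _] := x0b; rewrite addn_gt0 x00 /=.
    have := eM nat (pred1 (x0 + p * t)%N) (fun=> 1%N); rewrite /=.
    rewrite (bigD1 (Ordinal tM)) //= leqNgt => e; apply/negP => lt; move: e.
    rewrite big_nat_cond big1 // => x /andP[/andP[_ xX] /andP[_ /eqP ex]].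
    by move: xX lt; rewrite ex ltnS leqNgt => /negP.
  by apply/eqmod_exP; exists 0%N, t; rewrite mul0n addn0 mulnC.
have yR : 0 < y%:R :> R by rewrite ltr0n.
have pR : 0 < p%:R :> R by rewrite ltr0n.
(* Common form of both cases: up to a constant [c] of size at most [1 / y], the normalised end is a
   centred residue [r t] divided by [q]. *)
suff [q [r [c [yqp cq [hc hb] he]]]] : exists (q : nat) (r : nat -> nat) (c : R), [/\ (0 < y <= q)%N /\ (q <= p * Q)%N,
     (forall t, coprime (x0 + p * t) q = coprime (x0 + p * t) y),
     `|c| <= y%:R^-1 /\
     `|\sum_(t < M | coprime (x0 + p * t) q) ((r t)%:R - (q%:R - 1) / 2)| / q%:R <=
        20 * p%:R ^+ 2 * pow34 (p * Q)%:R * D%:R ^+ 2 * H ^+ 2 * Q%:R * ((gcdn n y)%:R / y%:R) &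
     forall t, (t < M)%N -> coprime (x0 + p * t) y ->
       (ru (x0 + p * t)%N)%:R / (y%:R * p%:R) - 2^-1 = ((r t)%:R - (q%:R - 1) / 2) / q%:R + c].
  rewrite (eq_bigr (fun t : 'I_M => ((r t)%:R - (q%:R - 1) / 2) / q%:R + c)); last first.
    by move=> t ct; exact: he.
  rewrite big_split /= -mulr_suml.
  rewrite (eq_bigl (fun t : 'I_M => coprime (x0 + p * t) y)) in hb; last by move=> t; exact: cq.
  apply: (le_trans (ler_normD _ _)); rewrite normrM [`|q%:R^-1|]ger0_norm ?invr_ge0 ?ler0n //.
  apply: (@le_trans _ _ (20 * p%:R ^+ 2 * pow34 (p * Q)%:R * D%:R ^+ 2 * H ^+ 2 * Q%:R * ((gcdn n y)%:R / y%:R)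
     + Q%:R / y%:R)).
    apply: lerD => //.
    apply: (@le_trans _ _ (\sum_(t < M) y%:R^-1)).
      apply: (le_trans (ler_norm_sum _ _ _)); rewrite big_mkcond /=; apply: ler_sum => t _.
      by case: ifP => _ //; rewrite invr_ge0 ler0n.
    by rewrite sumr_const card_ord -[leLHS]mulr_natl ler_wpM2r ?invr_ge0 ?ler0n // ler_nat.
  have g1 : 1 <= (gcdn n y)%:R :> R by rewrite ler1n gcdn_gt0 y0 orbT.
  have P1 : 1 <= p%:R ^+ 2 * pow34 (p * Q)%:R * D%:R ^+ 2 * H ^+ 2 :> R.
    have D0 : (0 < D)%N by rewrite -(ler1n R).
    have h34 : 1 <= pow34 (p * Q)%:R :> R by apply: pow34_ge1; rewrite ler1n.
    by do 3 (apply: mulr_ege1 => //); rewrite ?exprn_ege1 ?ler1n.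
  set c1 := p%:R ^+ 2 * _ * _ * _ in P1.
  have Qy : 0 <= Q%:R / y%:R :> R by rewrite divr_ge0 ?ler0n.
  have h1 : Q%:R / y%:R <= c1 * (gcdn n y)%:R * (Q%:R / y%:R) by rewrite ler_peMl // mulr_ege1.
  have -> : end_const * ((gcdn n y)%:R / y%:R) = 21 * (c1 * (gcdn n y)%:R * (Q%:R / y%:R)).
    by rewrite /end_const /c1; move: (y%:R^-1 : R) => iy; ring.
  have -> : 20 * p%:R ^+ 2 * pow34 (p * Q)%:R * D%:R ^+ 2 * H ^+ 2 * Q%:R * ((gcdn n y)%:R / y%:R)
    = 20 * (c1 * (gcdn n y)%:R * (Q%:R / y%:R)).
    by rewrite /c1; move: (y%:R^-1 : R) => iy; ring.
  by lra.
have [y1 ey] : exists y1, y = y1.+1 by exists y.-1; rewrite prednK.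
(* If [p] does not divide [y], the class modulo [p] splits off as [ru = r0 + p * r], and [r] is a
   residue modulo [y]. If it does, [x] is already invertible modulo [y * p], and [ru - 1] is the
   residue. *)
have [py|npy] := boolP (p %| y)%N; last first.
  have cpy : coprime p y by rewrite prime_coprime.
  have [p' ep'] := modn_inv_ex cpy.
  have cp' : coprime p' y.
    have : coprime (p * p') y by rewrite -coprime_modl ep' coprime_modl coprime1n.
    by rewrite coprimeMl => /andP[].
  have [r0 [/andP[r00 r0p] er0]] := residue_window U u0 p0.
  pose r t := ((ru (x0 + p * t) - r0) %/ p)%N.
  have rE t : (t < M)%N -> coprime (x0 + p * t) y ->
      ru (x0 + p * t)%N = (r0 + p * r t)%N /\ (r t < y)%N.
    move=> tM ct; have [/andP[h1 h2] h3 h4] := hru' t tM ct.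
    have : ru (x0 + p * t)%N = r0 %[mod p].
      by apply/eqP; rewrite -(eqn_modDl U) h3 er0.
    move/eqmod_exP => [k [l e]].
    have kl : (k <= l)%N.
      rewrite leqNgt; apply/negP => lk; have := leq_mul lk (leqnn p); move: e h1 r0p; clear; nia.
    have e1 : ru (x0 + p * t)%N = (r0 + p * (l - k))%N.
      by rewrite mulnBr; have := leq_mul (leqnn p) kl; move: e; clear; lia.
    have er : r t = (l - k)%N by rewrite /r e1 addKn mulKn.
    rewrite er; split => //; rewrite -(ltn_pmul2l p0); move: h2 r00; rewrite e1 [(y * p)%N]mulnC; clear; lia.
  exists y, r, (r0%:R / (y%:R * p%:R) - (2 * y%:R)^-1); split=> //.
  - by rewrite y0 leqnn; split=> //; rewrite (leq_trans yQ) // leq_pmull.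
  - split.
      have h0 : 0 <= r0%:R / (y%:R * p%:R) :> R by rewrite divr_ge0 ?mulr_ge0 ?ler0n.
      have h1 : r0%:R / (y%:R * p%:R) <= y%:R^-1 :> R.
        rewrite ler_pdivrMr ?mulr_gt0 // mulrA mulVf ?lt0r_neq0 // mul1r ler_nat //.
      have h2 : 0 < y%:R^-1 :> R by rewrite invr_gt0.
      by rewrite invfM ler_norml; apply/andP; split; lra.
    (* Dividing [x * (U + r0 + p * r) = n] by [p] modulo [y] gives
       [x * r = p' * n - x * p' * (U + r0)], with [y1] for [-1]. *)
    apply: (@saw_sum_bound' y y n x0 M (p' * n)%N (p' * (U + r0) * y1)%N) => //.
    + by rewrite y0 leqnn.
    + by rewrite (leq_trans yQ) // leq_pmull.
    + by rewrite gcdnC Gauss_gcdr 1?coprime_sym // gcdnC leq_pmull.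
    move=> t tM ct; have [e1 lt] := rE t tM ct; split=> //.
    have [_ _ /eqmod_exP[a [b e2]]] := hru' t tM ct.
    have /eqmod_exP[c [d e3]] := ep'.
    move: e2; rewrite e1; move: (x0 + p * t)%N (r t) => x s e2.
    apply/eqmod_exP; exists (d * x * s + p' * x * (U + r0) + p' * v0 + p' * a * p)%N, (p' * b * p + c * x * s)%N.
    have e4 := congr1 (muln p') e2; have e5 := congr1 (muln (x * s)) e3.
    by move: e4 e5; rewrite ey; clear; lia.
  move=> t tM ct; have [-> _] := rE t tM ct; rewrite natrD natrM.
  by field; rewrite !lt0r_neq0.
pose q := (y * p)%N.
have q0 : (0 < q)%N by rewrite muln_gt0 y0.
have [q1 eq] : exists q1, q = q1.+1 by exists q.-1; rewrite prednK.
have qR : 0 < q%:R :> R by rewrite ltr0n.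
have cq x : coprime x q = coprime x y.
  rewrite /q coprimeMr; case: (boolP (coprime x y)) => //= cxy.
  exact: coprime_dvdr py cxy.
exists q, (fun t => (ru (x0 + p * t)%N).-1), ((2 * q%:R)^-1); split=> //.
- by rewrite y0 /q leq_pmulr //; split=> //; rewrite mulnC leq_mul2l yQ orbT.
- split.
    rewrite ger0_norm ?invr_ge0 ?mulr_ge0 ?ler0n // lef_pV2 ?posrE ?mulr_gt0 //.
    by rewrite -natrM ler_nat /q mulnCA leq_pmulr // muln_gt0 p0.
  (* With [q1] for [-1] the parameters are [n - y * v0] and [-(U + 1)]. Passing from [q] to [y] in
     the gcd costs a factor [p], and modulo [y] the term [y * v0] drops out. *)
  apply: (@saw_sum_bound' q y n x0 M (n + y * v0 * q1)%N ((U + 1) * q1)%N (fun t => (ru (x0 + p * t)%N).-1)) => //.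
  + by rewrite y0 /q leq_pmulr.
  + by rewrite /q mulnC leq_mul2l yQ orbT.
  + apply: (@leq_trans (p * gcdn (n + y * v0 * q1) y)).
      apply: dvdn_leq; first by rewrite muln_gt0 p0 gcdn_gt0 y0 orbT.
      by rewrite muln_gcdr dvdn_gcd dvdn_mull ?dvdn_gcdl //= [(p * y)%N]mulnC dvdn_gcdr.
    by rewrite leq_mul2l addnC -mulnA mulnC gcdnC gcdnMDl gcdnC leqnn orbT.
  move=> t tM; rewrite cq => ct; have [/andP[h1 h2] h3 /eqmod_exP[a [b e2]]] := hru' t tM ct.
  split; first by rewrite prednK.
  move: e2 h1; move: (x0 + p * t)%N (ru _) => x s; case: s => // s e2 _ /=.
  apply/eqmod_exP; exists (x * (U + 1) + y * v0 + a)%N, b.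
  by move: e2; rewrite -/q eq; clear; lia.
move=> t tM ct; have [/andP[h1 h2] h3 _] := hru' t tM ct.
rewrite -natrM -/q; case: (ru _) h1 => // s _ /=; rewrite -natr1.
by field; rewrite lt0r_neq0.
Qed.

Definition region n U V X1 X2 x y :=
  [&& (x <= X1)%N, (y <= X2)%N, coprime x y & (x * U + y * V < n)%N].

Lemma sum_line_ends n U V X1 X2 x0 y0 u0 v0 B (rr : nat -> nat -> nat) :
  (0 < n)%N -> (X1 <= Q)%N -> (X2 <= Q)%N -> (0 < x0 <= p)%N ->
  (forall x y, (0 < x)%N -> (0 < y)%N -> x = x0 %[mod p] -> y = y0 %[mod p] ->
     region n U V X1 X2 x y ->
     [/\ (0 < rr x y <= y * p)%N, (U + rr x y = u0 %[mod p])%N &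
         (x * (U + rr x y) + y * v0 = n %[mod y * p])%N]) ->
  `|\sum_(1 <= y < B.+1) \sum_(1 <= x < B.+1 |
       [&& (x == x0 %[mod p])%N, (y == y0 %[mod p])%N & region n U V X1 X2 x y])
      ((rr x y)%:R / (y%:R * p%:R) - 2^-1)| <= end_const * ((numdiv n)%:R * H).
Proof.
move=> n0 X1Q X2Q x0b hr.
have e0 : 0 <= end_const.
  by rewrite /end_const !mulr_ge0 ?exprn_ge0 ?pow34_ge0 ?harm_ge0 ?ler0n.
apply: (@le_trans _ _ (end_const * \sum_(1 <= y < Q.+1) (gcdn y n)%:R / y%:R)); last first.
  apply: ler_wpM2l => //; apply: (le_trans (sum_gcdn_div _ _ n0)).
  by rewrite ler_wpM2l ?ler0n // harm_le // leq_pmull.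
apply: (le_trans (ler_norm_sum _ _ _)); rewrite mulr_sumr.
pose G y : R := end_const * ((gcdn y n)%:R / y%:R).
have G0 y : 0 <= G y by rewrite mulr_ge0 // divr_ge0 ?ler0n.
apply: (@le_trans _ _ (\sum_(1 <= y < B.+1 | (y <= Q)%N) G y)); last first.
  have [BQ|QB] := leqP B Q.
    rewrite [leRHS](big_cat_nat (n := B.+1)) //= -[leLHS]addr0; apply: lerD; last by apply: sumr_ge0 => y _; exact: G0.
    by rewrite [leLHS]big_mkcond /=; apply: ler_sum => y _; case: ifP => // _; exact: G0.
  by rewrite [leRHS](big_nat_widen _ _ B.+1) // ltnW.
rewrite [leRHS]big_mkcond [leLHS]big_nat_cond [leRHS]big_nat_cond; apply: ler_sum => y; rewrite andbT => /andP[y0' _].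
have [yQ|yQ] := leqP y X2; last first.
  rewrite big1 ?normr0; first by case: ifP.
  by move=> x /and3P[_ _ /and4P[_]]; rewrite leqNgt yQ.
rewrite (leq_trans yQ X2Q).
have [/eqP ey|ney] := boolP (y == y0 %[mod p])%N; last first.
  rewrite big1 ?normr0; first exact: G0.
  by move=> x /and3P[].
(* For fixed [y] the region is an initial interval in [x], apart from coprimality, which is the
   restriction to units. *)
pose P x := (x <= X1)%N && (x * U + y * V < n)%N.
have Pd x x' : (x <= x')%N -> P x' -> P x.
  move=> xx /andP[h1 h2]; rewrite /P (leq_trans xx h1) /=.
  by apply: leq_ltn_trans h2; rewrite leq_add2r leq_mul2r xx orbT.
have [X' [XB [PX' _]] eX'] := sum_initial B Pd.
have X'Q : (X' <= Q)%N.
  have [->//|X'0] := posnP X'; have /andP[h _] : P X' by apply: PX'; rewrite X'0 /=.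
  exact: leq_trans X1Q.
rewrite (eq_bigl (fun x => ((x == x0 %[mod p])%N && coprime x y) && P x)); last first.
  by move=> x; rewrite /region yQ /P /= -!andbA; congr (_ && _); rewrite andbCA.
rewrite eX' /G gcdnC; apply: (@line_end_bound n y U u0 v0) => //.
  by rewrite y0' (leq_trans yQ).
move=> x /andP[x0' xX'] ex cxy; apply: hr => //.
have /andP[h1 h2] : P x by apply: PX'; rewrite x0'.
by rewrite /region h1 yQ cxy.
Qed.

(** The modulus of the end [ru] depends on [y] only and that of [rv] on [x] only, so the two
    sawtooth sums are taken in opposite orders of summation. *)
Lemma core_bound n U V X1 X2 x0 y0 u0 v0 B : (n <= B)%N ->
  (0 < n)%N -> (X1 <= Q)%N -> (X2 <= Q)%N -> (0 < x0 <= p)%N -> (0 < y0 <= p)%N ->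
  (x0 * u0 + y0 * v0 = n %[mod p])%N ->
  `|\sum_(1 <= x < B.+1) \sum_(1 <= y < B.+1 |
       [&& (x == x0 %[mod p])%N, (y == y0 %[mod p])%N & region n U V X1 X2 x y])
      ((line_num p n U V u0 v0 B x y)%:R -
       (n%:R - x%:R * U%:R - y%:R * V%:R) / (x%:R * y%:R * p%:R))|
  <= 2 * end_const * ((numdiv n)%:R * H).
Proof.
move=> nB n0 X1Q X2Q x0b y0b cons.
pose spec (xy : nat * nat) (r : nat * nat) :=
  let: (x, y) := xy in
  (0 < x)%N -> (0 < y)%N -> x = x0 %[mod p] -> y = y0 %[mod p] -> region n U V X1 X2 x y ->
  [/\ (0 < r.1 <= y * p)%N /\ (0 < r.2 <= x * p)%N,
      (U + r.1 = u0 %[mod p])%N /\ (x * (U + r.1) + y * v0 = n %[mod y * p])%N,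
      (V + r.2 = v0 %[mod p])%N /\ (y * (V + r.2) + x * u0 = n %[mod x * p])%N &
      ((line_num p n U V u0 v0 B x y)%:R
       = (n%:R - x%:R * U%:R - y%:R * V%:R) / (x%:R * y%:R * p%:R)
         - (r.1%:R / (y%:R * p%:R) - 2^-1) - (r.2%:R / (x%:R * p%:R) - 2^-1) :> R)].
have /choice[r hr] : forall xy, exists r, spec xy r.
  move=> [x y]; have [[x0' y0' ex ey rg]|] := pselect [/\ (0 < x)%N, (0 < y)%N, x = x0 %[mod p], y = y0 %[mod p] & region n U V X1 X2 x y]; last first.
    by move=> h; exists (0%N, 0%N) => ? ? ? ? ?; case: h.
  have /and4P[_ _ cxy lt] := rg.
  have cons' : (x * u0 + y * v0 = n %[mod p])%N.
    by rewrite -cons -modnDm -modnMml ex modnMml -[in X in (_ + X)%N]modnMml ey modnMml modnDm.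
  have [ru [rv [h1 h2 h3 h4]]] := line_count R nB p0 x0' y0' cxy cons' lt.
  by exists (ru, rv) => _ _ _ _ _.
pose r1 x y := (r (x, y)).1; pose r2 x y := (r (x, y)).2.
pose C x y := [&& (x == x0 %[mod p])%N, (y == y0 %[mod p])%N & region n U V X1 X2 x y].
have -> : \sum_(1 <= x < B.+1) \sum_(1 <= y < B.+1 | C x y)
      ((line_num p n U V u0 v0 B x y)%:R -
       (n%:R - x%:R * U%:R - y%:R * V%:R) / (x%:R * y%:R * p%:R)) =
  - (\sum_(1 <= y < B.+1) \sum_(1 <= x < B.+1 | C x y) ((r1 x y)%:R / (y%:R * p%:R) - 2^-1))
  - \sum_(1 <= x < B.+1) \sum_(1 <= y < B.+1 | C x y) ((r2 x y)%:R / (x%:R * p%:R) - 2^-1) :> R.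
  have -> : \sum_(1 <= y < B.+1) \sum_(1 <= x < B.+1 | C x y) ((r1 x y)%:R / (y%:R * p%:R) - 2^-1)
     = \sum_(1 <= x < B.+1) \sum_(1 <= y < B.+1 | C x y) ((r1 x y)%:R / (y%:R * p%:R) - 2^-1) :> R.
    under eq_bigr => y _ do rewrite big_mkcond /=.
    rewrite exchange_big /=; apply: eq_bigr => x _.
    by rewrite [RHS]big_mkcond.
  rewrite -opprD -big_split /= -sumrN big_nat_cond [RHS]big_nat_cond.
  apply: eq_bigr => x; rewrite andbT => /andP[x0' _].
  rewrite -big_split /= -sumrN big_nat_cond [RHS]big_nat_cond.
  apply: eq_bigr => y /andP[/andP[y0' _] /and3P[/eqP ex /eqP ey rg]].
  have [_ _ _ ->] := hr (x, y) x0' y0' ex ey rg.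
  by rewrite /r1 /r2; ring.
apply: (le_trans (ler_normB _ _)); rewrite normrN -mulrA mulr_natl mulr2n; apply: lerD.
  apply: (@sum_line_ends n U V X1 X2 x0 y0 u0 v0 B r1) => // x y x0' y0' ex ey rg.
  by have [[h1 _] [h2 h3] _ _] := hr (x, y) x0' y0' ex ey rg.
have := @sum_line_ends n V U X2 X1 y0 x0 v0 u0 B (fun y x => r2 x y) n0 X2Q X1Q y0b.
have C' x y : [&& (y == y0 %[mod p])%N, (x == x0 %[mod p])%N & region n V U X2 X1 y x] = C x y.
  by rewrite /C /region coprime_sym addnC andbCA; congr [&& _, _ & _]; rewrite andbCA.
under eq_bigr => x _ do under eq_bigl => y do rewrite C'.
apply=> y x y0' x0' ey ex; rewrite /region => rg.
have rg' : region n U V X1 X2 x y.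
  by move: rg => /and4P[h1 h2 h3 h4]; rewrite /region h1 h2 coprime_sym h3 addnC.
by have [[_ h1] _ [h2 h3] _] := hr (x, y) x0' y0' ex ey rg'.
Qed.

End LineEnds.

(** * Quadruples with two small variables *)

Lemma sum_residues (V : nmodType) p N (F : nat -> V) : (0 < p)%N ->
  \sum_(1 <= x < N.+1) F x =
  \sum_(i < p) \sum_(1 <= x < N.+1 | (x == i.+1 %[mod p])%N) F x.
Proof.
move=> p0; under [RHS]eq_bigr => i _ do rewrite big_mkcond.
rewrite exchange_big /= big_nat_cond [RHS]big_nat_cond; apply: eq_bigr => x /andP[/andP[x0 _] _].
case: x x0 => // z _; have lt : (z %% p < p)%N by rewrite ltn_pmod.
have cE (i : 'I_p) : (z.+1 == i.+1 %[mod p])%N = (i == Ordinal lt).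
  by rewrite -addn1 -[i.+1]addn1 eqn_modDr [(i %% p)%N]modn_small // eq_sym -val_eqE.
by under eq_bigr => i _ do rewrite cE; rewrite -big_mkcond big_pred1_eq.
Qed.

Lemma numdiv_dvd m n : (0 < n)%N -> (m %| n)%N -> (numdiv m <= numdiv n)%N.
Proof.
move=> n0 mn; have m0 := dvdn_gt0 n0 mn.
apply: uniq_leq_size; first exact: divisors_uniq.
by move=> d; rewrite -!dvdn_divisors // => dm; exact: dvdn_trans dm mn.
Qed.

Section WeightedQuadruples.
Variables (R : realType) (p Q D : nat).
Hypothesis p_prime : prime p.
Hypothesis Q_gt0 : (0 < Q)%N.
Hypothesis D_max : forall k, (0 < k <= p * Q)%N -> (numdiv k <= D)%N.
Variable W : nat -> nat -> nat -> nat -> R[i].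
Hypothesis W_mod : forall x y u v, W x y u v = W (x %% p)%N (y %% p)%N (u %% p)%N (v %% p)%N.
Hypothesis W_le1 : forall x y u v, `|W x y u v| <= 1.

(** [x] and [y] are the small variables and [u], [v] their cofactors; the thresholds [U] and [V]
    keep the four ranges disjoint. *)
Definition quad_sum n U V X1 X2 : R[i] :=
  \sum_(1 <= x < n.+1) \sum_(1 <= y < n.+1)
    if (x <= X1)%N && (y <= X2)%N then
      \sum_(1 <= u < n.+1) \sum_(1 <= v < n.+1 | [&& (U < u)%N, (V < v)%N & (x * u + y * v == n)%N])
        W x y u v
    else 0.

(** The total weight of the residue pairs that solutions [(u, v)] can occupy; the factor [1 / p]
    that makes it a mean sits in [quad_main]. *)
Definition line_mean n' g x y : R[i] :=
  \sum_(u0 < p) \sum_(v0 < p | (x * u0 + y * v0 == n' %[mod p])%N) W (g * x)%N (g * y)%N u0 v0.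

Definition quad_main n U V X1 X2 : R[i] :=
  \sum_(1 <= g < n.+1 | (g %| n)%N) \sum_(1 <= x < n.+1) \sum_(1 <= y < n.+1 |
      region (n %/ g)%N U V (X1 %/ g)%N (X2 %/ g)%N x y)
    (((n %/ g)%N%:R - x%:R * U%:R - y%:R * V%:R) / (x%:R * y%:R * p%:R))
    * line_mean (n %/ g)%N g x y.

Let p0 : (0 < p)%N. Proof. exact: prime_gt0. Qed.

Lemma sum_line_weight n g x y U V B :
  \sum_(1 <= u < B.+1) \sum_(1 <= v < B.+1 | [&& (U < u)%N, (V < v)%N & (x * u + y * v == n)%N])
     W (g * x)%N (g * y)%N u v =
  \sum_(u0 < p) \sum_(v0 < p | (x * u0 + y * v0 == n %[mod p])%N)
     W (g * x)%N (g * y)%N u0 v0 * (line_num p n U V u0 v0 B x y)%:R.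
Proof.
transitivity (\sum_(1 <= u < B.+1) \sum_(1 <= v < B.+1)
   \sum_(u0 < p) \sum_(v0 < p | (x * u0 + y * v0 == n %[mod p])%N)
     W (g * x)%N (g * y)%N u0 v0 * ([&& (U < u)%N, (V < v)%N, (u == u0 %[mod p])%N, (v == v0 %[mod p])%N & (x * u + y * v == n)%N] : nat)%:R).
  apply: eq_bigr => u _; rewrite big_mkcond; apply: eq_bigr => v _.
  have lu : (u %% p < p)%N by rewrite ltn_pmod.
  have lv : (v %% p < p)%N by rewrite ltn_pmod.
  case: ifP => [/and3P[h1 h2 /eqP h3]|hN]; last first.
    rewrite big1 // => u0 _; rewrite big1 // => v0 _.
    have -> : [&& (U < u)%N, (V < v)%N, u == u0 %[mod p], v == v0 %[mod p] & (x * u + y * v == n)%N] = false.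
      apply: contraFF hN => /and5P[-> -> _ _ ->] //.
    by rewrite mulr0.
  rewrite (bigD1 (Ordinal lu)) //= (bigD1 (Ordinal lv)) /=; last first.
    by rewrite -h3 -modnDm !modnMmr modnDm.
  rewrite h1 h2 h3 !modn_mod !eqxx /= mulr1 big1 => [|v0 /andP[_ nv]].
    rewrite addr0 big1 => [|u0 nu]; first by rewrite addr0 W_mod [RHS]W_mod !modn_mod.
    rewrite big1 // => v0 _; suff /negPf-> : (u %% p != u0 %% p)%N by rewrite mulr0.
    by apply: contra nu => /eqP e; rewrite -val_eqE /= e modn_small.
  suff /negPf-> : (v %% p != v0 %% p)%N by rewrite mulr0.
  by apply: contra nv => /eqP e; rewrite -val_eqE /= e modn_small.
under eq_bigr => u _ do rewrite exchange_big.
rewrite exchange_big /=; apply: eq_bigr => u0 _.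
under eq_bigr => u _ do rewrite exchange_big.
rewrite exchange_big /=; apply: eq_bigr => v0 _.
rewrite /line_num natr_sum mulr_sumr; apply: eq_bigr => u _.
by rewrite natr_sum mulr_sumr.
Qed.

(** The gcd [g] of the two small variables must divide [n]. Removing it leaves the coprime
    coefficients that [line_count] requires, while the weight keeps [g * x] and [g * y]. *)
Lemma quad_sum_split n U V X1 X2 : (0 < n)%N -> (X1 <= n)%N -> (X2 <= n)%N ->
  quad_sum n U V X1 X2 =
  \sum_(1 <= g < n.+1 | (g %| n)%N) \sum_(1 <= x < n.+1) \sum_(1 <= y < n.+1 |
      region (n %/ g)%N U V (X1 %/ g)%N (X2 %/ g)%N x y)
    \sum_(u0 < p) \sum_(v0 < p | (x * u0 + y * v0 == n %/ g %[mod p])%N)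
     W (g * x)%N (g * y)%N u0 v0 * (line_num p (n %/ g)%N U V u0 v0 n x y)%:R.
Proof.
move=> n0 X1n X2n; rewrite /quad_sum sum_gcd_split [RHS]big_mkcond.
rewrite [LHS]big_nat_cond [RHS]big_nat_cond; apply: eq_bigr => g /andP[/andP[g0 gn] _].
have [gdn|ngdn] := boolP (g %| n)%N; last first.
  rewrite big1 // => x _; rewrite big1 // => y _; case: ifP => // _.
  rewrite big1 // => u _; rewrite big1 // => v /and3P[_ _ /eqP e]; case/negP: ngdn.
  by rewrite -e -!mulnA -mulnDr dvdn_mulr.
have en : n = (g * (n %/ g))%N by rewrite mulnC divnK.
set n' := (n %/ g)%N in en *.
rewrite [LHS]big_mkcond; apply: eq_bigr => x _.
have h1 z X : (X <= n)%N -> (z <= X %/ g)%N = (g * z <= X)%N by move=> _; rewrite leq_divRL // mulnC.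
rewrite [RHS]big_mkcond; case: ifP => gx; last first.
  rewrite big1 // => y _; rewrite /region (h1 x) //.
  by case: ifP => // /and4P[h _ _ _]; move: gx; rewrite (leq_trans h X1n).
rewrite [LHS]big_mkcond [LHS]big_nat_cond [RHS]big_nat_cond; apply: eq_bigr => y /andP[/andP[y0 _] _].
rewrite /region (h1 x) // (h1 y) //.
case: (boolP (g * x <= X1)%N) => hx /=; last by case: ifP.
case: (boolP (g * y <= X2)%N) => hy /=; last by case: ifP.
rewrite (leq_trans hy X2n) /=; case: (boolP (coprime x y)) => //= cxy.
rewrite -sum_line_weight.
rewrite (eq_bigr (fun u => \sum_(1 <= v < n.+1 | [&& (U < u)%N, (V < v)%N & (x * u + y * v == n')%N]) W (g * x)%N (g * y)%N u v)); last first.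
  move=> u _; apply: eq_bigl => v; rewrite [X in (_ == X)%N]en -!mulnA -mulnDr eqn_pmul2l //.
case: ltnP => // le; rewrite big1 // => u _; rewrite big1 // => v /and3P[hu hv /eqP e].
have h2 : (x * U + y * V < x * u + y * v)%N.
  by apply: leq_ltn_trans (_ : x * u + y * V < _)%N; [rewrite leq_add2r leq_mul2l (ltnW hu) orbT | rewrite ltn_add2l ltn_pmul2l].
by move: h2; rewrite e ltnNge le.
Qed.

(** [p ^ 4] counts the residue classes of the four variables and one factor [numdiv n] the values of
    [g]; the other comes from summing [gcdn y n / y]. *)
Lemma quad_sum_main n U V X1 X2 : (0 < n)%N -> (X1 <= n)%N -> (X2 <= n)%N ->
  (X1 <= Q)%N -> (X2 <= Q)%N ->
  `|quad_sum n U V X1 X2 - quad_main n U V X1 X2| <=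
  (p%:R ^+ 4 * (2 * end_const R p Q D * ((numdiv n)%:R ^+ 2 * harm R (p * Q))))%:C.
Proof.
move=> n0 X1n X2n X1Q X2Q.
rewrite quad_sum_split // /quad_main -sumrB.
set E := 2 * end_const R p Q D * ((numdiv n)%:R * harm R (p * Q)).
have E0 : 0 <= E.
  by rewrite /E /end_const !mulr_ge0 ?exprn_ge0 ?pow34_ge0 ?harm_ge0 ?ler0n.
have -> : p%:R ^+ 4 * (2 * end_const R p Q D * ((numdiv n)%:R ^+ 2 * harm R (p * Q))) = (numdiv n)%:R * (p%:R ^+ 4 * E).
  by rewrite /E; ring.
have -> : ((numdiv n)%:R * (p%:R ^+ 4 * E))%:C = \sum_(1 <= g < n.+1 | (g %| n)%N) (p%:R ^+ 4 * E)%:C.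
  by rewrite numdivE // natr_sum mulr_suml rmorph_sum; apply: eq_bigr => g _; rewrite mul1r.
apply: (le_trans (ler_norm_sum _ _ _)).
rewrite big_nat_cond [leRHS]big_nat_cond; apply: ler_sum => g /andP[/andP[g0 gn] gdn].
set n' := (n %/ g)%N.
have n'0 : (0 < n')%N by rewrite divn_gt0 // dvdn_leq.
have n'n : (n' <= n)%N by exact: leq_div.
pose reg x y := region n' U V (X1 %/ g)%N (X2 %/ g)%N x y.
pose diff u0 v0 x y : R := (line_num p n' U V u0 v0 n x y)%:R -
  (n'%:R - x%:R * U%:R - y%:R * V%:R) / (x%:R * y%:R * p%:R).
have -> : \sum_(1 <= x < n.+1) \sum_(1 <= y < n.+1 | reg x y)
    \sum_(u0 < p) \sum_(v0 < p | (x * u0 + y * v0 == n' %[mod p])%N)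
     W (g * x)%N (g * y)%N u0 v0 * (line_num p n' U V u0 v0 n x y)%:R
   - \sum_(1 <= x < n.+1) \sum_(1 <= y < n.+1 | reg x y)
    ((n'%:R - x%:R * U%:R - y%:R * V%:R) / (x%:R * y%:R * p%:R)) * line_mean n' g x y
  = \sum_(i < p) \sum_(j < p) \sum_(u0 < p) \sum_(v0 < p | (i.+1 * u0 + j.+1 * v0 == n' %[mod p])%N)
      W (g * i.+1)%N (g * j.+1)%N u0 v0 *
      (\sum_(1 <= x < n.+1) \sum_(1 <= y < n.+1 |
       [&& (x == i.+1 %[mod p])%N, (y == j.+1 %[mod p])%N & reg x y]) diff u0 v0 x y)%:C.
  rewrite -sumrB.
  rewrite (sum_residues _ _ p0); apply: eq_bigr => i _.
  transitivity (\sum_(1 <= x < n.+1 | (x == i.+1 %[mod p])%N) \sum_(j < p)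
     \sum_(1 <= y < n.+1 | (y == j.+1 %[mod p])%N && reg x y)
     \sum_(u0 < p) \sum_(v0 < p | (i.+1 * u0 + j.+1 * v0 == n' %[mod p])%N)
       W (g * i.+1)%N (g * j.+1)%N u0 v0 * (diff u0 v0 x y)%:C).
    apply: eq_bigr => x /eqP ex; rewrite -sumrB big_mkcond (sum_residues _ _ p0); apply: eq_bigr => j _.
    rewrite -big_mkcondr; apply: eq_bigr => y /andP[/eqP ey _].
    rewrite /line_mean mulr_sumr -sumrB; apply: eq_bigr => u0 _.
    rewrite mulr_sumr -sumrB; apply: eq_big => [v0|v0 _].
      by rewrite -modnDm -(modnMml x) -(modnMml y) ex ey !modnMml modnDm.
    rewrite [X in _ - X]mulrC -mulrBr; congr (_ * _).
      have gx : (g * x %% p = g * i.+1 %% p)%N by rewrite -modnMmr ex modnMmr.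
      have gy : (g * y %% p = g * j.+1 %% p)%N by rewrite -modnMmr ey modnMmr.
      by rewrite [LHS]W_mod [RHS]W_mod gx gy.
    rewrite /diff rmorphB /= rmorphM /= fmorphV !rmorphB /= !rmorphM /= !rmorph_nat.
    by [].
  rewrite exchange_big /=; apply: eq_bigr => j _.
  under eq_bigr => x _ do rewrite exchange_big /=.
  rewrite exchange_big /=; apply: eq_bigr => u0 _.
  under eq_bigr => x _ do rewrite exchange_big /=.
  rewrite exchange_big /=; apply: eq_bigr => v0 _.
  under eq_bigr => x _ do rewrite -mulr_sumr.
  rewrite -mulr_sumr; congr (_ * _); rewrite rmorph_sum /= [LHS]big_mkcond; apply: eq_bigr => x _.
  case: ifP => ex; last by rewrite big1 ?rmorph0 // => y; rewrite ex.
  by rewrite rmorph_sum.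
have -> : (p%:R ^+ 4 * E)%:C = \sum_(i < p) \sum_(j < p) \sum_(u0 < p) \sum_(v0 < p) E%:C.
  have -> : (p%:R ^+ 4 * E)%:C = p%:R ^+ 4 * E%:C.
    by rewrite rmorphM; congr (_ * _); rewrite rmorphXn; congr (_ ^+ _); rewrite rmorph_nat.
  by rewrite !sumr_const !card_ord -!mulrnA -[RHS]mulr_natr !natrM; ring.
have tri (I : finType) (P : pred I) (F G : I -> R[i]) : (forall i, 0 <= G i) -> (forall i, P i -> `|F i| <= G i) ->
   `|\sum_(i | P i) F i| <= \sum_i G i.
  move=> G0 FG; apply: (le_trans (ler_norm_sum _ _ _)); rewrite big_mkcond /=.
  by apply: ler_sum => i _; case: ifP => // /FG.
have EC : 0 <= E%:C by rewrite lecR.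
apply: (@tri _ _ _ _) => [i|i _]; first by do ?[apply: sumr_ge0 => ? _].
apply: (@tri _ _ _ _) => [j|j _]; first by do ?[apply: sumr_ge0 => ? _].
apply: (@tri _ _ _ _) => [u0|u0 _]; first by do ?[apply: sumr_ge0 => ? _].
apply: tri => // v0 /eqP cons.
rewrite normrM normc_real; set S := \sum_(1 <= x < n.+1) _.
apply: (@le_trans _ _ (1 * `|S|%:C)); first by rewrite ler_wpM2r // lecR.
rewrite mul1r lecR /S.
have b1 : (X1 %/ g <= Q)%N by exact: leq_trans (leq_div _ _) X1Q.
have b2 : (X2 %/ g <= Q)%N by exact: leq_trans (leq_div _ _) X2Q.
have h := @core_bound R p Q D p_prime Q_gt0 D_max n' U V (X1 %/ g)%N (X2 %/ g)%N i.+1 j.+1 u0 v0 n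
  n'n n'0 b1 b2 (ltn_ord i) (ltn_ord j) cons.
apply: (le_trans h).
rewrite /E; apply: ler_wpM2l; first by rewrite !mulr_ge0 ?exprn_ge0 ?pow34_ge0 ?harm_ge0 ?ler0n.
rewrite ler_wpM2r ?harm_ge0 // ler_nat numdiv_dvd //.
by apply/dvdnP; exists g; rewrite mulnC divnK.
Qed.

End WeightedQuadruples.

Section RealModulus.
Variable R : realType.
Implicit Types z w : R[i].

(** The norm of [R[i]] takes values in [R[i]]; this is the same modulus in [R], where error terms
    are compared. *)
Definition cabs z : R := complex.Re `|z|.

Lemma cabsE z : `|z| = (cabs z)%:C.
Proof. by rewrite /cabs normc_def. Qed.

Lemma le_cabs z r : (`|z| <= r%:C) = (cabs z <= r).
Proof. by rewrite cabsE lecR. Qed.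

Lemma cabs_ge0 z : 0 <= cabs z.
Proof. by have := normr_ge0 z; rewrite cabsE lecR. Qed.

Lemma cabsM z w : cabs (z * w) = cabs z * cabs w.
Proof. by apply: complexI; rewrite -cabsE normrM !cabsE rmorphM. Qed.

Lemma cabsD z w : cabs (z + w) <= cabs z + cabs w.
Proof. by rewrite -lecR -cabsE rmorphD /= -!cabsE ler_normD. Qed.

Lemma cabsN z : cabs (- z) = cabs z.
Proof. by apply: complexI; rewrite -!cabsE normrN. Qed.

Lemma cabsB z w : cabs (z - w) <= cabs z + cabs w.
Proof. by rewrite -(cabsN w) cabsD. Qed.

Lemma cabs_real (x : R) : cabs x%:C = `|x|.
Proof. by apply: complexI; rewrite -cabsE normc_real. Qed.

Lemma cabs_nat n : cabs n%:R = n%:R.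
Proof. by apply: complexI; rewrite -cabsE normr_nat rmorph_nat. Qed.

Lemma cabsV z : cabs z^-1 = (cabs z)^-1.
Proof. by apply: complexI; rewrite -cabsE normfV cabsE fmorphV. Qed.

Lemma cabs0 : cabs 0 = 0.
Proof. by rewrite (cabs_nat 0). Qed.

Lemma cabs1 : cabs 1 = 1.
Proof. by rewrite (cabs_nat 1). Qed.

Lemma cabs_eq0 z : (cabs z == 0) = (z == 0).
Proof. by rewrite -[RHS]normr_eq0 cabsE -(inj_eq (@complexI R)). Qed.

Lemma cabs_sum (I : Type) (s : seq I) (P : pred I) (F : I -> R[i]) :
  cabs (\sum_(i <- s | P i) F i) <= \sum_(i <- s | P i) cabs (F i).
Proof.
rewrite -lecR -cabsE rmorph_sum /=; under [leRHS]eq_bigr => i _ do rewrite -cabsE.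
exact: ler_norm_sum.
Qed.

Lemma cabs_sum_nat m n (P : pred nat) (F : nat -> R[i]) (G : nat -> R) :
  (forall i, (m <= i < n)%N -> P i -> cabs (F i) <= G i) ->
  cabs (\sum_(m <= i < n | P i) F i) <= \sum_(m <= i < n | P i) G i.
Proof.
move=> FG; apply: (le_trans (cabs_sum _ _ _)).
rewrite big_nat_cond [leRHS]big_nat_cond; apply: ler_sum => i /andP[h1 h2]; exact: FG.
Qed.

Lemma cabs_invn n : cabs n%:R^-1 = n%:R^-1.
Proof. by rewrite cabsV cabs_nat. Qed.

End RealModulus.

(** * The inverse of a Dirichlet series at 2 *)

Section MoebiusInverse.
Variable R : realType.
Variable T : nat -> R[i].
Hypothesis T1 : T 1 = 1.
Hypothesis TM : forall a b, T (a * b)%N = T a * T b.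
Hypothesis T_le1 : forall a, cabs (T a) <= 1.

Definition mob n : R[i] := (moebius n)%:~R.

Lemma cabs_mob n : cabs (mob n) <= 1.
Proof.
have e : mob n = ((moebius n)%:~R : R)%:C by rewrite /mob rmorph_int.
by rewrite e cabs_real -intr_norm -[1]/(1%:~R) ler_int moebius_norm_le1.
Qed.

Definition mobS N : R[i] := \sum_(1 <= e < N.+1) mob e * T e / e%:R ^+ 2.

Lemma cabs_mobterm e : cabs (mob e * T e / e%:R ^+ 2) <= e%:R^-1 ^+ 2.
Proof.
rewrite !cabsM cabsV expr2 cabsM cabs_nat invfM -expr2 -[leRHS]mul1r ler_pM ?mulr_ge0 ?cabs_ge0 ?exprn_ge0 ?invr_ge0 ?ler0n //.
by rewrite -[1]mulr1 ler_pM ?cabs_ge0 // cabs_mob.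
Qed.

Lemma cabs_mobS N : cabs (mobS N) <= 2.
Proof.
apply: le_trans (cabs_sum_nat (G := fun e => e%:R^-1 ^+ 2) _) _ => [e _ _|].
  exact: cabs_mobterm.
by apply: (le_trans (sum_inv_sqr_tail R 0 N)); rewrite divr1.
Qed.

Lemma divS_ge N e : (0 < e)%N -> N%:R / e%:R <= (N %/ e).+1%:R :> R.
Proof.
move=> e0; rewrite ler_pdivrMr ?ltr0n // -natrM ler_nat mulSn addnC.
by rewrite {1}(divn_eq N e) leq_add2l ltnW // ltn_pmod.
Qed.

(** Multiply the truncated series of [La] and of its inverse: by Moebius inversion the pairs with
    [e * f <= N] give exactly [1]. The other pairs contribute at most the sum of
    [2 / (e ^ 2 * (N / e))], whence the harmonic factor. *)
Lemma mobS_inv (La : R[i]) (K : R) : La != 0 ->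
  (forall N, cabs (\sum_(1 <= k < N.+1) T k / k%:R ^+ 2 - La) <= K / N.+1%:R) ->
  exists K' : R, forall N, (0 < N)%N -> cabs (mobS N - La^-1) <= K' * harm R N / N%:R.
Proof.
move=> La0 hK; exists ((2 * K + 2) / cabs La) => N N0.
have NR : 0 < N%:R :> R by rewrite ltr0n.
have K0 : 0 <= K by have := hK 0%N; rewrite divr1; apply: le_trans; exact: cabs_ge0.
have H1 : 1 <= harm R N by exact: harm_ge1.
set S := \sum_(1 <= k < N.+1) T k / k%:R ^+ 2.
have aL : 0 < cabs La by rewrite lt0r cabs_eq0 La0 cabs_ge0.
pose G k : R[i] := T k / k%:R ^+ 2.
have GM e f : mob e * T e / e%:R ^+ 2 * G f = mob e * G (e * f)%N.
  have h : ((e * f)%N%:R ^+ 2)^-1 = (e%:R ^+ 2)^-1 * (f%:R ^+ 2)^-1 :> R[i].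
    by rewrite natrM exprMn invfM.
  by rewrite /G TM h; move: (e%:R ^+ 2)^-1 (f%:R ^+ 2)^-1 => a b; ring.
have eR : cabs (mobS N * S - 1) <= 2 * harm R N / N%:R.
  have -> : mobS N * S - 1 = \sum_(1 <= e < N.+1) \sum_(1 <= f < N.+1 | ~~ (e * f <= N)%N) mob e * G (e * f)%N.
    rewrite /mobS /S big_distrlr /=.
    have e1 : \sum_(1 <= e < N.+1) \sum_(1 <= f < N.+1 | (e * f <= N)%N) mob e * G (e * f)%N = 1.
      rewrite big_nat_cond (eq_bigr (fun e => \sum_(1 <= k < N.+1 | (e %| k)%N) mob e * G k)) => [|e /andP[/andP[e0 _] _]]; last first.
        by rewrite (sum_multiples _ (fun k => mob e * G k)).
      rewrite -big_nat_cond; under eq_bigr => e _ do rewrite big_mkcond.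
      rewrite exchange_big /= big_ltn // [X in _ + X]big_nat_cond [X in _ + X]big1 => [|k /andP[/andP[k1 kN] _]].
        rewrite addr0 big_ltn //= [X in _ + X]big_nat_cond big1 ?addr0 => [|e /andP[/andP[e1 _] _]]; last first.
          by rewrite dvdn1 gtn_eqF.
        by rewrite /mob moebius1 /G T1 expr1n divr1 mulr1.
      transitivity ((\sum_(e <- divisors k) mob e) * G k).
        rewrite sum_divisors; last exact: ltnW.
        rewrite mulr_suml -big_mkcond /= [in RHS](big_nat_widen _ _ N.+1) //=.
        rewrite big_nat_cond [RHS]big_nat_cond; apply: eq_bigl => e.
        congr (_ && _); case: (boolP (e %| k)%N) => //= ek.
        by rewrite ltnS dvdn_leq // ltnW.
      rewrite /mob -(rmorph_sum (intmul 1)) /= sum_moebius; last exact: ltnW.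
      by rewrite gtn_eqF // mul0r.
    rewrite -[X in _ - X = _]e1 -sumrB; apply: eq_bigr => e _.
    rewrite [X in X - _](eq_bigr (fun f => mob e * G (e * f)%N)); last by move=> f _; exact: GM.
    rewrite [X in X - _](bigID (fun f => (e * f <= N)%N)) /=.
    by rewrite addrAC subrr add0r.
  apply: le_trans (cabs_sum_nat (G := fun e => 2 / N%:R * e%:R^-1) _) _ => [e /andP[e0 _] _|]; last first.
    by rewrite -mulr_sumr -/(harm R N) mulrAC.
  apply: le_trans (cabs_sum_nat (G := fun f => e%:R^-1 ^+ 2 * f%:R^-1 ^+ 2) _) _ => [f _ _|].
    rewrite -GM cabsM ler_pM ?cabs_ge0 ?cabs_mobterm //.
    rewrite /G cabsM cabsV expr2 cabsM cabs_nat invfM -expr2 -[leRHS]mul1r.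
    by rewrite ler_wpM2r ?exprn_ge0 ?invr_ge0 ?ler0n.
  rewrite -mulr_sumr.
  apply: (@le_trans _ _ (e%:R^-1 ^+ 2 * (2 / (N %/ e).+1%:R))).
    apply: ler_wpM2l; first by rewrite exprn_ge0 ?invr_ge0 ?ler0n.
    apply: le_trans (sum_inv_sqr_tail R (N %/ e) N).
    rewrite [leRHS](big_nat_widenl _ 1) //= big_mkcond [leRHS]big_mkcond; apply: ler_sum => f _.
    by rewrite -ltnNge [(e * f)%N]mulnC -ltn_divLR.
  have eR : 0 < e%:R :> R by rewrite ltr0n.
  have h := divS_ge N e0.
  apply: (@le_trans _ _ (e%:R^-1 ^+ 2 * (2 / (N%:R / e%:R)))).
    apply: ler_wpM2l; first by rewrite exprn_ge0 ?invr_ge0 ?ler0n.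
    by apply: ler_wpM2l => //; rewrite lef_pV2 ?posrE ?divr_gt0 ?ltr0n.
  rewrite le_eqVlt; apply/orP; left; apply/eqP; field.
  by rewrite !lt0r_neq0.
have -> : mobS N - La^-1 = (mobS N * (La - S) + (mobS N * S - 1)) / La.
  by rewrite mulrBr; field.
rewrite cabsM cabsV.
have -> : (2 * K + 2) / cabs La * harm R N / N%:R = (2 * K + 2) * harm R N / N%:R / cabs La.
  by move: (cabs La)^-1 (N%:R^-1 : R) => a b; ring.
rewrite ler_wpM2r ?invr_ge0 ?cabs_ge0 //.
apply: (le_trans (cabsD _ _)).
have h2 : cabs (mobS N * (La - S)) <= 2 * K * harm R N / N%:R.
  rewrite cabsM -mulrA -mulrA; apply: ler_pM; rewrite ?cabs_ge0 ?cabs_mobS //.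
  rewrite -cabsN opprB; apply: (le_trans (hK N)); rewrite ler_wpM2l //.
  apply: (@le_trans _ _ N%:R^-1); first by rewrite lef_pV2 ?posrE ?ltr0n // ler_nat.
  by rewrite ler_peMl ?invr_ge0 ?ler0n.
by apply: le_trans (lerD h2 eR) _; rewrite !mulrDl.
Qed.

End MoebiusInverse.

(** * Main terms *)

Section MainSums.
Variable R : realType.
Variables (h h' : nat -> R[i]) (n : nat).
Hypothesis n_gt0 : (0 < n)%N.
Hypothesis hM : forall a b, h (a * b)%N = h a * h b.
Hypothesis h'M : forall a b, h' (a * b)%N = h' a * h' b.
Hypothesis h_le1 : forall a, cabs (h a) <= 1.
Hypothesis h'_le1 : forall a, cabs (h' a) <= 1.

Definition hh a := h a * h' a.

Definition wterm x y : R[i] := h x * h' y / (x%:R * y%:R).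

(** [om] is the cut-off, a box or a triangle. The scale [m] will be the common divisor [g] times the
    Moebius variable that removes coprimality. *)
Definition Asum (om : nat -> nat -> R) m : R[i] :=
  \sum_(1 <= x < n.+1) \sum_(1 <= y < n.+1) wterm x y * (om (m * x)%N (m * y)%N)%:C.

Definition Tsum (om : nat -> nat -> R) g : R[i] :=
  \sum_(1 <= x < n.+1) \sum_(1 <= y < n.+1 | coprime x y)
    wterm x y * (om (g * x)%N (g * y)%N)%:C.

Lemma hh_le1 a : cabs (hh a) <= 1.
Proof. by rewrite cabsM -[1]mulr1 ler_pM ?cabs_ge0. Qed.

Lemma wtermM e x y : wterm (e * x) (e * y) = hh e / e%:R ^+ 2 * wterm x y.
Proof.
rewrite /wterm /hh hM h'M !natrM.
have -> : e%:R * x%:R * (e%:R * y%:R) = e%:R ^+ 2 * (x%:R * y%:R) :> R[i] by ring.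
by rewrite invfM; move: (e%:R ^+ 2)^-1 (x%:R * y%:R)^-1 => a b; ring.
Qed.

Lemma coprime_moebius x y : (0 < x <= n)%N ->
  (coprime x y)%:R = \sum_(1 <= e < n.+1 | (e %| x)%N && (e %| y)%N) mob R e.
Proof.
move=> /andP[x0 xn]; have g0 : (0 < gcdn x y)%N by rewrite gcdn_gt0 x0.
have gn : (gcdn x y <= n)%N by rewrite (leq_trans _ xn) // dvdn_leq // dvdn_gcdl.
have := sum_moebius g0; rewrite sum_divisors // => /(congr1 (intmul (1 : R[i]))).
rewrite rmorph_sum rmorph_nat /coprime => <-.
rewrite [LHS](big_nat_widen _ _ n.+1) //= big_nat_cond [RHS]big_nat_cond; apply: eq_bigl => e.
congr (_ && _); rewrite -dvdn_gcd; case: (boolP (e %| _)%N) => //= eg.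
by rewrite ltnS dvdn_leq.
Qed.

Lemma Tsum_moebius om g : (0 < g)%N ->
  (forall a b, (n < a)%N || (n < b)%N -> om a b = 0) ->
  Tsum om g = \sum_(1 <= e < n.+1) mob R e * hh e / e%:R ^+ 2 * Asum om (g * e)%N.
Proof.
move=> g0 om0; rewrite /Tsum.
transitivity (\sum_(1 <= x < n.+1) \sum_(1 <= y < n.+1) \sum_(1 <= e < n.+1)
   if (e %| x)%N && (e %| y)%N then mob R e * (wterm x y * (om (g * x)%N (g * y)%N)%:C) else 0).
  rewrite big_nat_cond [RHS]big_nat_cond; apply: eq_bigr => x /andP[/andP[x0 xn] _].
  rewrite big_mkcond; apply: eq_bigr => y _.
  rewrite -big_mkcond /= -mulr_suml -coprime_moebius ?x0 //.
  by case: coprime; rewrite ?mul1r ?mul0r.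
under eq_bigr => x _ do rewrite exchange_big /=.
rewrite exchange_big /= big_nat_cond [RHS]big_nat_cond.
apply: eq_bigr => e /andP[/andP[e0 _] _].
transitivity (\sum_(1 <= x < n.+1 | (e %| x)%N) \sum_(1 <= y < n.+1 | (e %| y)%N)
    mob R e * (wterm x y * (om (g * x)%N (g * y)%N)%:C)).
  rewrite [RHS]big_mkcond; apply: eq_bigr => x _; case: (boolP (e %| x)%N) => ex.
    by rewrite [RHS]big_mkcond.
  by rewrite big1.
rewrite sum_multiples // /Asum mulr_sumr big_mkcond; apply: eq_bigr => x _.
have om0' z y : (n < e * z)%N -> om (g * e * z)%N y = 0 /\ om y (g * e * z)%N = 0.
  move=> ez; have h1 : (n < g * e * z)%N by rewrite -mulnA (leq_trans ez) // leq_pmull.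
  by rewrite !om0 ?h1 ?orbT.
case: leqP => ex; last first.
  by rewrite big1 ?mulr0 // => y _; have [-> _] := om0' x (g * e * y)%N ex; rewrite mulr0.
rewrite sum_multiples // mulr_sumr big_mkcond; apply: eq_bigr => y _.
case: leqP => ey; last first.
  by have [_ ->] := om0' y (g * e * x)%N ey; rewrite !mulr0.
by rewrite wtermM !mulnA; ring.
Qed.

Variables (LL La : R[i]) (E E2 : R).

(** An error growing like [m] is affordable: at [m = g * e] it meets the weight [1 / e ^ 2], which
    leaves a harmonic sum. *)
Lemma Tsum_bound om g : (0 < g)%N ->
  (forall a b, (n < a)%N || (n < b)%N -> om a b = 0) ->
  (forall m, (0 < m)%N -> cabs (Asum om m - LL) <= E * m%:R) ->
  cabs (mobS hh n - La^-1) <= E2 ->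
  cabs (Tsum om g - LL / La) <= E * g%:R * harm R n + cabs LL * E2.
Proof.
move=> g0 om0 hA hm; rewrite Tsum_moebius //.
have -> : \sum_(1 <= e < n.+1) mob R e * hh e / e%:R ^+ 2 * Asum om (g * e)%N - LL / La =
  \sum_(1 <= e < n.+1) mob R e * hh e / e%:R ^+ 2 * (Asum om (g * e)%N - LL) + LL * (mobS hh n - La^-1).
  under [in RHS]eq_bigr => e _ do rewrite mulrBr.
  by rewrite sumrB /mobS -mulr_suml; ring.
apply: (le_trans (cabsD _ _)); apply: lerD; last by rewrite cabsM ler_wpM2l ?cabs_ge0.
apply: le_trans (cabs_sum_nat (G := fun e => E * g%:R * e%:R^-1) _) _ => [e /andP[e0 _] _|]; last first.
  by rewrite -mulr_sumr.
rewrite cabsM; apply: (@le_trans _ _ (e%:R^-1 ^+ 2 * (E * (g * e)%N%:R))).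
  apply: ler_pM; rewrite ?cabs_ge0 ?cabs_mobterm //; first exact: hh_le1.
  by apply: hA; rewrite muln_gt0 g0.
have eR : e%:R != 0 :> R by rewrite pnatr_eq0 -lt0n.
by rewrite natrM le_eqVlt; apply/orP; left; apply/eqP; field.
Qed.

Lemma main_bound om :
  (forall a b, (n < a)%N || (n < b)%N -> om a b = 0) ->
  (forall m, (0 < m)%N -> cabs (Asum om m - LL) <= E * m%:R) ->
  cabs (mobS hh n - La^-1) <= E2 ->
  cabs (\sum_(1 <= g < n.+1 | (g %| n)%N) hh g / g%:R * Tsum om g
        - (\sum_(1 <= g < n.+1 | (g %| n)%N) hh g / g%:R) * (LL / La)) <=
  (numdiv n)%:R * (E * harm R n + cabs LL * E2).
Proof.
move=> om0 hA hm; rewrite mulr_suml -sumrB.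
have E20 : 0 <= E2 by apply: le_trans hm; exact: cabs_ge0.
rewrite numdivE // natr_sum mulr_suml.
apply: cabs_sum_nat => g /andP[g0 _] _; rewrite mul1r -mulrBr cabsM.
have gR : 0 < g%:R :> R by rewrite ltr0n.
apply: (@le_trans _ _ (g%:R^-1 * (E * g%:R * harm R n + cabs LL * E2))).
  apply: ler_pM; rewrite ?cabs_ge0 ?Tsum_bound //.
  by rewrite cabsM cabs_invn ler_piMl ?invr_ge0 ?ler0n ?hh_le1.
rewrite mulrDr (_ : g%:R^-1 * (E * g%:R * harm R n) = E * harm R n); last first.
  by field; rewrite lt0r_neq0.
rewrite lerD2l ler_piMl ?mulr_ge0 ?cabs_ge0 // invf_le1 // ler1n //.
Qed.

End MainSums.

(** * Character averages over boxes and triangles *)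

Section Averages.
Variable R : realType.
Variables (h h' : nat -> R[i]) (L L' : R[i]) (K B : R) (n Y : nat).
Hypothesis Y_gt0 : (0 < Y)%N.
Hypothesis Yn : (Y * Y <= n)%N.
Hypothesis h_le1 : forall a, cabs (h a) <= 1.
Hypothesis hL : forall N, cabs (\sum_(1 <= x < N.+1) h x / x%:R - L) <= K / N.+1%:R.
Hypothesis h'L : forall N, cabs (\sum_(1 <= x < N.+1) h' x / x%:R - L') <= K / N.+1%:R.
Hypothesis hB : forall N, cabs (\sum_(1 <= x < N.+1) h x) <= B.
Hypothesis h'B : forall N, cabs (\sum_(1 <= x < N.+1) h' x) <= B.

Let K0 : 0 <= K.
Proof. by have := hL 0; rewrite divr1; apply: le_trans; exact: cabs_ge0. Qed.
Let B0 : 0 <= B. Proof. by apply: le_trans (hB 0); exact: cabs_ge0. Qed.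
Let n0 : (0 < n)%N. Proof. by apply: leq_trans Yn; rewrite muln_gt0 Y_gt0. Qed.
Let YR : 0 < Y%:R :> R. Proof. by rewrite ltr0n. Qed.
Let nR : 0 < n%:R :> R. Proof. by rewrite ltr0n. Qed.

Definition om_box a b : R := ((a <= Y)%N && (b <= Y)%N)%:R.

(** The count of solutions above both thresholds is proportional to [n - a * Y - b * Y], cut off at
    zero; this is that factor relative to [n]. *)
Definition om_tri a b : R := if ((a + b) * Y < n)%N then 1 - (a + b)%N%:R * Y%:R / n%:R else 0.

(** The box factors into two partial sums of length [Y %/ m], each within [K * m / Y] of its
    limit. *)
Lemma Asum_box m : (0 < m)%N ->
  cabs (Asum h h' n om_box m - L * L') <= K * (cabs L + cabs L' + K) / Y%:R * m%:R.
Proof.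
move=> m0; have mR : 0 < m%:R :> R by rewrite ltr0n.
have Ym (f : nat -> R[i]) : \sum_(1 <= x < n.+1) (m * x <= Y)%N%:R * f x = \sum_(1 <= x < (Y %/ m).+1) f x.
  have le : (Y %/ m <= n)%N.
    by rewrite (leq_trans (leq_div _ _)) // (leq_trans _ Yn) // leq_pmulr.
  rewrite [RHS](big_nat_widen _ _ n.+1) //= [RHS]big_mkcond; apply: eq_bigr => x _.
  by rewrite ltnS leq_divRL // mulnC; case: (_ <= _)%N; rewrite ?mul1r ?mul0r.
have -> : Asum h h' n om_box m = (\sum_(1 <= x < (Y %/ m).+1) h x / x%:R) * (\sum_(1 <= x < (Y %/ m).+1) h' x / x%:R).
  rewrite -!Ym big_distrlr /=; apply: eq_bigr => x _; apply: eq_bigr => y _.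
  rewrite /om_box /wterm invfM -mulnb natrM rmorphM /= !rmorph_nat.
  by move: (x%:R^-1) (y%:R^-1) => a b; ring.
set P := \sum_(1 <= x < _) h x / _; set P' := \sum_(1 <= x < _) h' x / _.
have hP := hL (Y %/ m); have hP' := h'L (Y %/ m); rewrite -/P -/P' in hP hP'.
have ineq : K / (Y %/ m).+1%:R <= K * (m%:R / Y%:R).
  rewrite ler_wpM2l // -[leRHS]invf_div lef_pV2 ?posrE ?divr_gt0 ?ltr0n //; exact: divS_ge.
have {}hP := le_trans hP ineq; have {}hP' := le_trans hP' ineq.
have bP : cabs P <= cabs L + K.
  have -> : P = L + (P - L) by ring.
  apply: (le_trans (cabsD _ _)); rewrite lerD2l; apply: (le_trans (hL _)).
  by rewrite ler_pdivrMr ?ltr0n // ler_peMr // ler1n.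
have -> : P * P' - L * L' = P * (P' - L') + L' * (P - L) by ring.
apply: (le_trans (cabsD _ _)); rewrite !cabsM.
have h1 : cabs P * cabs (P' - L') <= (cabs L + K) * (K * (m%:R / Y%:R)) by rewrite ler_pM ?cabs_ge0.
have h2 : cabs L' * cabs (P - L) <= cabs L' * (K * (m%:R / Y%:R)) by rewrite ler_wpM2l ?cabs_ge0.
apply: (le_trans (lerD h1 h2)); rewrite le_eqVlt; apply/orP; left; apply/eqP.
by move: (Y%:R^-1) => i; ring.
Qed.

(** For fixed [x] the weight is linear in [y], so the inner sum is a partial sum of the L-series
    minus a partial sum of the character, which is bounded. As the weight tends to zero at the cut,
    both errors are of size [w]; the outer sum repeats the argument. *)
Lemma Asum_tri m : (0 < m)%N ->
  cabs (Asum h h' n om_tri m - L * L') <=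
  ((K + B) * harm R n + cabs L' * (K + B)) / Y%:R * m%:R.
Proof.
move=> m0; have mR : 0 < m%:R :> R by rewrite ltr0n.
(* The weight at [(m * x, m * y)] is [1 - w * (x + y)], and [Y * Y <= n] gives [w <= m / Y]. *)
pose w : R := m%:R * Y%:R / n%:R.
have w0 : 0 < w by rewrite divr_gt0 ?mulr_gt0.
have mY0 : (0 < m * Y)%N by rewrite muln_gt0 m0.
have wle : w <= m%:R / Y%:R.
  rewrite ler_pdivrMr // mulrAC ler_pdivlMr // -mulrA ler_wpM2l ?ler0n // -natrM ler_nat //.
have KB0 : 0 <= K + B by rewrite addr_ge0.
have H0 : 0 <= harm R n by exact: harm_ge0.
suff main : cabs (Asum h h' n om_tri m - L * L') <= ((K + B) * harm R n + cabs L' * (K + B)) * w.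
  apply: (le_trans main); rewrite -[leRHS]mulrA [_^-1 * _]mulrC; apply: ler_wpM2l => //.
  by rewrite addr_ge0 ?mulr_ge0 ?cabs_ge0.
pose P0 x := (m * x * Y < n)%N.
have P0d x y : (x <= y)%N -> P0 y -> P0 x.
  by move=> xy; apply: leq_ltn_trans; rewrite leq_mul2r leq_mul2l xy !orbT.
have [N0 [_ [P0in P0out]] eN0] := sum_initial n P0d.
(* [sum_initial] leaves open that the cut is not reached before [n]; this is impossible since
   [n * (m * Y) >= n]. *)
have big_fail N (P : pred nat) : (P n -> (n * (m * Y) < n)%N) -> (forall x, (0 < x <= N)%N -> P x) ->
    (N = n \/ ~~ P N.+1) -> ~~ P N.+1.
  move=> Pn Pin [e|//]; exfalso; have : P n by apply: Pin; rewrite e n0 leqnn.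
  by move/Pn; rewrite ltnNge leq_pmulr.
have outw N x : ~~ ((m * x + m * N.+1) * Y < n)%N -> 1 <= w * (x%:R + N.+1%:R).
  rewrite -leqNgt => le; rewrite /w mulrAC ler_pdivlMr // mul1r.
  rewrite -natrD -!natrM ler_nat (leq_trans le) //; nia.
have N0w : N0.+1%:R^-1 <= w.
  have := @outw N0 0; rewrite muln0 add0n add0r => h1.
  rewrite -[leLHS]mul1r ler_pdivrMr ?ltr0n //; apply: h1.
  apply: (big_fail N0 P0) => //.
  by rewrite /P0 [(m * n)%N]mulnC mulnA.
pose S x := \sum_(1 <= y < n.+1) wterm h h' x y * (om_tri (m * x)%N (m * y)%N)%:C.
have S0 x : ~~ P0 x -> S x = 0.
  move=> nP; rewrite /S big1 // => y _; rewrite /om_tri ifF ?mulr0 //.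
  apply: contraNF nP; apply: leq_ltn_trans.
  by rewrite mulnDl leq_addr.
have Sx x : (0 < x <= N0)%N ->
    cabs (S x - h x / x%:R * ((1 - w * x%:R)%:C * L')) <= x%:R^-1 * ((K + B) * w).
  move=> xN; have /andP[x0 _] := xN; have Px := P0in x xN.
  have xR : 0 < x%:R :> R by rewrite ltr0n.
  have wx : 0 < 1 - w * x%:R.
    rewrite subr_gt0 /w mulrAC ltr_pdivrMr // mul1r -!natrM ltr_nat.
    by move: Px; rewrite /P0 mulnAC.
  pose P y := ((m * x + m * y) * Y < n)%N.
  have Pd y z : (y <= z)%N -> P z -> P y.
    by move=> yz; apply: leq_ltn_trans; rewrite leq_mul2r leq_add2l leq_mul2l yz !orbT.
  have [N [_ [Pin Pout]] eN] := sum_initial n Pd.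
  (* At [N + 1] the weight is no longer positive, so [1 - w * x <= w * (N + 1)]: a short partial sum
     has a large tail but carries a small weight. *)
  have Nw : (1 - w * x%:R) / N.+1%:R <= w.
    have NP : ~~ P N.+1.
      apply: (big_fail N P) => // h1; apply: leq_ltn_trans h1.
      by rewrite mulnDl (leq_trans _ (leq_addl _ _)) // mulnCA mulnA.
    have := outw N x NP; rewrite mulrDr ler_pdivrMr ?ltr0n //; lra.
  have -> : S x = h x / x%:R * ((1 - w * x%:R)%:C * \sum_(1 <= y < N.+1) h' y / y%:R
       - w%:C * \sum_(1 <= y < N.+1) h' y).
    rewrite /S.
    transitivity (\sum_(1 <= y < n.+1 | true && P y) wterm h h' x y * (1 - w * (x%:R + y%:R))%:C).
      rewrite [RHS]big_mkcond; apply: eq_bigr => y _; rewrite /om_tri /= /P.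
      case: ifP => _; last by rewrite mulr0.
      congr (_ * _%:C); rewrite natrD !natrM /w; congr (1 - _).
      by move: (n%:R^-1) => i; ring.
    rewrite eN !mulr_sumr -sumrB mulr_sumr big_nat_cond [RHS]big_nat_cond.
    apply: eq_bigr => y /andP[/andP[y0 _] _].
    have yC : y%:R != 0 :> R[i] by rewrite pnatr_eq0 -lt0n.
    have xC : x%:R != 0 :> R[i] by rewrite pnatr_eq0 -lt0n.
    have -> : (1 - w * (x%:R + y%:R))%:C = (1 - w * x%:R)%:C - w%:C * y%:R.
      rewrite mulrDr opprD addrA rmorphB; congr (_ - _).
      by rewrite rmorphM; congr (_ * _); rewrite rmorph_nat.
    by rewrite /wterm; move: (_%:C) (w%:C) => a b; field; rewrite yC xC.
  rewrite -mulrBr cabsM; apply: ler_pM; rewrite ?cabs_ge0 //.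
    by rewrite cabsM cabs_invn ler_piMl ?invr_ge0 ?ler0n.
  rewrite addrAC -mulrBr; apply: (le_trans (cabsB _ _)); rewrite mulrDl; apply: lerD.
    rewrite cabsM cabs_real gtr0_norm //.
    apply: (@le_trans _ _ ((1 - w * x%:R) * (K / N.+1%:R))); first by rewrite ler_wpM2l // ltW.
    by rewrite mulrCA ler_wpM2l.
  by rewrite cabsM cabs_real gtr0_norm // mulrC ler_wpM2r // ltW.
have -> : Asum h h' n om_tri m = \sum_(1 <= x < N0.+1) S x.
  rewrite -(eN0 _ predT) /= [RHS]big_mkcond; apply: eq_bigr => x _ /=.
  by case: ifP => // /negbT /S0.
have -> : \sum_(1 <= x < N0.+1) S x - L * L' =
   \sum_(1 <= x < N0.+1) (S x - h x / x%:R * ((1 - w * x%:R)%:C * L')) +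
   L' * ((\sum_(1 <= x < N0.+1) h x / x%:R - L) - w%:C * \sum_(1 <= x < N0.+1) h x).
  rewrite sumrB.
  have -> : \sum_(1 <= x < N0.+1) h x / x%:R * ((1 - w * x%:R)%:C * L') =
     L' * (\sum_(1 <= x < N0.+1) h x / x%:R - w%:C * \sum_(1 <= x < N0.+1) h x).
    rewrite mulr_sumr -sumrB mulr_sumr big_nat_cond [RHS]big_nat_cond.
    apply: eq_bigr => x /andP[/andP[x0 _] _].
    have xC : x%:R != 0 :> R[i] by rewrite pnatr_eq0 -lt0n.
    have -> : (1 - w * x%:R)%:C = 1 - w%:C * x%:R.
      rewrite rmorphB rmorph1; congr (_ - _).
      by rewrite rmorphM; congr (_ * _); rewrite rmorph_nat.
    by move: (w%:C) => b; field.
  ring.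
apply: (le_trans (cabsD _ _)); rewrite mulrDl; apply: lerD.
  apply: le_trans (cabs_sum_nat (G := fun x => x%:R^-1 * ((K + B) * w)) _) _ => [x /andP[x0 xN] _|].
    by apply: Sx; rewrite x0.
  rewrite -mulr_suml -/(harm R N0) mulrC mulrAC; apply: ler_wpM2r; first exact: ltW.
  apply: ler_wpM2l => //; apply: harm_le.
  have [->//|N00] := posnP N0.
  have : P0 N0 by apply: P0in; rewrite N00 leqnn.
  rewrite /P0 => h1; apply: ltnW; apply: leq_ltn_trans h1.
  by rewrite mulnAC leq_pmull.
rewrite cabsM -mulrA; apply: ler_wpM2l; first exact: cabs_ge0.
apply: (le_trans (cabsB _ _)); rewrite mulrDl; apply: lerD.
  by apply: (le_trans (hL _)); rewrite ler_wpM2l.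
by rewrite cabsM cabs_real gtr0_norm // mulrC ler_wpM2r // ltW.
Qed.

End Averages.

(** * The four ranges *)

(** [mc_sum] expresses that the character is not principal. *)
Record modchar (R : realType) (p : nat) (f : nat -> R[i]) : Prop := ModChar {
  mc1 : f 1 = 1;
  mcM : forall a b, f (a * b)%N = f a * f b;
  mc_mod : forall a, f a = f (a %% p)%N;
  mc0 : forall a, (p %| a)%N -> f a = 0;
  mc_norm : forall a, ~~ (p %| a)%N -> `|f a| = 1;
  mc_sum : \sum_(a < p) f a = 0 }.

Lemma lin_eq (F : fieldType) (x a c n : F) : x != 0 ->
  (x * a + c == n) = (a == (n - c) / x).
Proof.
move=> x0; apply/eqP/eqP => [<-|->]; first by rewrite addrK mulrAC mulfV // mul1r.
by rewrite mulrC divfK // subrK.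
Qed.

(** * Character sums along lines modulo [p] *)

Section LineMeans.
Variables (R : realType) (p : nat).
Hypothesis p_prime : prime p.

Lemma sum_Fp (V : nmodType) (F : nat -> V) : \sum_(i < p) F i = \sum_(a : 'F_p) F a.
Proof.
rewrite -(big_mkord predT F) -[in RHS](big_mkord predT F).
by rewrite Fp_cast.
Qed.

Lemma Fp_eqn (a b : nat) : (a%:R == b%:R :> 'F_p) = (a == b %[mod p])%N.
Proof. by rewrite -val_eqE /= !val_Fp_nat. Qed.

Lemma Fp_natr (a : 'F_p) : (a : nat)%:R = a.
Proof. exact: natr_Zp. Qed.

Lemma Fp_nat_eq0 (n : nat) : ((n%:R : 'F_p) == 0) = (p %| n)%N.
Proof. by rewrite (Fp_eqn n 0) mod0n. Qed.

Lemma sum_line_Fp (F G : nat -> R[i]) (x y n : nat) :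
  \sum_(u < p) \sum_(v < p | (x * u + y * v == n %[mod p])%N) F u * G v =
  \sum_(a : 'F_p) \sum_(b : 'F_p | x%:R * a + y%:R * b == n%:R) F a * G b.
Proof.
pose H u := \sum_(v < p | (x * u + y * v == n %[mod p])%N) F u * G v.
rewrite -[LHS]/(\sum_(u < p) H u) sum_Fp; apply: eq_bigr => a _; rewrite /H.
rewrite big_mkcond [RHS]big_mkcond /=.
rewrite (sum_Fp (fun v => if (x * a + y * v == n %[mod p])%N then F a * G v else 0)).
apply: eq_bigr => b _; rewrite -Fp_eqn natrD !natrM !Fp_natr //.
Qed.

Variables (f f' : nat -> R[i]).
Hypotheses (fc : modchar p f) (fc' : modchar p f').

Lemma mc_nat (k : nat -> R[i]) (kc : modchar p k) n : k n = k (n%:R : 'F_p).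
Proof. by rewrite (mc_mod kc) val_Fp_nat. Qed.

Lemma mcFM (k : nat -> R[i]) (kc : modchar p k) (a b : 'F_p) : k (a * b)%R = k a * k b.
Proof. by rewrite -(mcM kc) [RHS](mc_nat kc) natrM !Fp_natr. Qed.

Lemma mc_F0 (k : nat -> R[i]) (kc : modchar p k) : k (0 : 'F_p) = 0.
Proof. by apply: (mc0 kc); rewrite /= dvdn0. Qed.

Lemma mc_sumF (k : nat -> R[i]) (kc : modchar p k) : \sum_(a : 'F_p) k a = 0.
Proof. by rewrite -sum_Fp (mc_sum kc). Qed.

Lemma Fp_ndvd (a : 'F_p) : a != 0 -> ~~ (p %| a)%N.
Proof. by rewrite -{1}(Fp_natr a) Fp_nat_eq0. Qed.

Lemma mc_inv (k : nat -> R[i]) (kc : modchar p k) (a : 'F_p) : a != 0 -> k a^-1 = (k a)^*.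
Proof.
move=> a0; have e : k a * k a^-1 = 1.
  by rewrite -(mcFM kc) mulfV // -[1]/(1%:R) -(mc_nat kc) (mc1 kc).
have n1 := mc_norm kc (Fp_ndvd a0).
have ka0 : k a != 0 by rewrite -normr_eq0 n1 oner_eq0.
by apply: (mulfI ka0); rewrite e -normCK n1 expr1n.
Qed.

Lemma line_mean_count (x y n : nat) : ~~ (p %| x)%N ->
  \sum_(u < p) \sum_(v < p | (x * u + y * v == n %[mod p])%N) (1 : R[i]) = p%:R.
Proof.
move=> px; have x0 : (x%:R : 'F_p) != 0 by rewrite Fp_nat_eq0.
transitivity (\sum_(u < p) \sum_(v < p | (x * u + y * v == n %[mod p])%N) (1 * 1 : R[i])).
  by apply: eq_bigr => u _; apply: eq_bigr => v _; rewrite mulr1.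
rewrite (sum_line_Fp (fun=> 1) (fun=> 1)).
under eq_bigr => a _ do rewrite big_mkcond.
rewrite exchange_big /= (eq_bigr (fun=> 1)) => [|b _].
  by rewrite sumr_const card_Fp.
rewrite -big_mkcond (big_pred1 ((n%:R - y%:R * b) / x%:R)) ?mulr1 // => a /=.
exact: lin_eq.
Qed.

Lemma line_mean_one (x y n : nat) : ~~ (p %| x)%N ->
  \sum_(u < p) \sum_(v < p | (x * u + y * v == n %[mod p])%N) f' v = 0.
Proof.
move=> px; have x0 : (x%:R : 'F_p) != 0 by rewrite Fp_nat_eq0.
transitivity (\sum_(u < p) \sum_(v < p | (x * u + y * v == n %[mod p])%N) (1 * f' v)).
  by apply: eq_bigr => u _; apply: eq_bigr => v _; rewrite mul1r.
rewrite (sum_line_Fp (fun=> 1) f').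
under eq_bigr => a _ do rewrite big_mkcond.
rewrite exchange_big /= (eq_bigr (fun b : 'F_p => f' b)) => [|b _]; first exact: mc_sumF.
rewrite -big_mkcond (big_pred1 ((n%:R - y%:R * b) / x%:R)) ?mul1r // => a /=.
exact: lin_eq.
Qed.

Definition jac : R[i] := jacobi (fun a : 'F_p => f a) (fun a : 'F_p => f' a).

(** Solving for one variable and rescaling the other by [N / Y] gives the Jacobi sum. When [p]
    divides [x] or [y] both sides are zero: the line is empty or one character runs over a complete
    sum. *)
Lemma line_mean_jac (x y n : nat) : ~~ (p %| n)%N ->
  \sum_(u < p) \sum_(v < p | (x * u + y * v == n %[mod p])%N) f u * f' v =
  (f x)^* * (f' y)^* * (f n * f' n * jac).
Proof.
move=> pn; rewrite sum_line_Fp (mc_nat fc x) (mc_nat fc' y) (mc_nat fc n) (mc_nat fc' n).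
have n0 : (n%:R : 'F_p) != 0 by rewrite Fp_nat_eq0.
move: (x%:R : 'F_p) (y%:R : 'F_p) (n%:R : 'F_p) n0 => X Y N N0.
have [->|X0] := eqVneq X 0.
  rewrite (mc_F0 fc) conjC0 !mul0r.
  have [->|Y0] := eqVneq Y 0.
    rewrite big1 // => a _; rewrite big_pred0 // => b; rewrite !mul0r addr0 eq_sym.
    exact: negbTE.
  rewrite (eq_bigr (fun a : 'F_p => f a * f' (N / Y))) => [|a _].
    by rewrite -mulr_suml (mc_sumF fc) mul0r.
  rewrite (big_pred1 (N / Y)) // => b /=.
  by rewrite mul0r addrC lin_eq // subr0.
under eq_bigr => a _ do rewrite big_mkcond.
rewrite exchange_big /= (eq_bigr (fun b : 'F_p => f ((N - Y * b) / X)%R * f' b)) => [|b _]; last first.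
  rewrite -big_mkcond (big_pred1 ((N - Y * b) / X)) // => a /=.
  exact: lin_eq.
have [->|Y0] := eqVneq Y 0.
  rewrite (mc_F0 fc') conjC0 mulr0 !mul0r.
  under eq_bigr => b _ do rewrite mul0r subr0.
  by rewrite -mulr_sumr (mc_sumF fc') mulr0.
have NY0 : N / Y != 0 by rewrite mulf_neq0 ?invr_eq0.
rewrite (reindex_inj (mulfI NY0)).
rewrite (eq_bigr (fun s : 'F_p => f N * (f X)^* * (f' N * (f' Y)^*) * (f (1 - s)%R * f' s))); last first.
  move=> s _; have -> : (N - Y * (N / Y * s)) / X = N * X^-1 * (1 - s).
    by field; rewrite X0 Y0.
  rewrite !(mcFM fc) !(mcFM fc') (mc_inv fc X0) (mc_inv fc' Y0).
  by ring.
have eJ : \sum_(s : 'F_p) f (1 - s)%R * f' s = jac.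
  by rewrite /jac /jacobi (reindex_inj (subrI 1)); apply: eq_bigr => s _; rewrite subKr.
by rewrite -mulr_sumr eJ; ring.
Qed.

End LineMeans.

Section FourCases.
Variables (R : realType) (n Y : nat) (f f' : nat -> R[i]).
Hypothesis Y_gt0 : (0 < Y)%N.

(* In [a * b + c * d = n] the roles of [(x, y, u, v)] are played by [(a, c, b, d)],
   [(a, d, b, c)], [(c, b, d, a)] and [(b, d, a, c)] respectively. *)
Definition Wi (x y u v : nat) : R[i] := f x * f' y.
Definition Wii (x y u v : nat) : R[i] := f x * f' v.
Definition Wiii (x y u v : nat) : R[i] := f' x * f v.
Definition Wiv (x y u v : nat) : R[i] := f u * f' v.

Definition quadruples : R[i] :=
  \sum_(1 <= a < n.+1) \sum_(1 <= b < n.+1) \sum_(1 <= c < n.+1)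
    \sum_(1 <= d < n.+1 | (a * b + c * d == n)%N) f a * f' c.

Let sum4 (C : nat -> nat -> nat -> nat -> bool) : R[i] :=
  \sum_(1 <= a < n.+1) \sum_(1 <= b < n.+1) \sum_(1 <= c < n.+1) \sum_(1 <= d < n.+1)
    if (a * b + c * d == n)%N && C a b c d then f a * f' c else 0.

Lemma small_cofactor y v w : (y * v + w = n)%N -> (Y < v)%N -> (y <= n %/ Y)%N.
Proof.
move=> e Yv; rewrite leq_divRL // -e (leq_trans _ (leq_addr _ _)) // leq_mul2l.
by rewrite (ltnW Yv) orbT.
Qed.

Lemma quad_sum_i : quad_sum Wi n 0 0 Y Y = sum4 (fun a b c d => (a <= Y)%N && (c <= Y)%N).
Proof.
rewrite /quad_sum /sum4; apply: eq_bigr => a _; rewrite exchange_big /=.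
apply: eq_bigr => c _; case: ifP => h; last first.
  by rewrite big1 // => b _; rewrite big1 // => d _; rewrite andbF.
rewrite big_nat_cond [RHS]big_nat_cond; apply: eq_bigr => b /andP[/andP[b0 _] _].
rewrite big_mkcond big_nat_cond [RHS]big_nat_cond; apply: eq_bigr => d /andP[/andP[d0 _] _].
by rewrite b0 d0 /= andbT.
Qed.

Lemma quad_sum_ii : quad_sum Wii n 0 Y Y (n %/ Y)%N = sum4 (fun a b c d => (a <= Y)%N && (Y < c)%N).
Proof.
rewrite /quad_sum /sum4; apply: eq_bigr => a _.
transitivity (\sum_(1 <= d < n.+1) \sum_(1 <= b < n.+1) \sum_(1 <= c < n.+1)
  if (a * b + c * d == n)%N && ((a <= Y)%N && (Y < c)%N) then f a * f' c else 0).
  apply: eq_bigr => d _; case: ifP => h; last first.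
    rewrite big1 // => b _; rewrite big1 // => c _; case: ifP => // /and3P[/eqP e aY Yc].
    have h2 : (d <= n %/ Y)%N.
      by apply: (small_cofactor (v := c) (w := (a * b)%N)) => //; rewrite -e [(d * c)%N]mulnC addnC.
    by move: h; rewrite aY h2.
  have /andP[aY _] := h.
  rewrite big_nat_cond [RHS]big_nat_cond; apply: eq_bigr => b /andP[/andP[b0 _] _].
  by rewrite big_mkcond; apply: eq_bigr => c _; rewrite b0 aY /= [(d * c)%N]mulnC andbC.
rewrite exchange_big /=; apply: eq_bigr => b _; exact: exchange_big.
Qed.

Lemma quad_sum_iii : quad_sum Wiii n 0 Y Y (n %/ Y)%N = sum4 (fun a b c d => (Y < a)%N && (c <= Y)%N).
Proof.
rewrite /quad_sum /sum4.
transitivity (\sum_(1 <= c < n.+1) \sum_(1 <= b < n.+1) \sum_(1 <= d < n.+1) \sum_(1 <= a < n.+1)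
  if (a * b + c * d == n)%N && ((Y < a)%N && (c <= Y)%N) then f a * f' c else 0).
  apply: eq_bigr => c _; apply: eq_bigr => b _; case: ifP => h; last first.
    rewrite big1 // => d _; rewrite big1 // => a _; case: ifP => // /and3P[/eqP e Ya cY].
    have h1 : (b <= n %/ Y)%N.
      by apply: (small_cofactor (v := a) (w := (c * d)%N)) => //; rewrite -e [(b * a)%N]mulnC.
    by move: h; rewrite cY h1.
  have /andP[cY _] := h.
  rewrite big_nat_cond [RHS]big_nat_cond; apply: eq_bigr => d /andP[/andP[d0 _] _].
  rewrite big_mkcond; apply: eq_bigr => a _; rewrite d0 cY /= andbT [(b * a)%N]mulnC addnC andbC.
  by rewrite /Wiii mulrC.
rewrite exchange_big /=.
under eq_bigr => b _ do (under eq_bigr => c _ do rewrite exchange_big /=).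
under eq_bigr => b _ do rewrite exchange_big /=.
by rewrite exchange_big.
Qed.

Lemma quad_sum_iv : quad_sum Wiv n Y Y (n %/ Y)%N (n %/ Y)%N = sum4 (fun a b c d => (Y < a)%N && (Y < c)%N).
Proof.
rewrite /quad_sum /sum4.
transitivity (\sum_(1 <= b < n.+1) \sum_(1 <= d < n.+1) \sum_(1 <= a < n.+1) \sum_(1 <= c < n.+1)
  if (a * b + c * d == n)%N && ((Y < a)%N && (Y < c)%N) then f a * f' c else 0).
  apply: eq_bigr => b _; apply: eq_bigr => d _; case: ifP => h; last first.
    rewrite big1 // => a _; rewrite big1 // => c _; case: ifP => // /and3P[/eqP e Ya Yc].
    have h1 : (b <= n %/ Y)%N.
      by apply: (small_cofactor (v := a) (w := (c * d)%N)) => //; rewrite -e [(b * a)%N]mulnC.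
    have h2 : (d <= n %/ Y)%N.
      by apply: (small_cofactor (v := c) (w := (a * b)%N)) => //; rewrite -e [(d * c)%N]mulnC addnC.
    by move: h; rewrite h1 h2.
  apply: eq_bigr => a _; rewrite big_mkcond; apply: eq_bigr => c _.
  by rewrite [(b * a)%N]mulnC [(d * c)%N]mulnC andbA andbC.
under eq_bigr => b _ do rewrite exchange_big /=.
rewrite exchange_big /=; apply: eq_bigr => a _; apply: eq_bigr => b _; exact: exchange_big.
Qed.

Lemma quadruples_split : quadruples =
  quad_sum Wi n 0 0 Y Y + quad_sum Wii n 0 Y Y (n %/ Y)%N
  + quad_sum Wiii n 0 Y Y (n %/ Y)%N + quad_sum Wiv n Y Y (n %/ Y)%N (n %/ Y)%N.
Proof.
rewrite quad_sum_i quad_sum_ii quad_sum_iii quad_sum_iv /sum4 -!big_split.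
apply: eq_bigr => a _; rewrite -!big_split; apply: eq_bigr => b _.
rewrite -!big_split; apply: eq_bigr => c _; rewrite -!big_split big_mkcond; apply: eq_bigr => d _ /=.
case: (_ == n)%N => /=; last by rewrite !addr0.
by case: (leqP a Y) => _; case: (leqP c Y) => _ /=; rewrite ?addr0 ?add0r.
Qed.

Lemma quadruples_conv :
  quadruples = \sum_(1 <= j < n) (\sum_(a <- divisors j) f a) * (\sum_(c <- divisors (n - j)) f' c).
Proof.
have dv (k : nat -> R[i]) j : (0 < j <= n)%N ->
    \sum_(a <- divisors j) k a = \sum_(1 <= a < n.+1) \sum_(1 <= b < n.+1) if (a * b == j)%N then k a else 0.
  move=> /andP[j0 jn]; rewrite sum_divisors // [LHS](big_nat_widen _ _ n.+1) //= [LHS]big_mkcond.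
  rewrite big_nat_cond [RHS]big_nat_cond; apply: eq_bigr => a /andP[/andP[a0 _] _].
  case: ifP => [/andP[aj _]|nd]; last first.
    rewrite big_nat_cond big1 // => b /andP[/andP[b0 _] _]; case: eqP => // e.
    by move: nd; rewrite -e dvdn_mulr // ltnS leq_pmulr.
  have ej : j = (a * (j %/ a))%N by rewrite mulnC divnK.
  rewrite (bigD1_seq (j %/ a)%N) ?iota_uniq //=; last first.
    by rewrite mem_index_iota divn_gt0 // dvdn_leq //= ltnS (leq_trans (leq_div _ _)).
  rewrite -ej eqxx big1 ?addr0 // => b nb; case: eqP => // e.
  by case/eqP: nb; rewrite -e mulKn.
transitivity (\sum_(1 <= j < n) \sum_(1 <= a < n.+1) \sum_(1 <= b < n.+1) \sum_(1 <= c < n.+1) \sum_(1 <= d < n.+1)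
   if (a * b == j)%N && (c * d == n - j)%N then f a * f' c else 0); last first.
  rewrite big_nat_cond [RHS]big_nat_cond; apply: eq_bigr => j /andP[/andP[j0 jn] _].
  rewrite !dv ?j0 ?(ltnW jn) ?subn_gt0 ?jn ?leq_subr // mulr_suml; apply: eq_bigr => a _.
  rewrite mulr_suml; apply: eq_bigr => b _; rewrite mulr_sumr; apply: eq_bigr => c _.
  rewrite mulr_sumr; apply: eq_bigr => d _.
  by case: (_ == j)%N; case: (_ == _)%N; rewrite /= ?mulr0 ?mul0r.
rewrite /quadruples [RHS]exchange_big [LHS]big_nat_cond [RHS]big_nat_cond; apply: eq_bigr => a /andP[/andP[a0 _] _].
rewrite [RHS]exchange_big [LHS]big_nat_cond [RHS]big_nat_cond; apply: eq_bigr => b /andP[/andP[b0 _] _].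
rewrite [RHS]exchange_big [LHS]big_nat_cond [RHS]big_nat_cond; apply: eq_bigr => c /andP[/andP[c0 _] _].
rewrite [RHS]exchange_big [LHS]big_mkcond [LHS]big_nat_cond [RHS]big_nat_cond; apply: eq_bigr => d /andP[/andP[d0 _] _].
have ab0 : (0 < a * b)%N by rewrite muln_gt0 a0.
have cd0 : (0 < c * d)%N by rewrite muln_gt0 c0.
case: eqP => [e|ne]; last first.
  rewrite big_nat_cond big1 // => j /andP[/andP[_ jn] _]; case: ifP => // /andP[/eqP e1 /eqP e2].
  by case: ne; rewrite e1 e2 subnKC // ltnW.
rewrite (bigD1_seq (a * b)%N) ?iota_uniq //=; last first.
  by rewrite mem_index_iota ab0 -e -{1}[(a * b)%N]addn0 ltn_add2l.
rewrite eqxx -{1}e addKn eqxx /= big1 ?addr0 // => j nj.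
by rewrite eq_sym (negPf nj).
Qed.

End FourCases.

Section MainTerms.
Variables (R : realType) (p n Y : nat) (f f' : nat -> R[i]).
Hypothesis p_prime : prime p.
Hypotheses (fc : modchar p f) (fc' : modchar p f').
Hypothesis Y_gt0 : (0 < Y)%N.
Hypothesis Yn : (Y * Y <= n)%N.
Hypothesis pn : ~~ (p %| n)%N.

Let n0 : (0 < n)%N. Proof. by apply: leq_trans Yn; rewrite muln_gt0 Y_gt0. Qed.
Let pC : p%:R != 0 :> R[i]. Proof. by rewrite pnatr_eq0 -lt0n prime_gt0. Qed.

(** If [p] does not divide [x], the residue of [v] is free on the line and [k'] sums to zero;
    otherwise [k (g * x)] is zero. *)
Lemma quad_main_ii (k k' : nat -> R[i]) U V X1 X2 : modchar p k -> modchar p k' ->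
  quad_main p (fun x y u v => k x * k' v) n U V X1 X2 = 0.
Proof.
move=> kc kc'; rewrite /quad_main big1 // => g _; rewrite big1 // => x _; rewrite big1 // => y _.
rewrite /line_mean; apply/eqP; rewrite mulf_eq0; apply/orP; right; apply/eqP.
under eq_bigr => u _ do rewrite -mulr_sumr.
rewrite -mulr_sumr; have [px|px] := boolP (p %| g * x)%N; first by rewrite (mc0 kc) ?mul0r.
rewrite line_mean_one ?mulr0 //; apply: contra px; exact: dvdn_mull.
Qed.

Lemma quad_main_i : quad_main p (Wi f f') n 0 0 Y Y =
  n%:R * \sum_(1 <= g < n.+1 | (g %| n)%N) hh f f' g / g%:R * Tsum f f' n (om_box R Y) g.
Proof.
rewrite /quad_main mulr_sumr big_nat_cond [RHS]big_nat_cond; apply: eq_bigr => g /andP[/andP[g0 _] gn].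
rewrite /Tsum !mulr_sumr big_nat_cond [RHS]big_nat_cond; apply: eq_bigr => x /andP[/andP[x0 _] _].
rewrite !mulr_sumr [LHS]big_mkcond [RHS]big_mkcond big_nat_cond [RHS]big_nat_cond; apply: eq_bigr => y /andP[/andP[y0 _] _].
have n'0 : (0 < n %/ g)%N by rewrite divn_gt0 // dvdn_leq.
rewrite /region !muln0 addn0 n'0 andbT !leq_divRL // ![(_ * g)%N]mulnC /om_box.
case: (boolP (coprime x y)) => cxy; last by rewrite !andbF.
rewrite andbT; case: (_ && _); last by rewrite !mulr0.
rewrite /= mulr1 !mulr0 !subr0.
have gC : g%:R != 0 :> R[i] by rewrite pnatr_eq0 -lt0n.
have xC : x%:R != 0 :> R[i] by rewrite pnatr_eq0 -lt0n.
have yC : y%:R != 0 :> R[i] by rewrite pnatr_eq0 -lt0n.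
have -> : (n %/ g)%N%:R = n%:R / g%:R :> R[i].
  by rewrite -{2}(divnK gn) natrM mulfK.
have -> : line_mean p (Wi f f') (n %/ g) g x y = p%:R * (f (g * x)%N * f' (g * y)%N).
  rewrite /line_mean /Wi; have [px|px] := boolP (p %| x)%N.
    by rewrite (mc0 fc) ?dvdn_mull // !mul0r mulr0 big1 // => u _; rewrite big1 // => v _; rewrite mul0r.
  rewrite -(line_mean_count R p_prime y (n %/ g) px) mulr_suml; apply: eq_bigr => u _.
  by rewrite mulr_suml; apply: eq_bigr => v _; rewrite mul1r.
rewrite (mcM fc) (mcM fc') /hh /wterm.
by field; rewrite gC xC yC pC.
Qed.

Definition thc (k : nat -> R[i]) a : R[i] := (k a)^*.

(** [line_mean_jac] puts conjugate characters on the small variables, so the L-series here are those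
    of [thc f] and [thc f']. *)
Lemma quad_main_iv : quad_main p (Wiv f f') n Y Y (n %/ Y)%N (n %/ Y)%N =
  f n * f' n * (jac p f f' / p%:R) *
  (n%:R * \sum_(1 <= g < n.+1 | (g %| n)%N) hh (thc f) (thc f') g / g%:R * Tsum (thc f) (thc f') n (om_tri R n Y) g).
Proof.
rewrite /quad_main !mulr_sumr big_nat_cond [RHS]big_nat_cond; apply: eq_bigr => g /andP[/andP[g0 _] gn].
rewrite /Tsum !mulr_sumr big_nat_cond [RHS]big_nat_cond; apply: eq_bigr => x /andP[/andP[x0 _] _].
rewrite !mulr_sumr [LHS]big_mkcond [RHS]big_mkcond big_nat_cond [RHS]big_nat_cond; apply: eq_bigr => y /andP[/andP[y0 _] _].
have n'0 : (0 < n %/ g)%N by rewrite divn_gt0 // dvdn_leq.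
have gC : g%:R != 0 :> R[i] by rewrite pnatr_eq0 -lt0n.
have xC : x%:R != 0 :> R[i] by rewrite pnatr_eq0 -lt0n.
have yC : y%:R != 0 :> R[i] by rewrite pnatr_eq0 -lt0n.
have nC : n%:R != 0 :> R[i] by rewrite pnatr_eq0 -lt0n.
have pg : ~~ (p %| g)%N by apply: contra pn => h; exact: dvdn_trans h gn.
have en : n = (g * (n %/ g))%N by rewrite mulnC divnK.
have pn' : ~~ (p %| n %/ g)%N by apply: contra pn => h; rewrite en dvdn_mull.
have reg : region (n %/ g) Y Y (n %/ Y %/ g) (n %/ Y %/ g) x y = coprime x y && ((g * x + g * y) * Y < n)%N.
  have e1 : ((g * x + g * y) * Y < n)%N = (x * Y + y * Y < n %/ g)%N.
    by rewrite -mulnDl -mulnDr {1}en -mulnA ltn_pmul2l.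
  rewrite /region -e1; case: (boolP (coprime x y)) => cxy /=; last by rewrite !andbF.
  case: ltnP => [lt|_]; last by rewrite !andbF.
  rewrite !andbT !leq_divRL // [(x * g)%N]mulnC [(y * g)%N]mulnC; apply/andP; split.
    by apply: ltnW; apply: leq_ltn_trans lt; rewrite mulnDl leq_addr.
  by apply: ltnW; apply: leq_ltn_trans lt; rewrite mulnDl leq_addl.
rewrite reg /om_tri; case: (coprime x y) => //=; case: ifP => _; last by rewrite !mulr0.
have -> : line_mean p (Wiv f f') (n %/ g) g x y = thc f x * thc f' y * (f (n %/ g)%N * f' (n %/ g)%N * jac p f f').
  by rewrite /line_mean /Wiv line_mean_jac.
have fn : f n = f g * f (n %/ g)%N by rewrite {1}en (mcM fc).
have fn' : f' n = f' g * f' (n %/ g)%N by rewrite {1}en (mcM fc').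
have tg : f g * thc f g = 1 by rewrite /thc -normCK (mc_norm fc pg) expr1n.
have tg' : f' g * thc f' g = 1 by rewrite /thc -normCK (mc_norm fc' pg) expr1n.
have -> : (n %/ g)%N%:R = n%:R / g%:R :> R[i].
  by rewrite -{2}(divnK gn) natrM mulfK.
have -> : (1 - (g * x + g * y)%N%:R * Y%:R / n%:R : R)%:C = 1 - (g%:R * x%:R + g%:R * y%:R) * Y%:R / n%:R.
  by rewrite rmorphB rmorph1; congr (_ - _); rewrite !rmorphM fmorphV !rmorph_nat natrD !natrM.
rewrite fn fn' /hh /wterm.
(* The inserted factors are [1] because [g] divides [n] and so is prime to [p]; they complete the
   values at [n %/ g] to [f n * f' n]. *)
transitivity ((f g * thc f g) * (f' g * thc f' g) * ((n%:R / g%:R - x%:R * Y%:R - y%:R * Y%:R) / (x%:R * y%:R * p%:R) *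
  (thc f x * thc f' y * (f (n %/ g)%N * f' (n %/ g)%N * jac p f f')))); first by rewrite tg tg' !mul1r.
move: (jac p f f') (f (n %/ g)%N) (f' (n %/ g)%N) (thc f x) (thc f' y) (thc f g) (thc f' g) => A1 A2 A3 A4 A5 A6 A7.
by field; rewrite gC xC yC pC nC.
Qed.

End MainTerms.

(** * The asymptotic formula *)

Section Scales.
Variable R : realType.

Lemma harm_half N : harm R N <= harm R N./2 + 1.
Proof.
have le : (N./2 <= N)%N by rewrite -{2}(odd_double_half N) -addnn; lia.
rewrite /harm (big_cat_nat (n := N./2.+1)) //= lerD2l.
apply: (@le_trans _ _ (\sum_(N./2.+1 <= k < N.+1) (N./2.+1)%:R^-1)).
  rewrite big_nat_cond [leRHS]big_nat_cond; apply: ler_sum => k /andP[/andP[h _] _].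
  by rewrite lef_pV2 ?posrE ?ltr0n ?ler_nat // (leq_trans _ h).
rewrite sumr_const_nat -[_ *+ _]mulr_natl ler_pdivrMr ?ltr0n // mul1r ler_nat.
have := odd_double_half N; rewrite -addnn; case: (odd N); lia.
Qed.

Lemma harm_log k N : (N < 2 ^ k)%N -> harm R N <= k%:R.
Proof.
elim: k N => [|k IH] N; first by rewrite expn0 ltnS leqn0 => /eqP ->; rewrite /harm big_geq.
move=> h; apply: (le_trans (harm_half N)); rewrite -natr1 lerD2r; apply: IH.
by move: h (odd_double_half N); rewrite expnS; clear; lia.
Qed.

(* [numdiv (2 ^ t) = t + 1], so the divisor bound also bounds logarithms. *)
Lemma harm_bound k : exists2 C, (0 < C)%N & forall N, (0 < N)%N -> harm R N ^+ k <= (C * N)%:R.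
Proof.
have [C C0 hC] := numdiv_bound k; exists C => // N N0.
have /andP[lo hi] := @trunc_log_bounds 2 N isT N0; set t := trunc_log 2 N in lo hi.
have e : numdiv (2 ^ t) = t.+1.
  have := @numdiv_pfactor 2 t 1 isT isT; rewrite coprimen1 muln1 => -> //.
  by rewrite /numdiv muln1.
have h : harm R N ^+ k <= (numdiv (2 ^ t) ^ k)%:R.
  by rewrite e natrX; apply: lerXn2r; rewrite ?nnegrE ?harm_ge0 ?ler0n // harm_log.
apply: (le_trans h); rewrite ler_nat (leq_trans (hC _ _)) ?expn_gt0 //.
by rewrite leq_mul2l lo orbT.
Qed.

(** As [c >= 1], it may replace its own root of order [k], so constants never need roots. *)
Lemma root_bound (x c w : R) k : (0 < k)%N -> 0 <= x -> 1 <= c -> 0 <= w ->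
  x ^+ k <= c * w ^+ k -> x <= c * w.
Proof.
move=> k0 x0 c1 w0 h; have c0 : 0 <= c by apply: le_trans c1.
have cw : 0 <= c * w by rewrite mulr_ge0.
rewrite -(ler_pXn2r k0) ?nnegrE // (le_trans h) // exprMn ler_wpM2r ?exprn_ge0 //.
by rewrite -{1}[c]expr1 ler_weXn2l.
Qed.

(* With [w = n ^ (1/128)] every error term is a power of [w], and [numdiv] and
   [harm] are [O(w)]. *)
Record scale (n Y : nat) (w : R) : Prop := Scale {
  sc_w : 1 <= w;
  sc_n : w ^+ 128 = n%:R;
  sc_Y0 : (0 < Y)%N;
  sc_YY : (Y * Y <= n)%N;
  sc_Yw : Y%:R <= w ^+ 64;
  sc_wY : w ^+ 64 <= 2 * Y%:R }.

Lemma scale_ex n (w : R) : 1 <= w -> w ^+ 128 = n%:R -> exists Y, scale n Y w.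
Proof.
move=> w1 e; have W1 : 1 <= w ^+ 64 by rewrite exprn_ege1.
have W0 : 0 <= w ^+ 64 by apply: le_trans W1.
pose Y := Num.truncn (w ^+ 64); have /andP[lo hi] := truncn_itv W0.
have Y0 : (0 < Y)%N by rewrite -ltnS -(ltr_nat R); apply: le_lt_trans hi.
exists Y; split => //.
  rewrite -(ler_nat R) -e natrM (_ : 128 = 64 + 64)%N // exprD.
  by apply: ler_pM.
apply: (le_trans (ltW hi)); rewrite -natrM ler_nat -/Y; lia.
Qed.

Lemma scale_w n : (0 < n)%N -> exists2 w : R, 1 <= w & w ^+ 128 = n%:R.
Proof.
move=> n0; exists (n%:R `^ (128%:R^-1)).
  by rewrite -{1}(powRr0 n%:R); apply: ler_powR; rewrite ?invr_ge0 ?ler0n ?ler1n.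
by rewrite -powR_mulrn ?powR_ge0 // -powRrM mulVf ?pnatr_eq0 // powRr1 ?ler0n.
Qed.

(** Thus cofactors of large variables, which are at most [n %/ Y], fit into the common range
    [Q = 4 * Y]. *)
Lemma scale_div n Y w : scale n Y w -> (n %/ Y <= 4 * Y)%N.
Proof.
move=> [w1 e Y0 YY Yw wY]; apply: (@leq_trans (4 * Y * Y %/ Y)); last by rewrite mulnK.
apply: leq_div2r; rewrite -(ler_nat R) -e !natrM (_ : 128 = 64 + 64)%N // exprD.
have -> : 4 * Y%:R * Y%:R = (2 * Y%:R) * (2 * Y%:R) :> R by ring.
by apply: ler_pM => //; rewrite exprn_ge0 // (le_trans ler01).
Qed.

Lemma small_bounds : exists2 c : R, 1 <= c & forall n Y w, scale n Y w ->
  (numdiv n)%:R <= c * w /\ harm R n <= c * w.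
Proof.
have [C C0 hC] := numdiv_bound 128; have [C' C'0 hC'] := harm_bound 128.
have c1 : 1 <= (C * C')%N%:R :> R by rewrite ler1n muln_gt0 C0.
exists (C * C')%N%:R => // n Y w [w1 e Y0 YY _ _].
have n0 : (0 < n)%N by apply: leq_trans YY; rewrite muln_gt0 Y0.
have w0 : 0 <= w by apply: le_trans w1.
split; apply: (@root_bound _ _ _ 128) => //; rewrite ?harm_ge0 //.
  rewrite e -natrX -natrM ler_nat (leq_trans (hC _ n0)) // leq_mul2r leq_pmulr ?orbT //.
rewrite e; apply: (le_trans (hC' _ n0)); rewrite -natrM ler_nat leq_mul2r leq_pmull ?orbT //.
Qed.

Definition max_numdiv m := (\max_(k < m.+1) numdiv k)%N.

Lemma max_numdivP m k : (k <= m)%N -> (numdiv k <= max_numdiv m)%N.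
Proof. by move=> h; rewrite -ltnS in h; exact: (leq_bigmax (Ordinal h)). Qed.

Lemma max_numdiv_bound k : exists2 C, (0 < C)%N & forall m, (0 < m)%N -> (max_numdiv m ^ k.+1 <= C * m)%N.
Proof.
have [C C0 hC] := numdiv_bound k.+1; exists C => // m m0; rewrite /max_numdiv.
elim/big_ind: _ => [|x y hx hy|i _]; first by rewrite exp0n.
  by case: (leqP x y) => _.
have [->|i0] := posnP i; first by rewrite /numdiv exp1n muln_gt0 C0.
by apply: (leq_trans (hC _ i0)); rewrite leq_mul2l -ltnS ltn_ord orbT.
Qed.

Lemma medium_bounds p : (0 < p)%N -> exists2 c : R, 1 <= c & forall n Y w, scale n Y w ->
  [/\ (max_numdiv (p * (4 * Y)))%:R <= c * w, harm R (p * (4 * Y)) <= c * w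
    & pow34 ((p * (4 * Y))%N%:R) <= c * w ^+ 48].
Proof.
move=> p0; have [C C0 hC] := max_numdiv_bound 127; have [C' C'0 hC'] := harm_bound 128.
pose M := (4 * p)%N; have M0 : (0 < M)%N by rewrite muln_gt0.
pose c : R := (C * C' * M ^ 3)%N%:R.
have c1 : 1 <= c by rewrite /c ler1n muln_gt0 muln_gt0 C0 C'0 expn_gt0 M0.
exists c => // n Y w [w1 e Y0 YY Yw _].
have eM : (p * (4 * Y) = M * Y)%N by rewrite /M mulnA [(p * 4)%N]mulnC.
rewrite eM.
have w0 : 0 <= w by apply: le_trans w1.
have Yw2 : Y%:R <= w ^+ 128 by apply: (le_trans Yw); rewrite ler_weXn2l.
have MM : (M <= M ^ 3)%N by rewrite !expnS expn0 muln1 leq_pmulr // muln_gt0 M0.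
split.
- apply: (@root_bound _ _ _ 128) => //; rewrite -natrX.
  apply: (@le_trans _ _ ((C * M)%N%:R * Y%:R)); last first.
    apply: ler_pM => //; rewrite ?ler0n // ler_nat -mulnA leq_mul2l.
    by rewrite (leq_trans MM) ?orbT // leq_pmull.
  by rewrite -natrM ler_nat -mulnA; apply: hC; rewrite muln_gt0 M0.
- apply: (@root_bound _ _ _ 128); rewrite ?harm_ge0 //.
  apply: (@le_trans _ _ ((C' * M)%N%:R * Y%:R)); last first.
    apply: ler_pM => //; rewrite ?ler0n // ler_nat [(C * C')%N]mulnC -mulnA leq_mul2l.
    by rewrite (leq_trans MM) ?orbT // leq_pmull.
  by rewrite -natrM -mulnA; apply: hC'; rewrite muln_gt0 M0.
- apply: (@root_bound _ _ _ 4); rewrite ?pow34_ge0 ?exprn_ge0 //.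
  rewrite pow34_X4 ?ler0n // natrM exprMn; apply: ler_pM; rewrite ?exprn_ge0 ?ler0n //.
    by rewrite -natrX ler_nat leq_pmull // muln_gt0 C0.
  rewrite -exprM (_ : 48 * 4 = 64 * 3)%N // exprM.
  by apply: lerXn2r; rewrite ?nnegrE ?exprn_ge0 ?ler0n.
Qed.

(** Exponents of [w]: [48] from the Kloosterman bound, [64] from [Q], and [7] from the divisor and
    harmonic factors. The total [119] is rounded up to [125], still below the limit [127] set by
    [n / numdiv n]. The constant [168] is [2 * 21 * 4], with [4] from [Q = 4 * Y]. *)
Lemma end_bound p : (0 < p)%N -> exists2 C : R, 0 <= C & forall n Y w, scale n Y w ->
  p%:R ^+ 4 * (2 * end_const R p (4 * Y) (max_numdiv (p * (4 * Y)))
    * ((numdiv n)%:R ^+ 2 * harm R (p * (4 * Y)))) <= C * w ^+ 125.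
Proof.
move=> p0; have [c c1 hc] := small_bounds; have [d d1 hd] := medium_bounds p0.
exists (168 * p%:R ^+ 6 * d ^+ 6 * c ^+ 2) => [|n Y w sc].
  by rewrite !mulr_ge0 ?exprn_ge0 ?ler0n ?(le_trans ler01).
have [hn _] := hc _ _ _ sc; have [h1 h2 h3] := hd _ _ _ sc; have [w1 e Y0 YY Yw _] := sc.
have w0 : 0 <= w by apply: le_trans w1.
have c0 : 0 <= c by apply: le_trans c1.
have d0 : 0 <= d by apply: le_trans d1.
have g1 := pow34_ge0 ((p * (4 * Y))%N%:R : R); have g2 := harm_ge0 R (p * (4 * Y)).
have X2 (x y : R) : 0 <= x -> x <= y -> x ^+ 2 <= y ^+ 2.
  by move=> x0 xy; apply: lerXn2r; rewrite ?nnegrE // (le_trans x0).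
rewrite /end_const (natrM _ 4 Y).
move: (pow34 _) (harm R _) g1 g2 h2 h3 => A H A0 H0 hH hA.
move: (max_numdiv _) h1 => D hD.
apply: (@le_trans _ _ (p%:R ^+ 4 * (2 * (21 * p%:R ^+ 2 * (d * w ^+ 48) * (d * w) ^+ 2 * (d * w) ^+ 2 * (4 * w ^+ 64))
   * ((c * w) ^+ 2 * (d * w))))).
  have P0 : 0 <= p%:R :> R by rewrite ler0n.
  have N0 : 0 <= (numdiv n)%:R :> R by rewrite ler0n.
  have D0 : 0 <= D%:R :> R by rewrite ler0n.
  have Y0' : 0 <= Y%:R :> R by rewrite ler0n.
  apply: ler_wpM2l; first exact: exprn_ge0.
  apply: ler_pM; rewrite ?mulr_ge0 ?exprn_ge0 //.
    rewrite ler_wpM2l //.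
    apply: ler_pM; [by rewrite !mulr_ge0 ?exprn_ge0|by rewrite mulr_ge0| |by rewrite ler_wpM2l].
    apply: ler_pM; [by rewrite !mulr_ge0 ?exprn_ge0|exact: exprn_ge0| |exact: X2].
    apply: ler_pM; [by rewrite !mulr_ge0 ?exprn_ge0|exact: exprn_ge0| |exact: X2].
    by rewrite ler_wpM2l ?mulr_ge0 ?exprn_ge0.
  by apply: ler_pM; rewrite ?exprn_ge0 ?X2.
have -> : p%:R ^+ 4 * (2 * (21 * p%:R ^+ 2 * (d * w ^+ 48) * (d * w) ^+ 2 * (d * w) ^+ 2 * (4 * w ^+ 64))
   * ((c * w) ^+ 2 * (d * w))) = 168 * p%:R ^+ 6 * d ^+ 6 * c ^+ 2 * w ^+ 119.
  rewrite (_ : 119 = 48 + 64 + 7)%N // !exprD; move: (w ^+ 48) (w ^+ 64) => a b; ring.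
rewrite ler_wpM2l //; first by rewrite !mulr_ge0 ?exprn_ge0 ?ler0n.
by rewrite ler_weXn2l.
Qed.

End Scales.

(** * Main terms with explicit error exponents *)

Section Approximations.
Variable R : realType.

Definition Lapprox (h : nat -> R[i]) (L : R[i]) := exists K : R, forall N,
  cabs (\sum_(1 <= x < N.+1) h x / x%:R - L) <= K / N.+1%:R.

Definition L2approx (h : nat -> R[i]) (L : R[i]) := exists K : R, forall N,
  cabs (\sum_(1 <= x < N.+1) h x / x%:R ^+ 2 - L) <= K / N.+1%:R.

Lemma Lapprox_max h h' L L' : Lapprox h L -> Lapprox h' L' -> exists2 K : R, 0 <= K &
  (forall N, cabs (\sum_(1 <= x < N.+1) h x / x%:R - L) <= K / N.+1%:R) /\
  (forall N, cabs (\sum_(1 <= x < N.+1) h' x / x%:R - L') <= K / N.+1%:R).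
Proof.
move=> [K hK] [K' hK'].
have K0 : 0 <= K by have := hK 0%N; rewrite divr1; apply: le_trans; exact: cabs_ge0.
have K'0 : 0 <= K' by have := hK' 0%N; rewrite divr1; apply: le_trans; exact: cabs_ge0.
exists (K + K'); first exact: addr_ge0.
split=> N; [apply: (le_trans (hK N))|apply: (le_trans (hK' N))];
  by rewrite ler_wpM2r ?invr_ge0 ?ler0n // ?lerDl ?lerDr.
Qed.

Lemma modchar_le1 p f a : modchar p f -> cabs (f a : R[i]) <= 1.
Proof.
move=> fc; rewrite -le_cabs rmorph1; have [pa|pa] := boolP (p %| a)%N.
  by rewrite (mc0 fc pa) normr0 ler01.
by rewrite (mc_norm fc pa).
Qed.

Lemma modchar_partial p f N : prime p -> modchar p f ->
  cabs (\sum_(1 <= x < N.+1) f x : R[i]) <= p%:R.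
Proof.
move=> p_pr fc; have p0 := prime_gt0 p_pr.
have f0 : f 0%N = 0 by rewrite (mc0 fc) ?dvdn0.
have -> : \sum_(1 <= x < N.+1) f x = \sum_(0 <= x < N.+1) f x.
  by rewrite [RHS]big_ltn // f0 add0r.
have per k r : \sum_(0 <= x < k * p + r) f x = \sum_(0 <= x < r) f x.
  elim: k => [|k IH]; first by rewrite mul0n add0n.
  rewrite -{}IH mulSn -addnA (big_cat_nat (n := p)) //= ?leq_addr //.
  rewrite big_mkord (mc_sum fc) add0r -{1}[p]add0n [LHS]big_addn addKn; apply: eq_bigr => x _.
  by rewrite (mc_mod fc) modnDr -(mc_mod fc).
rewrite (divn_eq N.+1 p) per.
apply: le_trans (cabs_sum_nat (G := fun=> 1) _) _ => [i _ _|]; first exact: modchar_le1 fc.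
by rewrite sumr_const_nat subn0 ler_nat ltnW // ltn_pmod.
Qed.

Definition divsum n (h h' : nat -> R[i]) : R[i] := \sum_(1 <= g < n.+1 | (g %| n)%N) hh h h' g / g%:R.

Section OneTerm.
Variables (h h' : nat -> R[i]) (LL La : R[i]).
Hypothesis hM : forall a b, h (a * b)%N = h a * h b.
Hypothesis h'M : forall a b, h' (a * b)%N = h' a * h' b.
Hypothesis h1 : h 1%N = 1.
Hypothesis h'1 : h' 1%N = 1.
Hypothesis h_le1 : forall a, cabs (h a) <= 1.
Hypothesis h'_le1 : forall a, cabs (h' a) <= 1.
Hypothesis La0 : La != 0.
Hypothesis hLa : L2approx (hh h h') La.

(** The averages have an error of order [harm n / Y], and the truncated Moebius series one of order
    [harm n / n]; with [n = w ^ 128] and [Y] of order [w ^ 64] they end up as [w ^ 67] and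
    [w ^ 2]. *)
Lemma main_asymp (om : nat -> nat -> nat -> nat -> R) (K : R) : 0 <= K ->
  (forall n Y, (Y * Y <= n)%N -> (0 < Y)%N -> forall a b, (n < a)%N || (n < b)%N -> om n Y a b = 0) ->
  (forall n Y, (Y * Y <= n)%N -> (0 < Y)%N -> forall m, (0 < m)%N ->
     cabs (Asum h h' n (om n Y) m - LL) <= K * harm R n / Y%:R * m%:R) ->
  exists2 C : R, 0 <= C & forall n Y w, scale n Y w ->
  cabs (n%:R * (\sum_(1 <= g < n.+1 | (g %| n)%N) hh h h' g / g%:R * Tsum h h' n (om n Y) g)
     - n%:R * (divsum n h h' * (LL / La))) <= C * w ^+ 125.
Proof.
move=> K0 om0 hA; have [K2 hK2] := hLa.
have T1 : hh h h' 1 = 1 by rewrite /hh h1 h'1 mulr1.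
have TM a b : hh h h' (a * b)%N = hh h h' a * hh h h' b by rewrite /hh hM h'M; ring.
have Tle1 a : cabs (hh h h' a) <= 1 by exact: hh_le1.
have [K' hK'] := mobS_inv T1 TM Tle1 La0 hK2.
have [c c1 hc] := small_bounds R.
have c0 : 0 <= c by apply: le_trans c1.
pose K3 := `|K'|.
exists (2 * K * c ^+ 3 + cabs LL * K3 * c ^+ 2) => [|n Y w sc].
  by rewrite addr_ge0 ?mulr_ge0 ?exprn_ge0 ?cabs_ge0 ?normr_ge0.
have [hn hH] := hc _ _ _ sc; have [w1 e Y0 YY Yw wY] := sc.
have w0 : 0 < w by apply: lt_le_trans w1.
have n0 : (0 < n)%N by apply: leq_trans YY; rewrite muln_gt0 Y0.
have nR : 0 < n%:R :> R by rewrite ltr0n.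
have YR : 0 < Y%:R :> R by rewrite ltr0n.
have H0 := harm_ge0 R n.
rewrite -mulrBr cabsM cabs_nat.
have mb := main_bound n0 hM h'M h_le1 h'_le1 (om0 n Y YY Y0) (hA n Y YY Y0) (hK' n n0).
apply: le_trans (ler_wpM2l (ltW nR) mb) _.
have W0 k : 0 <= w ^+ k by rewrite exprn_ge0 // ltW.
have iY : Y%:R^-1 <= 2 / w ^+ 64.
  by rewrite ler_pdivlMr ?exprn_gt0 // mulrC ler_pdivrMr.
apply: (@le_trans _ _ (n%:R * (c * w * (K * (c * w) * (2 / w ^+ 64) * (c * w) + cabs LL * (K3 * (c * w) / n%:R))))).
  apply: ler_wpM2l; first exact: ltW.
  apply: ler_pM => //; rewrite ?ler0n //.
    apply: addr_ge0; first by rewrite !mulr_ge0 ?invr_ge0 ?ler0n.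
    apply: mulr_ge0; [exact: cabs_ge0 | exact: le_trans (cabs_ge0 _) (hK' n n0)].
  apply: lerD.
    apply: ler_pM; rewrite ?mulr_ge0 ?invr_ge0 ?ler0n //.
    apply: ler_pM; rewrite ?mulr_ge0 ?invr_ge0 ?ler0n //.
    by rewrite ler_wpM2l.
  rewrite ler_wpM2l ?cabs_ge0 // ler_wpM2r ?invr_ge0 ?ler0n //.
  apply: (@le_trans _ _ (K3 * harm R n)); first by rewrite ler_wpM2r // ler_norm.
  by rewrite ler_wpM2l // normr_ge0.
have w64 : w ^+ 64 != 0 by rewrite expf_neq0 // gt_eqF.
have -> : n%:R * (c * w * (K * (c * w) * (2 / w ^+ 64) * (c * w) + cabs LL * (K3 * (c * w) / n%:R)))
   = 2 * K * c ^+ 3 * w ^+ 67 + cabs LL * K3 * c ^+ 2 * w ^+ 2.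
  rewrite mulrDr mulrDr; congr (_ + _).
    rewrite -e (_ : 128 = 64 + 64)%N // (_ : 67 = 64 + 3)%N // !exprD.
    by move: (w ^+ 64) w64 => v v0; field.
  by field; rewrite gt_eqF.
have K30 : 0 <= K3 by exact: normr_ge0.
rewrite [leRHS]mulrDl; apply: lerD; rewrite ler_wpM2l ?mulr_ge0 ?exprn_ge0 ?cabs_ge0 // ler_weXn2l //.
Qed.

End OneTerm.

End Approximations.

Section Asymptotics.
Variables (R : realType) (p : nat) (f f' : nat -> R[i]).
Variables (L L' Lt Lt' La Lb : R[i]).
Hypothesis p_prime : prime p.
Hypotheses (fc : modchar p f) (fc' : modchar p f').

Lemma thcE (k : nat -> R[i]) a : thc k a = Num.conj (k a).
Proof. by []. Qed.

Lemma modchar_conj (k : nat -> R[i]) : modchar p k -> modchar p (thc k).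
Proof.
move=> kc; split.
- by rewrite thcE (mc1 kc) rmorph1.
- by move=> a b; rewrite !thcE (mcM kc) rmorphM.
- by move=> a; rewrite !thcE (mc_mod kc).
- by move=> a pa; rewrite thcE (mc0 kc pa) rmorph0.
- by move=> a pa; rewrite thcE norm_conjC (mc_norm kc pa).
- under eq_bigr do rewrite thcE.
  by rewrite -rmorph_sum (mc_sum kc) rmorph0.
Qed.

Hypotheses (fL : Lapprox f L) (fL' : Lapprox f' L').
Hypotheses (fLt : Lapprox (thc f) Lt) (fLt' : Lapprox (thc f') Lt').
Hypotheses (La0 : La != 0) (Lb0 : Lb != 0).
Hypothesis hLa : L2approx (hh f f') La.
Hypothesis hLb : L2approx (hh (thc f) (thc f')) Lb.

Lemma box_asymp : exists2 C : R, 0 <= C & forall n Y w, scale n Y w -> ~~ (p %| n)%N ->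
  cabs (quad_main p (Wi f f') n 0 0 Y Y - n%:R * (divsum n f f' * (L * L' / La))) <= C * w ^+ 125.
Proof.
have [K K0 [hK hK']] := Lapprox_max fL fL'.
have [|n Y YY Y0 a b|n Y YY Y0 m m0|C C0 hC] := @main_asymp R f f' (L * L') La (mcM fc) (mcM fc')
  (mc1 fc) (mc1 fc') (fun a => modchar_le1 a fc) (fun a => modchar_le1 a fc') La0 hLa (fun _ => om_box R)
  (K * (cabs L + cabs L' + K)).
- by rewrite mulr_ge0 ?addr_ge0 ?cabs_ge0.
- have Yn : (Y <= n)%N by rewrite (leq_trans _ YY) // leq_pmulr.
  by rewrite /om_box; case/orP => /(leq_ltn_trans Yn); rewrite ltnNge => /negbTE ->; rewrite ?andbF.
- apply: le_trans (Asum_box Y0 YY hK hK' m0) _.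
  rewrite ler_wpM2r ?ler0n // ler_wpM2r ?invr_ge0 ?ler0n // ler_peMr ?mulr_ge0 ?addr_ge0 ?cabs_ge0 //.
  by rewrite harm_ge1 // (leq_trans _ YY) // muln_gt0 Y0.
exists C => // n Y w sc pn; have [_ _ Y0 YY _ _] := sc.
by rewrite (quad_main_i p_prime fc fc' Y0 YY); exact: hC.
Qed.

Lemma tri_asymp : exists2 C : R, 0 <= C & forall n Y w, scale n Y w -> ~~ (p %| n)%N ->
  cabs (quad_main p (Wiv f f') n Y Y (n %/ Y)%N (n %/ Y)%N
    - f n * f' n * (jac p f f' / p%:R) * (n%:R * (divsum n (thc f) (thc f') * (Lt * Lt' / Lb)))) <= C * w ^+ 125.
Proof.
have [K K0 [hK hK']] := Lapprox_max fLt fLt'.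
have tc := modchar_conj fc; have tc' := modchar_conj fc'.
have [|n Y YY Y0 a b|n Y YY Y0 m m0|C C0 hC] := @main_asymp R (thc f) (thc f') (Lt * Lt') Lb (mcM tc) (mcM tc')
  (mc1 tc) (mc1 tc') (fun a => modchar_le1 a tc) (fun a => modchar_le1 a tc') Lb0 hLb (fun n => om_tri R n)
  ((K + p%:R) * (1 + cabs Lt')).
- by rewrite mulr_ge0 ?addr_ge0 ?cabs_ge0.
- move=> h; rewrite /om_tri ifF //; apply/negbTE; rewrite -leqNgt.
  have ab : (n <= a + b)%N by case/orP: h => /ltnW h; rewrite (leq_trans h) ?leq_addr ?leq_addl.
  by rewrite (leq_trans ab) // leq_pmulr.
- apply: le_trans (Asum_tri Y0 YY (fun a => modchar_le1 a tc) hK hK' (fun N => modchar_partial N p_prime tc)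
      (fun N => modchar_partial N p_prime tc') m0) _.
  have KP : 0 <= K + p%:R by rewrite addr_ge0.
  rewrite ler_wpM2r ?ler0n // ler_wpM2r ?invr_ge0 ?ler0n //.
  have -> : (K + p%:R) * (1 + cabs Lt') * harm R n = (K + p%:R) * harm R n + cabs Lt' * (K + p%:R) * harm R n by ring.
  rewrite lerD2l ler_peMr ?mulr_ge0 ?cabs_ge0 //.
  by rewrite harm_ge1 // (leq_trans _ YY) // muln_gt0 Y0.
exists (cabs (jac p f f') * C) => [|n Y w sc pn]; first by rewrite mulr_ge0 ?cabs_ge0.
have [_ _ Y0 YY _ _] := sc.
rewrite (quad_main_iv p_prime fc fc' Y0 YY pn) -mulrBr cabsM -[leRHS]mulrA; apply: ler_pM; rewrite ?cabs_ge0 //; last exact: hC.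
rewrite !cabsM -[leRHS]mul1r; apply: ler_pM; rewrite ?mulr_ge0 ?cabs_ge0 //.
  by rewrite -[leRHS]mul1r; apply: ler_pM; rewrite ?cabs_ge0 ?(modchar_le1 _ fc) ?(modchar_le1 _ fc').
by rewrite cabs_invn ler_piMr ?cabs_ge0 // invf_le1 ?ltr0n ?ler1n ?prime_gt0.
Qed.

Lemma quadruples_asymp : exists2 C : R, 0 <= C & forall n w, 1 <= w -> w ^+ 128 = n%:R -> ~~ (p %| n)%N ->
  cabs (quadruples n f f' - (n%:R * (divsum n f f' * (L * L' / La)) +
    f n * f' n * (jac p f f' / p%:R) * (n%:R * (divsum n (thc f) (thc f') * (Lt * Lt' / Lb))))) <= C * w ^+ 125.
Proof.
have [C1 C10 h1] := box_asymp; have [C2 C20 h2] := tri_asymp.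
have [C3 C30 h3] := end_bound R (prime_gt0 p_prime).
exists (C1 + C2 + 4 * C3) => [|n w w1 e pn]; first by rewrite !addr_ge0 ?mulr_ge0.
have [Y sc] := scale_ex w1 e; have [_ _ Y0 YY _ _] := sc.
have b1 := h1 _ _ _ sc pn; have b2 := h2 _ _ _ sc pn; have b3 := h3 _ _ _ sc.
rewrite (quadruples_split n f f' Y0).
have n0 : (0 < n)%N by rewrite (leq_trans _ YY) // muln_gt0 Y0.
have Yn : (Y <= n)%N by rewrite (leq_trans _ YY) // leq_pmulr.
have dn : (n %/ Y <= n)%N by exact: leq_div.
have dQ := scale_div sc.
have YQ : (Y <= 4 * Y)%N by rewrite leq_pmull.
have Q0 : (0 < 4 * Y)%N by rewrite muln_gt0.
have D_max k : (0 < k <= p * (4 * Y))%N -> (numdiv k <= max_numdiv (p * (4 * Y)))%N.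
  by case/andP=> _; exact: max_numdivP.
have le1 (k : nat -> R[i]) x : modchar p k -> `|k x| <= 1.
  by move=> kc; rewrite -[1](rmorph1 (@real_complex R)) le_cabs (modchar_le1 _ kc).
have le2 (k k' : nat -> R[i]) x y : modchar p k -> modchar p k' -> `|k x * k' y| <= 1.
  move=> kc kc'; rewrite normrM -[leRHS]mul1r; apply: ler_pM => //; exact: le1.
have Q W U V X1 X2 : (forall x y u v, W x y u v = W (x %% p)%N (y %% p)%N (u %% p)%N (v %% p)%N) ->
    (forall x y u v, `|W x y u v : R[i]| <= 1) -> (X1 <= n)%N -> (X2 <= n)%N -> (X1 <= 4 * Y)%N -> (X2 <= 4 * Y)%N ->
    cabs (quad_sum W n U V X1 X2 - quad_main p W n U V X1 X2) <= C3 * w ^+ 125.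
  move=> Wm W1 a1 a2 a3 a4; apply: le_trans b3; rewrite -le_cabs.
  exact: (quad_sum_main p_prime Q0 D_max Wm W1 U V n0 a1 a2 a3 a4).
have qi := Q (Wi f f') 0%N 0%N Y Y; have qii := Q (Wii f f') 0%N Y Y (n %/ Y)%N.
have qiii := Q (Wiii f f') 0%N Y Y (n %/ Y)%N; have qiv := Q (Wiv f f') Y Y (n %/ Y)%N (n %/ Y)%N.
have {}qi := qi (fun x y u v => congr2 _ (mc_mod fc x) (mc_mod fc' y)) (fun x y u v => le2 _ _ x y fc fc') Yn Yn YQ YQ.
have {}qii := qii (fun x y u v => congr2 _ (mc_mod fc x) (mc_mod fc' v)) (fun x y u v => le2 _ _ x v fc fc') Yn dn YQ dQ.
have {}qiii := qiii (fun x y u v => congr2 _ (mc_mod fc' x) (mc_mod fc v)) (fun x y u v => le2 _ _ x v fc' fc) Yn dn YQ dQ.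
have {}qiv := qiv (fun x y u v => congr2 _ (mc_mod fc u) (mc_mod fc' v)) (fun x y u v => le2 _ _ u v fc fc') dn dn dQ dQ.
have z2 : quad_main p (Wii f f') n 0 Y Y (n %/ Y) = 0 by apply: quad_main_ii.
have z3 : quad_main p (Wiii f f') n 0 Y Y (n %/ Y) = 0 by apply: quad_main_ii.
move: qii qiii; rewrite z2 z3 !subr0 => qii qiii.
move: (quad_sum (Wi f f') _ _ _ _ _) (quad_sum (Wii f f') _ _ _ _ _) (quad_sum (Wiii f f') _ _ _ _ _)
  (quad_sum (Wiv f f') _ _ _ _ _) qi qii qiii qiv b1 b2.
move: (quad_main p (Wi f f') _ _ _ _ _) (quad_main p (Wiv f f') _ _ _ _ _) => M1 M4 S1 S2 S3 S4.
set A := n%:R * (divsum n f f' * _); set B := f n * f' n * _ * _ => qi qii qiii qiv b1 b2.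
have -> : S1 + S2 + S3 + S4 - (A + B) = (S1 - M1) + (M1 - A) + S2 + S3 + ((S4 - M4) + (M4 - B)) by ring.
have t1 := cabsD ((S1 - M1) + (M1 - A) + S2 + S3) ((S4 - M4) + (M4 - B)).
have t2 := cabsD ((S1 - M1) + (M1 - A) + S2) S3.
have t3 := cabsD ((S1 - M1) + (M1 - A)) S2.
have t4 := cabsD (S1 - M1) (M1 - A).
have t5 := cabsD (S4 - M4) (M4 - B).
by lra.
Qed.

End Asymptotics.

(** * L-values *)

Section LValues.
Variables (R : realType) (p : nat).
Hypothesis p_prime : prime p.

Let p0 : (0 < p)%N. Proof. exact: prime_gt0. Qed.
Let pR : p%:R != 0 :> R. Proof. by rewrite pnatr_eq0 -lt0n. Qed.
Let pC : p%:R != 0 :> R[i]. Proof. by rewrite pnatr_eq0 -lt0n. Qed.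

Definition zetap : R[i] := expi (2 * pi / p%:R).

(** The order divides the prime [p], and order [1] is excluded by the distance bound
    [expi_root_far]. *)
Lemma zetap_prim : p.-primitive_root zetap.
Proof.
have zp : zetap ^+ p = 1 by rewrite expiX mulrC divfK // expi_2pi.
have [m mprim mp] := prim_order_exists p0 zp.
have := primeP p_prime => -[_ /(_ m mp) /pred2P[e|<- //]].
have := prim_expr_order mprim; rewrite e expr1 => z1.
move: p_prime z1; rewrite /zetap; case: p => [|[|m']] // _ z1.
have := @expi_root_far R m' (Ordinal (isT : (1 < m'.+2)%N)) isT.
rewrite expr1 z1 subrr normr0 /= subSS subn0 => h.
have : (0 : R[i]) < (minn 1 m'.+1)%:R / m'.+2%:R by rewrite divr_gt0 ?ltr0n // leq_min.
by move/lt_le_trans/(_ h); rewrite ltxx.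
Qed.

Definition tau (f : nat -> R[i]) : R[i] := gauss zetap (fun a : 'F_p => f a) 1.

Definition angle (a : 'F_p) : R := (a : nat)%:R * (2 * pi / p%:R).

Lemma ezp_angle (a : 'F_p) n : ezp zetap (a * n%:R) = expi (n%:R * angle a).
Proof.
rewrite -(Fp_natr a) -natrM (ezp_nat p_prime zetap_prim) expiX natrM Fp_natr /angle.
by congr expi; ring.
Qed.

Lemma angle_itv (a : 'F_p) : a != 0 -> 0 < angle a < pi *+ 2.
Proof.
move=> a0; have pi0 := pi_gt0 R.
have a1 : (0 < a)%N by rewrite lt0n.
have ap : (a < p)%N by rewrite -[X in (_ < X)%N](Fp_cast p_prime) ltn_ord.
have pR0 : 0 < p%:R :> R by rewrite ltr0n.
rewrite /angle mulr_gt0 ?ltr0n ?divr_gt0 ?mulr_gt0 //= mulrA ltr_pdivrMr //.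
by rewrite mulrC -[pi *+ 2]mulr_natl ltr_pM2l ?mulr_gt0 // ltr_nat.
Qed.

Section OneCharacter.
Variable f : nat -> R[i].
Hypothesis fc : modchar p f.

(** Both sides vanish at the multiples of [p], so an L-series of [thc f] can be expanded term by
    term without exceptions. *)
Lemma gauss_thc n : gauss zetap (fun a : 'F_p => f a) n%:R = thc f n * tau f.
Proof.
have [pn|pn] := boolP (p %| n)%N.
  rewrite thcE (mc0 fc pn) conjC0 mul0r /gauss.
  have -> : (n%:R : 'F_p) = 0 by apply/eqP; rewrite Fp_nat_eq0.
  rewrite -[RHS](mc_sumF p_prime fc); apply: eq_bigr => a _.
  by rewrite mulr0 ezp0 mulr1.
have n0 : (n%:R : 'F_p) != 0 by rewrite Fp_nat_eq0.
rewrite /tau -(gauss_scale zetap (mcFM p_prime fc) n0) mulrA.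
have -> : thc f n * f (n%:R : 'F_p) = 1.
  by rewrite -(mc_nat p_prime fc) thcE mulrC -normCK (mc_norm fc pn) expr1n.
by rewrite mul1r.
Qed.

Lemma mc_opp (a : 'F_p) : f (- a)%R = f (-1 : 'F_p)%R * f a.
Proof. by rewrite -(mcFM p_prime fc) mulN1r. Qed.

Lemma expi_opp (t : R) : expi (- t) = cos t -i* sin t.
Proof. by rewrite /expi cosN sinN. Qed.

Lemma gauss_opp n : thc f n * tau f =
  f (-1 : 'F_p)%R * \sum_(a : 'F_p) f a * expi (- (n%:R * angle a)).
Proof.
rewrite -gauss_thc /gauss (reindex_inj oppr_inj) mulr_sumr; apply: eq_bigr => a _.
rewrite mc_opp -mulrA; congr (_ * (_ * _)).
have e : expi (n%:R * angle a) * ezp zetap (- a * n%:R) = 1.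
  by rewrite -ezp_angle -(ezpD p_prime zetap_prim) mulNr subrr ezp0.
have n0 : expi (n%:R * angle a) != 0 by rewrite -normr_eq0 expi_norm oner_eq0.
by apply: (mulfI n0); rewrite e -expiD subrr expi0.
Qed.

Lemma gauss_odd n : f (-1 : 'F_p)%R = -1 ->
  thc f n * tau f = \sum_(a : 'F_p) 'i * f a * (sin (n%:R * angle a))%:C.
Proof.
move=> odd; have e1 := gauss_opp n; have e2 := gauss_thc n.
have two : (2 : R[i]) != 0 by rewrite pnatr_eq0.
apply: (mulfI two); rewrite mulr_natl mulr2n {1}e1 odd mulN1r -e2 /gauss -sumrN -big_split mulr_sumr.
apply: eq_bigr => a _; rewrite ezp_angle expi_opp /expi; move: (cos _) (sin _) (f a) => c s [x y].
by apply/eqP; rewrite eq_complex /=; apply/andP; split; apply/eqP; ring.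
Qed.

Lemma gauss_even n : f (-1 : 'F_p)%R = 1 ->
  thc f n * tau f = \sum_(a : 'F_p) f a * (cos (n%:R * angle a))%:C.
Proof.
move=> even; have e1 := gauss_opp n; have e2 := gauss_thc n.
have two : (2 : R[i]) != 0 by rewrite pnatr_eq0.
apply: (mulfI two); rewrite mulr_natl mulr2n {1}e1 even mul1r -e2 /gauss -big_split mulr_sumr.
apply: eq_bigr => a _; rewrite ezp_angle expi_opp /expi; move: (cos _) (sin _) (f a) => c s [x y].
by apply/eqP; rewrite eq_complex /=; apply/andP; split; apply/eqP; ring.
Qed.

Lemma approx_sum (g : 'F_p -> R[i]) (s : 'F_p -> nat -> R) (l : 'F_p -> R) :
  g 0 = 0 -> (forall a, a != 0 -> exists K : R, forall N, `|s a N - l a| <= K / N.+1%:R) ->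
  exists K : R, forall N, cabs (\sum_a g a * (s a N)%:C - \sum_a g a * (l a)%:C) <= K / N.+1%:R.
Proof.
move=> g0 h; have h' a : exists K : R, forall N, cabs (g a * (s a N)%:C - g a * (l a)%:C) <= K / N.+1%:R.
  have [->|a0] := eqVneq a 0; first by exists 0 => N; rewrite g0 !mul0r subrr cabs0.
  have [K hK] := h a a0; exists (cabs (g a) * K) => N.
  by rewrite -mulrBr -rmorphB cabsM cabs_real -mulrA ler_wpM2l ?cabs_ge0.
have [K hK] := fin_all_exists h'; exists (\sum_a K a) => N.
by rewrite -sumrB mulr_suml; apply: (le_trans (cabs_sum _ _ _)); apply: ler_sum => a _.
Qed.

Definition delta0 : R[i] := - (2 * p%:R)^-1 * \sum_(1 <= a < p) f a * a%:R.

Lemma sum_Fp_pos (G : nat -> R[i]) : \sum_(a : 'F_p) f a * G a = \sum_(1 <= a < p) f a * G a.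
Proof.
rewrite -(sum_Fp p_prime (fun a => f a * G a)) -(big_mkord predT (fun a => f a * G a)) big_ltn //.
by rewrite (mc0 fc) ?dvdn0 // mul0r add0r.
Qed.

(** Times [tau f], the value [thc f x] is a combination of sines; summing over [x] first turns them
    into [(pi - angle a) / 2]. The constant part is lost against the nontrivial character, and the
    part linear in [a] is [delta0]. *)
Lemma Lapprox_odd : f (-1 : 'F_p)%R = -1 -> tau f != 0 ->
  Lapprox (thc f) (2 * 'i * pi%:C / tau f * delta0).
Proof.
move=> odd t0.
have [|K hK] := @approx_sum (fun a => 'i * f a) (fun a N => sinS N (angle a)) (fun a => (pi - angle a) / 2) _ (fun a a0 => sinS_lim (angle_itv a0)).
  by rewrite (mc_F0 fc) mulr0.
exists (K / cabs (tau f)) => N.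
have tR : 0 < cabs (tau f) by rewrite lt0r cabs_eq0 t0 cabs_ge0.
rewrite [leRHS]mulrAC ler_pdivlMr // -cabsM mulrBl.
have -> : (\sum_(1 <= x < N.+1) thc f x / x%:R) * tau f = \sum_(a : 'F_p) 'i * f a * (sinS N (angle a))%:C.
  rewrite mulr_suml (eq_bigr (fun x => \sum_(a : 'F_p) 'i * f a * (sin (x%:R * angle a))%:C / x%:R)).
    rewrite exchange_big /=; apply: eq_bigr => a _; rewrite /sinS rmorph_sum mulr_sumr; apply: eq_bigr => x _.
    by rewrite /= rmorphM fmorphV rmorph_nat [RHS]mulrA.
  by move=> x _; rewrite mulrAC (gauss_odd _ odd) mulr_suml.
suff -> : 2 * 'i * pi%:C / tau f * delta0 * tau f = \sum_(a : 'F_p) 'i * f a * ((pi - angle a) / 2)%:C by exact: hK.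
have -> : 2 * 'i * pi%:C / tau f * delta0 * tau f = 2 * 'i * pi%:C * delta0 by field.
have e (a : 'F_p) : 'i * f a * ((pi - angle a) / 2)%:C = 'i * pi%:C / 2 * f a - 'i * pi%:C / p%:R * (f a * (a : nat)%:R).
  have -> : (pi - angle a) / 2 = pi / 2 - pi / p%:R * (a : nat)%:R :> R by rewrite /angle; field.
  by rewrite rmorphB !rmorphM !fmorphV !rmorph_nat; ring.
under [RHS]eq_bigr => a _ do rewrite e.
rewrite sumrB -!mulr_sumr (mc_sumF p_prime fc) mulr0 sub0r (sum_Fp_pos (fun a => a%:R)) /delta0.
by field.
Qed.

(** The second generalized Bernoulli number without the constant term of the Bernoulli polynomial,
    which a nontrivial character annihilates; see [gen_bernoulli_psi]. *)
Definition bern2 : R[i] := \sum_(1 <= a < p) f a * (a%:R ^+ 2 / p%:R - a%:R).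

Lemma L2approx_even : f (-1 : 'F_p)%R = 1 -> tau f != 0 ->
  L2approx (thc f) (pi%:C ^+ 2 / (p%:R * tau f) * bern2).
Proof.
move=> even t0.
have [|K hK] := @approx_sum (fun a => f a) (fun a N => cosS N (angle a)) (fun a => (pi - angle a) ^+ 2 / 4 - pi ^+ 2 / 12)
   _ (fun a a0 => cosS_lim (angle_itv a0)).
  by rewrite (mc_F0 fc).
exists (K / cabs (tau f)) => N.
have tR : 0 < cabs (tau f) by rewrite lt0r cabs_eq0 t0 cabs_ge0.
rewrite [leRHS]mulrAC ler_pdivlMr // -cabsM mulrBl.
have -> : (\sum_(1 <= x < N.+1) thc f x / x%:R ^+ 2) * tau f = \sum_(a : 'F_p) f a * (cosS N (angle a))%:C.
  rewrite mulr_suml (eq_bigr (fun x => \sum_(a : 'F_p) f a * (cos (x%:R * angle a))%:C / x%:R ^+ 2)).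
    rewrite exchange_big /=; apply: eq_bigr => a _; rewrite /cosS rmorph_sum mulr_sumr; apply: eq_bigr => x _.
    by rewrite /= rmorphM fmorphV rmorphXn rmorph_nat [RHS]mulrA.
  by move=> x _; rewrite mulrAC (gauss_even _ even) mulr_suml.
suff -> : pi%:C ^+ 2 / (p%:R * tau f) * bern2 * tau f = \sum_(a : 'F_p) f a * ((pi - angle a) ^+ 2 / 4 - pi ^+ 2 / 12)%:C by exact: hK.
have -> : pi%:C ^+ 2 / (p%:R * tau f) * bern2 * tau f = pi%:C ^+ 2 / p%:R * bern2 by field; rewrite t0 pC.
have e (a : 'F_p) : f a * ((pi - angle a) ^+ 2 / 4 - pi ^+ 2 / 12)%:C =
   pi%:C ^+ 2 / 6 * f a + pi%:C ^+ 2 / p%:R * (f a * ((a : nat)%:R ^+ 2 / p%:R - (a : nat)%:R)).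
  have -> : (pi - angle a) ^+ 2 / 4 - pi ^+ 2 / 12 = pi ^+ 2 / 6 + pi ^+ 2 / p%:R * ((a : nat)%:R ^+ 2 / p%:R - (a : nat)%:R) :> R
    by rewrite /angle; field.
  by rewrite !(rmorphD, rmorphB, rmorphXn, rmorphM, fmorphV, rmorph_nat); ring.
under [RHS]eq_bigr => a _ do rewrite e.
by rewrite big_split /= -!mulr_sumr (mc_sumF p_prime fc) mulr0 add0r (sum_Fp_pos (fun a => a%:R ^+ 2 / p%:R - a%:R)).
Qed.

Lemma mc_nontrivial : exists2 c : 'F_p, f c != 1 & c != 0.
Proof.
apply: contrapT => h.
have h' (c : 'F_p) : c != 0 -> f c = 1.
  by move=> c0; apply/eqP/negPn/negP => fc1; apply: h; exists c.
have := mc_sumF p_prime fc; rewrite (bigD1 0) //= (mc_F0 fc) add0r (eq_bigr (fun=> 1)) // sumr_const.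
move/eqP; rewrite pnatr_eq0 => /eqP h0; have h1 : ((1 : 'F_p) != 0) = false := card0_eq h0 1.
by rewrite oner_neq0 in h1.
Qed.

Lemma tau_mul_thc : tau f * tau (thc f) = f (-1 : 'F_p)%R * p%:R.
Proof.
have [c c1 c0] := mc_nontrivial; have tc := modchar_conj fc.
apply: (gauss_mul_inv p_prime zetap_prim (c := c)) => //.
- exact: mc_F0 fc.
- exact: mcFM.
- exact: mc_F0 tc.
- move=> a a0; rewrite thcE mulrC -normCK (mc_norm fc) ?expr1n //; exact: Fp_ndvd.
Qed.

Lemma mc_N1_neq0 : f (-1 : 'F_p)%R != 0.
Proof.
rewrite -normr_eq0 (mc_norm fc) ?oner_eq0 //; apply: Fp_ndvd => //.
by rewrite oppr_eq0 oner_eq0.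
Qed.

Lemma tau_neq0 : tau f != 0.
Proof.
have := mulf_neq0 mc_N1_neq0 pC; rewrite -tau_mul_thc mulf_eq0 negb_or => /andP[] //.
Qed.

(** The terms are [f (a / (1 - a))], and [a / (1 - a)] takes every value except [-1], so the
    complete sum misses one term. *)
Lemma jac_thc : jac p f (thc f) = - f (-1 : 'F_p)%R.
Proof.
have tc := modchar_conj fc.
rewrite /jac /jacobi.
have e (a : 'F_p) : f a * thc f (1 - a)%R = if a == 1 then 0 else f (a / (1 - a))%R.
  case: eqP => [->|/eqP a1]; first by rewrite subrr (mc_F0 tc) mulr0.
  have d0 : 1 - a != 0 by rewrite subr_eq0 eq_sym.
  by rewrite (mcFM p_prime fc) (mc_inv p_prime fc d0).
under eq_bigr => a _ do rewrite e.
rewrite (bigD1 1) //= add0r.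
rewrite (eq_bigr (fun a : 'F_p => f (a / (1 - a))%R)); last by move=> a /negPf ->.
have := mc_sumF p_prime fc; rewrite (bigD1 (-1)) //= => /eqP; rewrite addrC addr_eq0 => /eqP <-.
rewrite [RHS](reindex_onto (fun a => a / (1 - a)) (fun b => b / (1 + b))) /=.
  apply: eq_bigl => a; apply/idP/andP => [a1|[h1 /eqP h2]].
    have d0 : 1 - a != 0 by rewrite subr_eq0 eq_sym.
    have h : 1 + a / (1 - a) = (1 - a)^-1 by field.
    split; last by rewrite h invrK divfK.
    apply: contra_neq (@oner_neq0 'F_p) => h3; move: h; rewrite h3 subrr => /esym/eqP.
    by rewrite invr_eq0 (negPf d0).
  apply: contraNneq h1 => a1; move: h2; rewrite a1 subrr invr0 mulr0 mul0r => /esym/eqP.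
  by rewrite oner_eq0.
move=> b b1; have d0 : 1 + b != 0 by rewrite addrC addr_eq0.
have -> : 1 - b / (1 + b) = (1 + b)^-1 by field.
by rewrite invrK divfK.
Qed.

Lemma jac_tau (psi : nat -> R[i]) : (forall a, psi a = f a * f a) -> modchar p psi ->
  jac p f f * tau psi = tau f ^+ 2.
Proof.
move=> e pc; have [c c1 c0] : exists2 c : 'F_p, f c * f c != 1 & c != 0.
  apply: contrapT => h.
  have h' (c : 'F_p) : c != 0 -> f c * f c = 1.
    by move=> c0; apply/eqP/negPn/negP => fc1; apply: h; exists c.
  have := mc_sumF p_prime pc; rewrite (bigD1 0) //= (mc_F0 pc) add0r (eq_bigr (fun=> 1)) => [|a a0]; last by rewrite e h'.
  rewrite sumr_const; move/eqP; rewrite pnatr_eq0 => /eqP h0; have h1 : ((1 : 'F_p) != 0) = false := card0_eq h0 1.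
  by rewrite oner_neq0 in h1.
rewrite /tau expr2 (gauss_mul_jacobi p_prime zetap_prim (c := c)) //.
- by congr (_ * _); rewrite /gauss; apply: eq_bigr => a _; rewrite e.
- exact: mc_F0 fc.
- exact: mcFM.
- exact: mcFM.
Qed.

End OneCharacter.

(** The multiples of [p] form [p ^ (-2)] times a shorter sum for [zeta(2)], which gives the Euler
    factor. *)
Lemma L2approx_principal (T : nat -> R[i]) : (forall n, T n = (~~ (p %| n)%N)%:R) ->
  L2approx T (pi%:C ^+ 2 / 6 * (1 - p%:R^-1 ^+ 2)).
Proof.
move=> hT; have [K hK] := zeta2S_lim R.
have K0 : 0 <= K by have := hK 0%N; rewrite divr1; apply: le_trans.
exists (K * 2) => N.
have e : \sum_(1 <= x < N.+1) T x / x%:R ^+ 2 = (zeta2S R N - p%:R^-1 ^+ 2 * zeta2S R (N %/ p))%:C.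
  have -> : p%:R^-1 ^+ 2 * zeta2S R (N %/ p) = \sum_(1 <= x < N.+1 | (p %| x)%N) x%:R^-1 ^+ 2.
    rewrite (sum_multiples _ _ p0) /zeta2S mulr_sumr (big_nat_widen _ _ N.+1) ?ltnS ?leq_div //=.
    apply: eq_big => [x|x _]; first by rewrite ltnS leq_divRL // mulnC.
    by rewrite natrM invfM exprMn.
  rewrite /zeta2S [X in _ = (X - _)%:C](bigID (fun x => (p %| x)%N)) addrAC subrr add0r rmorph_sum big_mkcond [RHS]big_mkcond.
  apply: eq_bigr => x _; rewrite hT; case: (_ %| _)%N; rewrite /= ?mul0r //.
  by rewrite mul1r rmorphXn fmorphV rmorph_nat exprVn.
rewrite e.
have -> : pi%:C ^+ 2 / 6 * (1 - p%:R^-1 ^+ 2) = (pi ^+ 2 / 6 - p%:R^-1 ^+ 2 * (pi ^+ 2 / 6) : R)%:C.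
  by rewrite rmorphB !rmorphM ?rmorphXn !fmorphV !rmorph_nat; ring.
rewrite -rmorphB cabs_real.
have -> : zeta2S R N - p%:R^-1 ^+ 2 * zeta2S R (N %/ p) - (pi ^+ 2 / 6 - p%:R^-1 ^+ 2 * (pi ^+ 2 / 6))
  = (zeta2S R N - pi ^+ 2 / 6) - p%:R^-1 ^+ 2 * (zeta2S R (N %/ p) - pi ^+ 2 / 6) by ring.
apply: (le_trans (ler_normB _ _)); rewrite mulr_natr mulr2n mulrDl; apply: lerD => //.
have P0 : 0 < p%:R :> R by rewrite ltr0n.
rewrite normrM ger0_norm ?exprn_ge0 ?invr_ge0 ?ler0n //.
apply: (@le_trans _ _ (p%:R^-1 ^+ 2 * (K / (N %/ p).+1%:R))); first by rewrite ler_wpM2l ?exprn_ge0 ?invr_ge0 ?ler0n.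
rewrite mulrCA ler_wpM2l //.
have h : N.+1%:R <= p%:R * (N %/ p).+1%:R :> R.
  by rewrite -natrM ler_nat mulnC {1}(divn_eq N p) mulSn addnC -addSn leq_add2r ltn_pmod.
rewrite -[leRHS]mul1r ler_pdivrMr ?ltr0n // mulrAC ler_pdivlMr ?ltr0n // mul1r.
apply: (@le_trans _ _ (p%:R^-1 ^+ 2 * (p%:R * (N %/ p).+1%:R))); first by rewrite ler_wpM2l ?exprn_ge0 ?invr_ge0 ?ler0n.
rewrite mulrA ler_piMl ?ler0n // expr2 -mulrA mulVf ?gt_eqF // mulr1 invf_le1 // ler1n //.
Qed.

End LValues.

(** The first term is [1] and the others add up to at most [1 / 4 + 2 / 3 = 11 / 12] in modulus. The
    remaining [1 / 12] exceeds the truncation error, which the choice of [N] makes less than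
    [1 / 24]. *)
Lemma L2approx_neq0 (R : realType) (T : nat -> R[i]) La : T 1%N = 1 -> (forall a, cabs (T a) <= 1) ->
  L2approx T La -> La != 0.
Proof.
move=> T1 Tle [K hK]; apply/eqP => La0.
have K0 : 0 <= K by have := hK 0%N; rewrite divr1; apply: le_trans; exact: cabs_ge0.
pose N := (Num.truncn (24 * K)).+2.
have hN := hK N; rewrite La0 subr0 in hN.
have NK : 24 * K < N.+1%:R.
  have /andP[_ h] := truncn_itv (mulr_ge0 (ler0n R 24) K0); apply: (lt_le_trans h).
  by rewrite ler_nat; exact: leq_trans (leqnSn _) (leqnSn _).
have b : cabs (\sum_(2 <= x < N.+1) T x / x%:R ^+ 2) <= 11 / 12.
  apply: (@le_trans _ _ (\sum_(2 <= x < N.+1) x%:R^-1 ^+ 2)).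
    apply: cabs_sum_nat => x _ _; rewrite cabsM cabsV expr2 cabsM cabs_nat exprVn -expr2.
    by rewrite ler_piMl ?invr_ge0 ?exprn_ge0.
  rewrite big_ltn //; have := sum_inv_sqr_tail R 2 N; set X := \sum_(_ <= _ < _) _ => h.
  have -> : 11 / 12 = 2%:R^-1 ^+ 2 + 2 / 3 :> R by field.
  by rewrite lerD2l.
move: hN; rewrite big_ltn // T1 expr1n divr1 => hN.
have t := cabsB (1 + \sum_(2 <= x < N.+1) T x / x%:R ^+ 2) (\sum_(2 <= x < N.+1) T x / x%:R ^+ 2).
rewrite addrK cabs1 in t.
have : K / N.+1%:R < 1 / 24 by rewrite ltr_pdivrMr ?ltr0n //; move: NK; lra.
move: b t hN; move: (cabs _) (cabs _) (K / _) => a1 a2 a3; lra.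
Qed.

(** * Quartic characters *)

Lemma Fp_generator p : prime p -> exists g : 'F_p, p.-1.-primitive_root g.
Proof.
move=> p_pr; have p1 := prime_gt1 p_pr.
pose rs := [seq a <- enum 'F_p | a != 0].
have ex (a : 'F_p) : a != 0 -> a ^+ p.-1 = 1.
  move=> a0; apply: (mulfI a0); rewrite -exprS prednK ?(ltnW p1) // mulr1.
  by have := expf_card a; rewrite card_Fp.
have h : has p.-1.-primitive_root rs.
  apply: has_prim_root.
  - by rewrite -ltnS prednK // ltnW.
  - by apply/allP => a; rewrite mem_filter => /andP[a0 _]; rewrite unity_rootE ex.
  - by rewrite filter_uniq // enum_uniq.
  rewrite size_filter; have := count_predC (fun a : 'F_p => a != 0) (enum 'F_p).
  rewrite -cardE card_Fp // => e.
  have e1 : count (predC (fun a : 'F_p => a != 0)) (enum 'F_p) = 1%N.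
    rewrite (eq_count (a2 := pred1 0)) => [|a]; last by rewrite /= negbK.
    by rewrite count_uniq_mem ?enum_uniq // mem_enum.
  by move: e; rewrite e1; move: (count _ _); clear; lia.
by have /hasP[g _ gp] := h; exists g.
Qed.

Section Quartic.
Variables (R : realType) (p : nat) (chi : int -> R[i]).
Hypotheses (p_prime : prime p) (p_mod8 : (p %% 8 = 5)%N).
Hypothesis chi_char : dirichlet_character p chi.
Hypothesis chi_order : has_exact_order p chi 4.

Definition chn (n : nat) : R[i] := chi n%:Z.
Definition psin (n : nat) : R[i] := chn n * chn n.

Let p1 : (1 < p)%N. Proof. exact: prime_gt1. Qed.

Lemma chi_periodic (a m : int) : chi (a + m * p%:Z) = chi a.
Proof.
have [_ _ per _] := chi_char.
have nper (k : nat) b : chi (b + k%:Z * p%:Z) = chi b.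
  elim: k => [|k IH]; first by rewrite mul0r addr0.
  by rewrite -{}IH -[RHS]per; congr chi; rewrite -addn1 PoszD; ring.
case: m => k; first exact: nper.
by rewrite -[LHS](nper k.+1) NegzE; congr chi; ring.
Qed.

Lemma chn_mod n : chn n = chn (n %% p)%N.
Proof.
rewrite /chn {1}(divn_eq n p) PoszD PoszM addrC; exact: chi_periodic.
Qed.

Lemma chi_nat (a : int) : exists n : nat, chi a = chn n /\ coprimez a p%:Z = ~~ (p %| n)%N.
Proof.
have p0 : p%:Z != 0 by rewrite eqz_nat -lt0n ltnW.
have r0 := modz_ge0 a p0.
exists `|(a %% p%:Z)%Z|%N; rewrite /chn gez0_abs //; split.
  by rewrite {1}(divz_eq a p%:Z) addrC chi_periodic.
by rewrite /coprimez -gcdz_modl -/(coprimez _ _) coprimezE /= coprime_sym prime_coprime.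
Qed.

Lemma chn_neq0 n : (chn n != 0) = ~~ (p %| n)%N.
Proof.
have [_ _ _ nz] := chi_char.
by rewrite /chn nz coprimezE /= coprime_sym prime_coprime.
Qed.

Lemma chn_order n : ~~ (p %| n)%N -> chn n ^+ 4 = 1.
Proof.
move=> pn; have [_ h _] := chi_order; rewrite /chn h /principal_character.
by rewrite coprimezE /= coprime_sym prime_coprime ?pn.
Qed.

Lemma chn_nontrivial j : (0 < j < 4)%N -> exists2 n, ~~ (p %| n)%N & chn n ^+ j != 1.
Proof.
move=> j4; have [_ _ /(_ j j4) h] := chi_order; have [_ _ _ nz] := chi_char.
have /andP[j0 _] := j4.
apply: contrapT => h1; apply: h => a; rewrite /principal_character.
case ca: (coprimez a p%:Z); last first.
  have := nz a; rewrite ca => /negbFE/eqP ->; by rewrite expr0n gtn_eqF.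
have [n [-> e]] := chi_nat a; apply/eqP/negPn/negP => hn; apply: h1; exists n => //.
by rewrite -e ca.
Qed.

Lemma modchar_of (f : nat -> R[i]) : f 1%N = 1 -> (forall a b, f (a * b)%N = f a * f b) ->
  (forall a, f a = f (a %% p)%N) -> (forall a, (p %| a)%N -> f a = 0) ->
  (forall a, ~~ (p %| a)%N -> f a ^+ 4 = 1) ->
  (exists2 n, ~~ (p %| n)%N & f n != 1) -> modchar p f.
Proof.
move=> f1 fM fmod f0 f4 [n pn fn]; split => //.
  move=> a pa; have /eqP := congr1 Num.norm (f4 a pa).
  by rewrite normrX normr1 pexprn_eq1 // => /eqP.
rewrite (sum_Fp p_prime); apply: (@sum_char _ _ (fun a : 'F_p => f a) _ n%:R).
- move=> a b; rewrite -fM [RHS]fmod; congr f.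
  by rewrite -val_Fp_nat // natrM !natr_Zp.
- by rewrite /= val_Fp_nat // -fmod.
- by rewrite Fp_nat_eq0.
Qed.

Lemma chn_modchar : modchar p chn.
Proof.
have [c1 cM _ nz] := chi_char.
apply: modchar_of => //.
- by move=> a b; rewrite /chn PoszM.
- exact: chn_mod.
- by move=> a pa; apply/eqP; rewrite -[_ == _]negbK chn_neq0 pa.
- exact: chn_order.
- by have [n pn h] := @chn_nontrivial 1 isT; exists n.
Qed.

Lemma psin_modchar : modchar p psin.
Proof.
have cc := chn_modchar; apply: modchar_of; rewrite /psin.
- by rewrite (mc1 cc) mulr1.
- by move=> a b; rewrite (mcM cc); ring.
- by move=> a; rewrite -chn_mod.
- by move=> a pa; rewrite (mc0 cc pa) mulr0.
- by move=> a pa; rewrite -expr2 -exprM mulnC exprM chn_order // expr1n.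
- by have [n pn h] := @chn_nontrivial 2 isT; exists n; rewrite // -expr2.
Qed.

Lemma chn_F_expr (g : 'F_p) k : chn (g ^+ k)%R = chn g ^+ k.
Proof.
have cc := chn_modchar.
elim: k => [|k IH]; last by rewrite exprS (mcFM p_prime cc) IH exprS.
by rewrite !expr0 -[X in chn X](_ : 1 = _) ?(mc1 cc) //= -[1]/(1%:R) val_Fp_nat // modn_small.
Qed.

(** If the square were [1] at a generator, [chi ^ 2] would be principal, against the exact order
    [4]. *)
Lemma quartic_generator : exists g : 'F_p, p.-1.-primitive_root g /\ chn g ^+ 2 = -1.
Proof.
have cc := chn_modchar; have [g gp] := Fp_generator p_prime; exists g; split=> //.
have pm0 : (0 < p.-1)%N by rewrite -ltnS prednK // ltnW.
have g0 : g != 0.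
  by apply/eqP => g0; have := prim_expr_order gp; rewrite g0 expr0n gtn_eqF.
have z4 : chn g ^+ 4 = 1 by apply: chn_order; exact: Fp_ndvd.
have : (chn g ^+ 2 - 1) * (chn g ^+ 2 + 1) = 0.
  by have -> : (chn g ^+ 2 - 1) * (chn g ^+ 2 + 1) = chn g ^+ 4 - 1 by [ring]; rewrite z4 subrr.
move/eqP; rewrite mulf_eq0 => /orP[|]; last by rewrite addr_eq0 => /eqP.
rewrite subr_eq0 => /eqP z2; exfalso.
have [n pn /negP[]] := @chn_nontrivial 2 isT.
have n0 : (n%:R : 'F_p) != 0 by rewrite Fp_nat_eq0.
have [i ei] : exists i : nat, (n%:R : 'F_p) = g ^+ i.
  have h : (n%:R : 'F_p) ^+ p.-1 = 1.
    apply: (mulfI n0); rewrite -exprS prednK ?(ltnW p1) // mulr1.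
    by have := expf_card (n%:R : 'F_p); rewrite card_Fp.
  by have [i ->] := prim_rootP gp h; exists i.
by rewrite (mc_nat p_prime cc) ei chn_F_expr exprAC z2 expr1n.
Qed.

(** As [p] is [5] modulo [8], [p - 1 = 4 * h] with [h] odd. Then [g ^ h] has order [4], and [chi]
    squared takes the value [(-1) ^ h = -1] there. This makes [chi] odd. *)
Lemma Fp_sqrtN1 : exists2 I : 'F_p, I ^+ 2 = -1 & chn I ^+ 2 = -1.
Proof.
have [g [gp gz]] := quartic_generator.
have ep : p = (8 * (p %/ 8) + 5)%N by rewrite {1}(divn_eq p 8) p_mod8 mulnC.
set k := (p %/ 8)%N in ep.
have e4 : p.-1 = (4 * (2 * k + 1))%N by rewrite ep; lia.
pose h := (2 * k + 1)%N; rewrite -/h in e4.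
exists (g ^+ h).
  rewrite -exprM; apply/eqP; have : (g ^+ (h * 2) - 1) * (g ^+ (h * 2) + 1) = 0.
    have -> : (g ^+ (h * 2) - 1) * (g ^+ (h * 2) + 1) = (g ^+ (h * 2)) ^+ 2 - 1 by ring.
    by rewrite -exprM (_ : h * 2 * 2 = p.-1)%N ?(prim_expr_order gp) ?subrr // e4; lia.
  move/eqP; rewrite mulf_eq0 => /orP[|]; last by rewrite addr_eq0.
  rewrite subr_eq0 -(prim_order_dvd gp) => /dvdn_leq; rewrite e4 /h => hh.
  by exfalso; have := hh _; lia.
rewrite chn_F_expr -exprM mulnC exprM gz /h exprD expr1 exprM sqrrN !expr1n mul1r //.
Qed.

Lemma chn_N1 : chn (-1 : 'F_p)%R = -1.
Proof.
have [I I2 cI] := Fp_sqrtN1.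
by rewrite -I2 chn_F_expr.
Qed.

Lemma psin_N1 : psin (-1 : 'F_p)%R = 1.
Proof. by rewrite /psin chn_N1 mulrNN mulr1. Qed.

Lemma psin_sqr n : ~~ (p %| n)%N -> psin n * psin n = 1.
Proof. by move=> pn; rewrite /psin -(chn_order pn); ring. Qed.

(** [psin] with integer values, since [quadratic_reciprocity] has to read them in characteristic
    [q]. *)
Definition psiz (a : 'F_p) : int := if a == 0 then 0 else if psin a == 1 then 1 else -1.

Lemma psizE (a : 'F_p) : psin a = (psiz a)%:~R.
Proof.
have pc := psin_modchar; rewrite /psiz; case: eqP => [->|/eqP a0]; first by rewrite (mc_F0 pc).
have h := psin_sqr (Fp_ndvd p_prime a0).
case: eqP => [-> //|ne].
have : (psin a - 1) * (psin a + 1) = 0.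
  by have -> : (psin a - 1) * (psin a + 1) = psin a * psin a - 1 by [ring]; rewrite h subrr.
by move/eqP; rewrite mulf_eq0 subr_eq0 => /orP[/eqP //|]; rewrite addr_eq0 => /eqP.
Qed.

(* If [I ^+ 2 = -1] then [(1 + I) ^+ 2 = 2 * I], and [psin I = chn (-1)]. *)
Lemma psin_two : psin 2 = -1.
Proof.
have pc := psin_modchar; have [I I2 cI] := Fp_sqrtN1.
have I10 : 1 + I != 0.
  apply/eqP => /eqP; rewrite addr_eq0 => /eqP e; move: I2; rewrite -sqrrN -e expr1n => /eqP.
  rewrite -addr_eq0 -[1 + 1]/(2%:R) Fp_nat_eq0 // => /dvdn_leq => h.
  have := h isT; move: p_mod8; move: p1 => h1 h2 h3.
  have e2 : p = 2%N by lia.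
  by move: h2; rewrite e2.
have e : (1 + I) * (1 + I) = 2%:R * I by have -> : (1 + I) * (1 + I) = 1 + I ^+ 2 + 2%:R * I by [ring]; rewrite I2 subrr add0r.
have := psin_sqr (Fp_ndvd p_prime I10).
rewrite -(mcFM p_prime pc) e (mcFM p_prime pc) -(mc_nat p_prime pc).
rewrite {2}/psin -expr2 cI mulrN1 => <-; by rewrite opprK.
Qed.

Lemma psin_prime q : prime q -> psin q = (kronecker_prime p%:Z q)%:~R.
Proof.
move=> q_pr; have pc := psin_modchar.
have ep : p = (8 * (p %/ 8) + 5)%N by rewrite {1}(divn_eq p 8) p_mod8 mulnC.
rewrite /kronecker_prime; case: eqP => [->|q2].
  rewrite psin_two; have -> : (2 %| p%:Z)%Z = false by rewrite ep; lia.
  have -> : (p%:Z %% 8)%Z = 5 by rewrite ep; lia.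
  by [].
rewrite /legendre; case: ifP => [qp|qp].
  have : (q %| p)%N by [].
  rewrite dvdn_prime2 // => /eqP ->; by rewrite (mc0 pc).
have [|qodd] := even_prime q_pr; first by move/q2.
have pq : p != q by apply: contraFneq qp => ->; exact: dvdzz.
have inj := @intr_inj R[i].
have [n pn hn] := @chn_nontrivial 2 isT.
have n0 : (n%:R : 'F_p) != 0 by rewrite Fp_nat_eq0.
have psn1 : psiz n%:R = -1.
  by rewrite /psiz (negPf n0) -(mc_nat p_prime pc) /psin -expr2 (negPf hn).
have := @quadratic_reciprocity p q psiz n%:R p_prime q_pr pq qodd.
have eM a b : psiz (a * b) = psiz a * psiz b.
  by apply: inj; rewrite rmorphM /= -!psizE (mcFM p_prime pc).
have esq a : a != 0 -> psiz a * psiz a = 1.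
  by move=> a0; apply: inj; rewrite rmorphM /= -!psizE psin_sqr // Fp_ndvd.
have eN : psiz (-1) = 1 by apply: inj; rewrite -psizE psin_N1.
have e0 : psiz 0 = 0 by rewrite /psiz eqxx.
move=> /(_ e0 eM esq (conj n0 psn1) eN) <-.
have q0 : (q%:R : 'F_p) != 0 by rewrite Fp_nat_eq0 // dvdn_prime2.
rewrite (mc_nat p_prime pc) psizE; have := esq _ q0.
by rewrite /psiz (negPf q0); case: (psin _ == 1).
Qed.

Lemma psin_kronecker n : (0 < n)%N -> psin n = kronecker_character R[i] p n%:Z.
Proof.
move=> n0; have pc := psin_modchar.
rewrite /kronecker_character /kronecker eqz_nat gtn_eqF // ltz_nat /= mul1r.
rewrite rmorph_prod {1}(prod_prime_decomp n0) prime_decompE big_map /=.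
rewrite (big_morph psin (mcM pc) (mc1 pc)) big_seq [RHS]big_seq; apply: eq_bigr => q.
rewrite mem_primes => /and3P[q_pr _ _]; rewrite rmorphXn /= -psin_prime //.
elim: (logn q n) => [|k IH]; first by rewrite expn0 (mc1 pc).
by rewrite expnS (mcM pc) IH exprS.
Qed.

(** The recursion at [0], [1], [2] is solved for the second number; the number of index [0] vanishes
    because the character sums to zero. *)
Lemma gen_bernoulli_psi : gen_bernoulli p (kronecker_character R[i] p) 2 = bern2 p psin.
Proof.
have p0 : (0 < p)%N by rewrite ltnW.
have pC : p%:R != 0 :> R[i] by rewrite pnatr_eq0 -lt0n.
have pc := psin_modchar.
set ka := kronecker_character R[i] p; set B := gen_bernoulli p ka.
have S (G : nat -> R[i]) : \sum_(1 <= a < p.+1) ka a%:Z * G a = \sum_(1 <= a < p) psin a * G a.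
  rewrite big_nat_recr //= -[ka p%:Z]psin_kronecker // (mc0 pc) // mul0r addr0.
  rewrite big_nat_cond [RHS]big_nat_cond; apply: eq_bigr => a /andP[/andP[a0 _] _].
  by rewrite psin_kronecker.
have b0 := @gen_bernoulliP _ p ka 0 p0; have b1 := @gen_bernoulliP _ p ka 1 p0.
have b2 := @gen_bernoulliP _ p ka 2 p0.
move: b0 b1 b2; rewrite !S !big_ord_recr !big_ord0 /= -/(B 0%N) -/(B 1%N) -/(B 2%N).
rewrite !fact0 !factS !fact0 /= !add0r !muln1.
have -> : \sum_(1 <= a < p) psin a * (a%:R ^+ 0 / 1) = 0.
  rewrite -[RHS](mc_sumF p_prime pc) -(sum_Fp p_prime psin) -(big_mkord predT psin) [RHS]big_ltn //.
  rewrite (mc0 pc) ?dvdn0 // add0r; apply: eq_bigr => a _; by rewrite expr0 divr1 mulr1.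
move=> b0 b1 b2.
have B0 : B 0%N = 0.
  by move/eqP: b0; rewrite eq_sym !divr1 mulf_eq0 expf_eq0 (negPf pC) andbF orbF => /eqP.
rewrite B0 !mul0r !add0r in b1 b2.
have B2 : B 2%N = 2 / p%:R * (\sum_(1 <= a < p) psin a * (a%:R ^+ 2 / 2%:R) - B 1%N / 1%:R * (p%:R ^+ 2 / 2%:R)).
  by rewrite b2; field.
have B1 : B 1%N = p%:R^-1 * \sum_(1 <= a < p) psin a * (a%:R ^+ 1 / 1%:R) by rewrite b1; field.
rewrite B2 B1 /bern2 !mulr_sumr !mulr_suml -sumrB mulr_sumr; apply: eq_bigr => a _.
by field.
Qed.

End Quartic.

(** * Limits *)

Local Open Scope classical_set_scope.
Local Open Scope ring_scope.
Local Open Scope complex_scope.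

Lemma sum_divisors_rev (V : nmodType) (F : nat -> V) n : (0 < n)%N ->
  \sum_(d <- divisors n) F d = \sum_(d <- divisors n) F (n %/ d)%N.
Proof.
move=> n0; rewrite -(big_map (fun d => n %/ d)%N predT F); apply: perm_big.
have K d : (d %| n)%N -> (n %/ (n %/ d))%N = d.
  move=> dn; have dn0 : (0 < n %/ d)%N by rewrite divn_gt0 ?(dvdn_gt0 n0 dn) // dvdn_leq.
  by rewrite -{1}(divnK dn) mulKn.
have dd d : (d %| n)%N -> (n %/ d %| n)%N by move=> dn; rewrite -{2}(divnK dn) dvdn_mulr.
have inj : {in divisors n &, injective (fun d => n %/ d)%N}.
  by move=> a b; rewrite -!dvdn_divisors // => an bn e; rewrite -(K a an) -(K b bn) e.
apply: uniq_perm; rewrite ?divisors_uniq ?map_inj_in_uniq ?divisors_uniq //.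
move=> d; apply/idP/mapP => [|[a]]; rewrite -!dvdn_divisors //.
  by move=> dn; exists (n %/ d)%N; rewrite -?dvdn_divisors ?dd ?K.
by move=> an ->; exact: dd.
Qed.

Section Convolutions.
Variables (R : realType) (p : nat) (f1 f2 : int -> R[i]).
Let h1 (a : nat) := f1 a%:Z.
Let h2 (a : nat) := f2 a%:Z.
Hypothesis h1_le1 : forall a, cabs (h1 a) <= 1.
Hypothesis h2_le1 : forall a, cabs (h2 a) <= 1.

Lemma conv_split n : (0 < n)%N ->
  \sum_(0 <= j < n.+1) delta p f1 j * delta p f2 (n - j) =
  quadruples n h1 h2 + (delta p f1 0 * delta p f2 n + delta p f1 n * delta p f2 0).
Proof.
move=> n0; rewrite big_ltn // big_nat_recr //= subn0 subnn quadruples_conv.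
have -> : \sum_(1 <= j < n) delta p f1 j * delta p f2 (n - j) =
    \sum_(1 <= j < n) (\sum_(a <- divisors j) h1 a) * (\sum_(c <- divisors (n - j)) h2 c).
  rewrite big_nat_cond [RHS]big_nat_cond; apply: eq_bigr => j /andP[/andP[j0 jn] _].
  by rewrite /delta !gtn_eqF // subn_gt0.
by rewrite addrCA.
Qed.

Lemma cabs_delta (f : int -> R[i]) n : (0 < n)%N -> (forall a : nat, cabs (f a%:Z) <= 1) ->
  cabs (delta p f n) <= (numdiv n)%:R.
Proof.
move=> n0 h; rewrite /delta gtn_eqF //; apply: (le_trans (cabs_sum _ _ _)).
rewrite /numdiv -sum1_size natr_sum; exact: ler_sum.
Qed.

(** The boundary terms [j = 0] and [j = n] are only [O(numdiv n)]. *)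
Lemma conv_asymp (M : nat -> R[i]) (P : nat -> Prop) (C : R) :
  (forall n w, 1 <= w -> w ^+ 128 = n%:R -> P n -> cabs (quadruples n h1 h2 - M n) <= C * w ^+ 125) ->
  exists C' : R, forall n w, 1 <= w -> w ^+ 128 = n%:R -> P n ->
    cabs (\sum_(0 <= j < n.+1) delta p f1 j * delta p f2 (n - j) - M n) <= C' * w ^+ 125.
Proof.
move=> h; have [c c1 hc] := small_bounds R.
exists (C + (cabs (delta p f1 0) + cabs (delta p f2 0)) * c) => n w w1 e Pn.
have [Y sc] := scale_ex w1 e; have [hn _] := hc _ _ _ sc.
have n0 : (0 < n)%N by have [_ _ Y0 YY _ _] := sc; apply: leq_trans YY; rewrite muln_gt0 Y0.
have n1 := cabs_delta n0 h1_le1; have n2 := cabs_delta n0 h2_le1.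
rewrite conv_split // addrAC; move: (delta p f1 0) (delta p f2 0) => d1 d2; apply: (le_trans (cabsD _ _)); rewrite mulrDl; apply: lerD; first exact: h.
apply: (le_trans (cabsD _ _)); rewrite !cabsM.
apply: (@le_trans _ _ ((cabs d1 + cabs d2) * (c * w))).
  rewrite [leRHS]mulrDl; apply: lerD; last rewrite mulrC.
    by rewrite ler_wpM2l ?cabs_ge0 // (le_trans n2).
  by rewrite ler_wpM2l ?cabs_ge0 // (le_trans n1).
rewrite mulrA ler_wpM2l ?mulr_ge0 ?addr_ge0 ?cabs_ge0 ?(le_trans ler01) //.
by rewrite -{1}[w]expr1 ler_weXn2l.
Qed.

End Convolutions.

(** The denominator is at least [n / numdiv n], of order at least [w ^ 127], and this beats the
    error [w ^ 125]. *)
Lemma ratio_limit (R : realType) (S sg : nat -> R[i]) (l : R[i]) (P : set nat) (C : R) :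
  (forall n w, 1 <= w -> w ^+ 128 = n%:R -> P n -> cabs (S n - sg n * l) <= C * w ^+ 125) ->
  (forall n, P n -> (0 < n)%N -> n%:R <= cabs (sg n) * (numdiv n)%:R) ->
  S n / sg n @[n --> within P \oo] --> (l : R[i]^o).
Proof.
move=> hS hsg; have [c c1 hc] := small_bounds R.
apply: (cvgrPdist_lt (V := R[i]^o) _ _).2 => /= e e0.
have [er er0] : exists2 er : R, 0 < er & e = er%:C.
  by move: e e0 => [a b]; rewrite ltcE /= => /andP[/eqP -> a0]; exists a.
move=> ->.
(* Chosen so that [w >= M] forces [|C| * c < er * w]. *)
pose M : R := 1 + `|C| * c / er.
have c0 : 0 <= c by apply: le_trans c1.
have Cc0 : 0 <= `|C| * c by rewrite mulr_ge0.
have M1 : 1 <= M by rewrite lerDl divr_ge0 // ltW.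
have M0 : 0 <= M by apply: le_trans M1.
exists (Num.truncn (M ^+ 128)).+1 => // n /= Nn Pn.
have n0 : (0 < n)%N by apply: leq_trans Nn.
have [w w1 ew] := scale_w R n0; have w0 : 0 < w by apply: lt_le_trans w1.
have [Y sc] := scale_ex w1 ew; have [hn _] := hc _ _ _ sc.
have Mw : M <= w.
  rewrite -(@ler_pXn2r _ 128) ?nnegrE ?(ltW w0) // ew.
  have /andP[_ h] := truncn_itv (exprn_ge0 128 M0); apply: (le_trans (ltW h)).
  by rewrite ler_nat.
have b1 := hS n w w1 ew Pn; have b2 := hsg n Pn n0.
have d0 : 0 < (numdiv n)%:R :> R by rewrite ltr0n numdiv_gt0.
have sg0 : 0 < cabs (sg n).
  by rewrite -(pmulr_lgt0 _ d0); apply: lt_le_trans b2; rewrite ltr0n.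
have sgn0 : sg n != 0 by rewrite -cabs_eq0 gt_eqF.
have -> : l - S n / sg n = - ((S n - sg n * l) / sg n) by field.
rewrite cabsE ltcR cabsN cabsM cabsV ltr_pdivrMr //.
apply: (le_lt_trans b1); rewrite -(ltr_pM2r d0) -mulrA.
have b3 : er * w ^+ 128 <= er * cabs (sg n) * (numdiv n)%:R.
  by rewrite ew -mulrA ler_pM2l.
apply: lt_le_trans b3.
apply: (@le_lt_trans _ _ (`|C| * (w ^+ 125 * (c * w)))).
  apply: (@le_trans _ _ (`|C| * (w ^+ 125 * (numdiv n)%:R))).
    by rewrite ler_wpM2r ?ler_norm // mulr_ge0 ?exprn_ge0 // ltW.
  by rewrite ler_wpM2l // ler_wpM2l // exprn_ge0 // ltW.
have h : `|C| * c < er * w.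
  rewrite -ltr_pdivrMl // mulrC; apply: lt_le_trans Mw; by rewrite ltrDr.
have -> : `|C| * (w ^+ 125 * (c * w)) = (`|C| * c) * w ^+ 126 by rewrite (exprSr w 125); ring.
apply: (@lt_le_trans _ _ (er * w * w ^+ 126)); first by rewrite ltr_pM2r ?exprn_gt0.
by rewrite -mulrA -exprS ler_pM2l // ler_weXn2l.
Qed.

Section Twisted.
Variables (R : realType) (T : nat -> R[i]).
Hypothesis TM : forall a b, T (a * b)%N = T a * T b.
Hypothesis T1 : T 1%N = 1.

(** Replace [d] by [n %/ g]; as [T g] is its own inverse, [T (n %/ g) = T n * T g]. *)
Lemma twisted_sigmaE n : (0 < n)%N -> (forall g, (g %| n)%N -> T g * T g = 1) ->
  \sum_(d <- divisors n) T d * d%:R = T n * (n%:R * \sum_(1 <= g < n.+1 | (g %| n)%N) T g / g%:R).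
Proof.
move=> n0 hT; rewrite sum_divisors_rev // sum_divisors // !mulr_sumr.
rewrite big_nat_cond [RHS]big_nat_cond; apply: eq_bigr => g /andP[/andP[g0 _] gn].
have gC : g%:R != 0 :> R[i] by rewrite pnatr_eq0 -lt0n.
have en : n = ((n %/ g) * g)%N by rewrite divnK.
have -> : T n = T (n %/ g)%N * T g by rewrite {1}en TM.
have -> : n%:R = (n %/ g)%N%:R * g%:R :> R[i] by rewrite -natrM -en.
have h := hT g gn; transitivity (T (n %/ g)%N * (n %/ g)%:R * (T g * T g)); first by rewrite h mulr1.
by move: (T g) (T _) ((n %/ g)%N%:R) => a b m; field.
Qed.

Lemma twisted_sigma_lower n : (0 < n)%N -> (forall g, (g %| n)%N -> T g * T g = 1) ->
  n%:R <= cabs (\sum_(d <- divisors n) T d * d%:R) * (numdiv n)%:R.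
Proof.
move=> n0 hT; have h := @twisted_sigma_ge R[i] T n n0 T1 TM.
rewrite -lecR rmorphM /= -cabsE !rmorph_nat; apply: h => q _ qn.
have /eqP := congr1 Num.norm (hT q qn).
by rewrite normrM -expr2 normr1 pexprn_eq1 // => /eqP.
Qed.

End Twisted.

(** * Evaluation of the limits *)

Section LimitConstants.
Variables (R : realType) (p : nat) (chi : int -> R[i]).
Hypotheses (p_prime : prime p) (p_mod8 : (p %% 8 = 5)%N).
Hypothesis chi_char : dirichlet_character p chi.
Hypothesis chi_order : has_exact_order p chi 4.

Let cc := chn_modchar p_prime chi_char chi_order.
Let tc := modchar_conj cc.
Let pc := psin_modchar p_prime chi_char chi_order.
Let f := chn chi.
Let psi := psin chi.
Let p1 : (1 < p)%N. Proof. exact: prime_gt1. Qed.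
Let pC : p%:R != 0 :> R[i]. Proof. by rewrite pnatr_eq0 -lt0n ltnW. Qed.

(** [A] is [L(1, chi)] and [B] is [L(1, .)] of the conjugate: [Lapprox_odd] expresses each series
    through the Gauss sum and [delta0] of the conjugate character. *)
Let A : R[i] := 2 * 'i * pi%:C / tau p (thc f) * delta0 p (thc f).
Let B : R[i] := 2 * 'i * pi%:C / tau p f * delta0 p f.

Lemma thcK (k : nat -> R[i]) : thc (thc k) = k.
Proof. by apply/funext => a; rewrite !thcE conjCK. Qed.

Lemma chn_odd : f (-1 : 'F_p)%R = -1. Proof. exact: chn_N1. Qed.

Lemma Lapprox_conj_chn : Lapprox (thc f) B.
Proof. by apply: Lapprox_odd => //; [exact: chn_odd | exact: tau_neq0]. Qed.

Lemma Lapprox_chn : Lapprox f A.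
Proof.
rewrite -[X in Lapprox X _](thcK f); apply: Lapprox_odd => //; last exact: tau_neq0.
by rewrite thcE chn_odd rmorphN1.
Qed.

Lemma tau_prod : tau p f * tau p (thc f) = - p%:R.
Proof. by rewrite tau_mul_thc // chn_odd mulN1r. Qed.

Lemma i_sqr : ('i : R[i]) * 'i = -1.
Proof. by apply/eqP; rewrite eq_complex /=; apply/andP; split; apply/eqP; ring. Qed.

Lemma piC_neq0 : (pi%:C : R[i]) != 0.
Proof. by rewrite -cabs_eq0 cabs_real normr_eq0 gt_eqF // pi_gt0. Qed.

Let f_unit g : ~~ (p %| g)%N -> f g * thc f g = 1.
Proof. by move=> pg; rewrite thcE -normCK (mc_norm cc pg) expr1n. Qed.

Let T0 := hh f (thc f).

Lemma principalE g : T0 g = (~~ (p %| g)%N)%:R.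
Proof.
rewrite /T0 /hh; case: (boolP (p %| g)%N) => pg /=; last exact: f_unit.
by rewrite /f (mc0 cc pg) mul0r.
Qed.

Lemma principalM a b : T0 (a * b)%N = T0 a * T0 b.
Proof. by rewrite !principalE Euclid_dvdM // negb_or -mulnb natrM. Qed.

Lemma ndvd_div n g : ~~ (p %| n)%N -> (g %| n)%N -> ~~ (p %| g)%N.
Proof. by move=> pn gn; apply: contra pn => /dvdn_trans; apply. Qed.

Lemma sigma'E n : (0 < n)%N -> ~~ (p %| n)%N -> sigma' R[i] p n = \sum_(d <- divisors n) T0 d * d%:R.
Proof.
move=> n0 pn; rewrite /sigma' gtn_eqF // big_mkcond; apply: eq_bigr => d _; rewrite principalE.
by case: (_ %| _)%N; rewrite ?mul0r ?mul1r.
Qed.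

Let La : R[i] := pi%:C ^+ 2 / 6 * (1 - p%:R^-1 ^+ 2).

Lemma p_sub1 : (p%:R - 1 : R[i]) != 0.
Proof. by rewrite subr_eq0 (eqr_nat _ p 1) gtn_eqF. Qed.

Lemma p_add1 : (p%:R + 1 : R[i]) != 0.
Proof. by rewrite natr1 pnatr_eq0. Qed.

(** The two main terms have ratio [jac / p = 1 / p], since [chi (-1) = -1]. The factor [1 + 1 / p]
    reduces [1 - 1 / p ^ 2] to [1 - 1 / p], and the two Gauss sums multiply to [- p]. *)
Lemma alphaE : A * B / La * (1 + p%:R^-1) = alpha p chi.
Proof.
have dc : delta0 p (thc f) = (delta0 p f)^*.
  rewrite /delta0 rmorphM rmorphN fmorphV rmorphM !rmorph_nat rmorph_sum; congr (_ * _).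
  by apply: eq_bigr => a _; rewrite rmorphM rmorph_nat.
have -> : alpha p chi = (delta0 p f * delta0 p (thc f)) * 24 / (p%:R - 1).
  by rewrite /alpha /sigma' /= normCK dc invf_div mulrA.
have t0 := tau_neq0 p_prime cc; have t1 := tau_neq0 p_prime tc; have tp := tau_prod.
have i2 := i_sqr; have pi0 := piC_neq0; have q1 := p_sub1; have q2 := p_add1.
rewrite /A /B /La; move: t0 t1 tp; rewrite -/f.
move: (tau p f) (tau p (thc f)) (delta0 p f) (delta0 p (thc f)) => t t' d d' t0 t1 tp.
move: (pi%:C) pi0 => x x0.
have V0 : 1 - p%:R^-1 ^+ 2 != 0 :> R[i].
  have -> : 1 - p%:R^-1 ^+ 2 = (p%:R - 1) * (p%:R + 1) / p%:R ^+ 2 :> R[i] by field.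
  by rewrite !mulf_neq0 ?invr_eq0 ?expf_neq0.
transitivity (('i * 'i) * 24 * d * d' / (t * t') * (1 + p%:R^-1) / (1 - p%:R^-1 ^+ 2)).
  set V := 1 - p%:R^-1 ^+ 2 in V0 *; set U := 1 + p%:R^-1; clearbody V U.
  by field; rewrite V0 x0 t0 t1.
have -> : 1 - p%:R^-1 ^+ 2 = (p%:R - 1) * (p%:R + 1) / p%:R ^+ 2 :> R[i] by field.
rewrite i2 tp; move: (p%:R : R[i]) pC q1 q2 => P P0 P1 P2.
by field; rewrite P0 P1 P2.
Qed.

Lemma conv_F_limit : conv_F p chi n / sigma' _ p n @[n --> within [set n : nat | ~~ (p %| n)%N] \oo]
     --> (alpha p chi : R[i]^o).
Proof.
have hLa : L2approx T0 La by apply: L2approx_principal => // n; exact: principalE.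
have hLb : L2approx (hh (thc f) (thc (thc f))) La.
  have -> // : hh (thc f) (thc (thc f)) = T0 by apply/funext => a; rewrite thcK /hh mulrC.
have T01 : T0 1%N = 1 by rewrite principalE dvdn1 gtn_eqF.
have La0 : La != 0.
  by apply: (L2approx_neq0 T01 _ hLa) => a; apply: hh_le1 => b; [exact: modchar_le1 cc|exact: modchar_le1 tc].
have fLt' : Lapprox (thc (thc f)) A by rewrite thcK; exact: Lapprox_chn.
have [C C0 hC] := quadruples_asymp p_prime cc tc Lapprox_chn Lapprox_conj_chn Lapprox_conj_chn fLt' La0 La0 hLa hLb.
have h1 a : cabs (chi a%:Z) <= 1 by exact: modchar_le1 cc.
have h2 a : cabs (conj_character chi a%:Z) <= 1 by exact: modchar_le1 tc.
have [|C' hC'] := @conv_asymp R p chi (conj_character chi) h1 h2 (fun n => sigma' R[i] p n * alpha p chi) (fun n => ~~ (p %| n)%N) C.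
  move=> n w w1 e pn; have n0 : (0 < n)%N by rewrite lt0n; apply: contraNneq pn => ->.
  suff <- : n%:R * (divsum n f (thc f) * (A * B / La)) + f n * thc f n * (jac p f (thc f) / p%:R) *
    (n%:R * (divsum n (thc f) (thc (thc f)) * (B * A / La))) = sigma' R[i] p n * alpha p chi by exact: hC.
  rewrite sigma'E // (twisted_sigmaE principalM) //; last first.
    by move=> g gn; rewrite principalE (ndvd_div pn gn) mulr1.
  have -> : divsum n (thc f) (thc (thc f)) = divsum n f (thc f).
    by rewrite /divsum thcK; apply: eq_bigr => g _; rewrite /hh [f g * _]mulrC.
  rewrite -[\sum_(1 <= g < n.+1 | _) _]/(divsum n f (thc f)) principalE pn f_unit // jac_thc // chn_odd opprK.
  rewrite -alphaE /= !mul1r; move: (divsum _ _ _) (p%:R^-1) (La^-1) => D iP iL; ring.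
apply: ratio_limit hC' _ => n pn n0; rewrite sigma'E //.
apply: (twisted_sigma_lower principalM T01) => // g gn.
by rewrite principalE (ndvd_div pn gn) mulr1.
Qed.

Lemma thc_psi : thc psi = psi.
Proof. by apply/funext => a; rewrite thcE /psi (mc_nat p_prime pc) (psizE p_prime chi_char chi_order) rmorph_int. Qed.

Lemma sigma_tildeE n : (0 < n)%N -> sigma_tilde R[i] p n = \sum_(d <- divisors n) psi d * d%:R.
Proof.
move=> n0; rewrite /sigma_tilde gtn_eqF // big_seq [RHS]big_seq; apply: eq_bigr => d.
by rewrite -dvdn_divisors // => dn; rewrite -(psin_kronecker p_prime p_mod8 chi_char chi_order) // (dvdn_gt0 n0 dn).
Qed.

Let Lp : R[i] := pi%:C ^+ 2 / (p%:R * tau p psi) * bern2 p psi.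

(** The Jacobi sum times [tau psi] is [tau f ^ 2], so all Gauss sums cancel. That the Bernoulli
    number is nonzero follows from [Lp != 0]. *)
Lemma alpha'E : Lp != 0 -> jac p f f / p%:R * (B * B / Lp) = alpha' p chi.
Proof.
move=> Lp0; have b0 : bern2 p psi != 0 by apply: contraNneq Lp0 => b0; rewrite /Lp b0 mulr0.
have -> : alpha' p chi = delta0 p f ^+ 2 / (- (1 / 4) * bern2 p psi).
  by rewrite /alpha' /sigma_tilde /= (gen_bernoulli_psi p_prime p_mod8 chi_char chi_order).
have t0 := tau_neq0 p_prime cc; have t1 := tau_neq0 p_prime pc; have i2 := i_sqr; have pi0 := piC_neq0.
have jt := jac_tau p_prime cc (fun=> erefl) pc.
rewrite /B /Lp; move: t0 t1 jt b0; rewrite -/f -/psi.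
move: (tau p f) (tau p psi) (jac p f f) (bern2 p psi) (delta0 p f) => t s J b d t0 s0 jt b0.
move: (pi%:C) pi0 => x x0.
transitivity (('i * 'i) * 4 * d ^+ 2 * (J * s) / (t ^+ 2 * b)).
  by field; rewrite b0 x0 t0 s0 pC.
by rewrite i2 jt; field; rewrite b0 t0.
Qed.

(** Both main terms contain [n] times the sum of [psi g / g], which is [psi n * sigma_tilde n]. For
    large [a], [c] this sign cancels against [f n * f n = psi n] and leaves [alpha']; for small [a],
    [c] it remains, as [eps], and [gamma] is [L(1, chi) ^ 2 / L(2, psi)]. *)
Lemma conv_H_limit : exists gamma : R[i], forall eps : int, eps = 1 \/ eps = -1 ->
    conv_H p chi n / sigma_tilde _ p n
      @[n --> within [set n : nat | ~~ (p %| n)%N /\ kronecker p%:Z n%:Z = eps] \oo]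
      --> (alpha' p chi + eps%:~R * gamma : R[i]^o).
Proof.
have hLb : L2approx psi Lp.
  rewrite -[X in L2approx X _]thc_psi; apply: L2approx_even => //; first exact: psin_N1.
  exact: tau_neq0.
have Lp0 : Lp != 0 by apply: (L2approx_neq0 (mc1 pc) _ hLb) => a; exact: modchar_le1 pc.
have hLc : L2approx (hh (thc f) (thc f)) Lp.
  have -> // : hh (thc f) (thc f) = psi.
  by rewrite -thc_psi; apply/funext => a; rewrite /hh !thcE -rmorphM.
have [C C0 hC] := quadruples_asymp p_prime cc cc Lapprox_chn Lapprox_chn Lapprox_conj_chn Lapprox_conj_chn Lp0 Lp0 hLb hLc.
have h1 a : cabs (chi a%:Z) <= 1 by exact: modchar_le1 cc.
have psi2 n g : ~~ (p %| n)%N -> (g %| n)%N -> psi g * psi g = 1.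
  by move=> pn gn; apply: (@psin_sqr R p chi) => //; exact: ndvd_div gn.
exists (A * A / Lp) => eps _.
have [|C' hC'] := @conv_asymp R p chi chi h1 h1 (fun n => sigma_tilde R[i] p n * (alpha' p chi + eps%:~R * (A * A / Lp)))
    (fun n => ~~ (p %| n)%N /\ kronecker p%:Z n%:Z = eps) C.
  move=> n w w1 e [pn en]; have n0 : (0 < n)%N by rewrite lt0n; apply: contraNneq pn => ->.
  suff <- : n%:R * (divsum n f f * (A * A / Lp)) + f n * f n * (jac p f f / p%:R) *
    (n%:R * (divsum n (thc f) (thc f) * (B * B / Lp))) =
     sigma_tilde R[i] p n * (alpha' p chi + eps%:~R * (A * A / Lp)) by exact: hC.
  have epsE : eps%:~R = psi n by rewrite /psi (psin_kronecker p_prime p_mod8 chi_char chi_order) // /kronecker_character en.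
  have sqn := psi2 n n pn (dvdnn n).
  rewrite sigma_tildeE // (twisted_sigmaE (mcM pc)) //; last by move=> g; exact: psi2.
  have -> : divsum n (thc f) (thc f) = divsum n f f.
    rewrite /divsum; apply: eq_bigr => g _; congr (_ / _).
    by rewrite -[RHS]/(psi g) -thc_psi /hh !thcE -rmorphM.
  rewrite -[\sum_(1 <= g < n.+1 | _) _]/(divsum n f f) epsE -(alpha'E Lp0) -[f n * f n]/(psi n).
  rewrite [RHS]mulrDr [LHS]addrC; congr (_ + _).
    rewrite -/psi; move: (divsum _ _ _) (p%:R^-1) (Lp^-1) => D iP iL.
    by move: (psi n) (jac p f f) A B n%:R => a1 a2 a3 a4 a5; ring.
  rewrite -[LHS]mul1r -sqn -/psi; move: (divsum _ _ _) (Lp^-1) => D iL; ring.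
apply: ratio_limit hC' _ => n [pn _] n0; rewrite sigma_tildeE //.
by apply: (twisted_sigma_lower (mcM pc) (mc1 pc)) => // g; exact: psi2.
Qed.

End LimitConstants.

Theorem theorem2 (R : realType) (p : nat) (chi : int -> R[i])
    (p_prime : prime p) (p_mod8 : (p %% 8 = 5)%N)
    (chi_char : dirichlet_character p chi)
    (chi_order : has_exact_order p chi 4) :
  (conv_F p chi n / sigma' _ p n @[n --> within [set n : nat | ~~ (p %| n)%N] \oo]
     --> (alpha p chi : R[i]^o))
  /\
  exists gamma : R[i], forall eps : int, eps = 1 \/ eps = -1 ->
    conv_H p chi n / sigma_tilde _ p n
      @[n --> within [set n : nat | ~~ (p %| n)%N /\ kronecker p%:Z n%:Z = eps] \oo]
      --> (alpha' p chi + eps%:~R * gamma : R[i]^o).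
Proof. by split; [exact: conv_F_limit | exact: conv_H_limit]. Qed.
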